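(* Let $m\ge 1$, $\kappa\ge 0$, $0<\alpha_j<1$ for $1\le j\le m$, $\alpha=\min_{1\le j\le m}\alpha_j$, $0<T<\infty$, and let $A,B_1,\dots,B_m$ be operators in the Hilbert space $\mathbf H$ as described in the context. Let $v$ be the solution of $$v'(t)+Av(t)+\sum_{j=1}^m\int_0^t\omega_{\alpha_j}(t-s)B_jv(s)\,ds-\kappa v(t)=g(t),\quad t>0,\qquad v(0)=u_0 ,$$ where $\omega_{\alpha_j}(t)=t^{\alpha_j-1}/\Gamma(\alpha_j)$. Suppose that for some positive constant $C$ $$\|Au_0-g(0)\|+\|g(t)\|\le C,\qquad \|E'(t)(Au_0-g(0))\|+\|g'(t)\|+t\|g''(t)\|\le Ct^{\alpha-1},\qquad 0<t\le T,$$ where $E(t)=\exp(-At)$. Then there is a positive constant $C$, independent of $t$, such that $$\|v''(t)\|+\|Av'(t)\|\le Ct^{\alpha-1}\|u_0\|_2,\qquad t\in(0,T].$$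
   Context: $\mathbf H$ is a Hilbert space with inner product $(\cdot,\cdot)$ and norm $\|\cdot\|$ (in the setting considered, $\mathbf H=L_2(\Omega)$ with $\Omega\subseteq\mathbb R^d$ a Lipschitz domain). $A$ is a self-adjoint positive-definite linear operator, not necessarily bounded, with compact inverse, defined on a dense subspace $D(A)\subset\mathbf H$. Set $\|w\|_q=\|A^{q/2}w\|=(A^qw,w)^{1/2}$, so $\|w\|_2=\|Aw\|$. Each $B_j$ ($1\le j\le m$) is a self-adjoint linear operator in $\mathbf H$ with $D(B_j)\supset D(A)$, and $A$ dominates $B_j$ in the sense that $|(B_jw,v)|\le C\|w\|_q\|v\|_\vartheta$ for $\vartheta=0,1,2$ and $\vartheta+q=2$. $E(t)=\exp(-At)$ is the analytic semigroup generated by $-A$, and primes denote derivatives in $t$. $C$ denotes a generic positive constant, not necessarily the same at each occurrence.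
   Formalization: The theorem assumes u0 ≠ 0, since for u0 = 0 the right-hand side vanishes and the bound fails (e.g. B_j = 0, κ = 0, g a constant eigenvector of A), and it makes explicit that g is continuous on [0,T], so that g(0) is the limit of g(t) as t → 0. *)

(* Defs.v *)
From Stdlib Require Import Reals.
From Coquelicot Require Export Coquelicot.
Open Scope R_scope.

(** Real scalars.  A complex Hilbert space is covered through its underlying
    real Hilbert space, with inner product the real part. *)
Record HilbertSpace := {
  hs_car :> CompleteNormedModule R_AbsRing;
  inner : hs_car -> hs_car -> R;
  inner_sym : forall x y, inner x y = inner y x;
  inner_plus_l : forall x y z, inner (plus x y) z = inner x z + inner y z;
  inner_scal_l : forall (a : R) x y, inner (scal a x) y = a * inner x y;
  inner_norm : forall x, inner x x = norm x ^ 2 }.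

Arguments inner {h} x y.

(** A possibly unbounded linear operator: the values of [op_fun] outside
    [dom] are irrelevant. *)
Record operator (H : HilbertSpace) := {
  dom : H -> Prop;
  op_fun :> H -> H;
  dom_zero : dom zero;
  dom_plus : forall x y, dom x -> dom y -> dom (plus x y);
  dom_scal : forall (a : R) x, dom x -> dom (scal a x);
  op_plus : forall x y, dom x -> dom y ->
    op_fun (plus x y) = plus (op_fun x) (op_fun y);
  op_scal : forall (a : R) x, dom x ->
    op_fun (scal a x) = scal a (op_fun x) }.

Arguments dom {H} o x.

Definition dense {H : HilbertSpace} (D : H -> Prop) : Prop :=
  forall (x : H) (eps : R), 0 < eps -> exists w, D w /\ norm (minus w x) < eps.

(** [f] is the value at [u] of the adjoint of [A]. *)
Definition is_adjoint_at {H : HilbertSpace} (A : operator H) (u f : H) : Prop :=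
  forall w, dom A w -> inner (A w) u = inner w f.

Definition self_adjoint {H : HilbertSpace} (A : operator H) : Prop :=
  dense (dom A) /\
  forall u f, is_adjoint_at A u f <-> (dom A u /\ f = A u).

Definition positive_definite {H : HilbertSpace} (A : operator H) : Prop :=
  forall w, dom A w -> w <> zero -> 0 < inner (A w) w.

Definition compact_map {H : HilbertSpace} (S : H -> H) : Prop :=
  forall f : nat -> H, (exists M : R, forall n, norm (f n) <= M) ->
  exists (phi : nat -> nat) (l : H),
    (forall n, (phi n < phi (n + 1))%nat) /\
    filterlim (fun n => S (f (phi n))) eventually (locally l).

Definition has_compact_inverse {H : HilbertSpace} (A : operator H) : Prop :=
  exists S : H -> H,
    (forall f, dom A (S f) /\ A (S f) = f) /\
    (forall w, dom A w -> S (A w) = w) /\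
    compact_map S.

(** The norm |w|_q = (A^q w, w)^(1/2) for [w] in [dom A] and q = 0, 1, 2;
    for q = 2 it is |A w|, which needs no more than [dom A w].
    Only these three values of [q] are meaningful. *)
Definition norm_q {H : HilbertSpace} (A : operator H) (q : nat) (w : H) : R :=
  match q with
  | 0%nat => norm w
  | 1%nat => sqrt (inner (A w) w)
  | _ => norm (A w)
  end.

(** Only [w] and [v] in [dom A] are tested; by density the bounds extend to
    the larger spaces on which the right-hand sides make sense. *)
Definition dominates {H : HilbertSpace} (A B : operator H) : Prop :=
  exists C : R, 0 < C /\
  forall theta q : nat, (theta + q = 2)%nat ->
  forall w v, dom A w -> dom A v ->
    Rabs (inner (B w) v) <= C * norm_q A q w * norm_q A theta v.

(** E(t) = exp(-tA): the strongly continuous semigroup of bounded operators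
    whose infinitesimal generator is exactly -A.  For A self-adjoint and
    positive it is automatically analytic. *)
Definition semigroup_exp {H : HilbertSpace} (A : operator H)
    (E : R -> H -> H) : Prop :=
  (forall t, 0 <= t -> is_linear (E t)) /\
  (forall x, E 0 x = x) /\
  (forall s t x, 0 <= s -> 0 <= t -> E (s + t) x = E s (E t x)) /\
  (forall x, filterlim (fun t => E t x) (at_right 0) (locally x)) /\
  (forall x y : H,
     filterlim (fun t => scal (/ t) (minus (E t x) x)) (at_right 0) (locally y)
     <-> (dom A x /\ y = opp (A x))).

Definition Gamma (a : R) : R :=
  RInt_gen (fun x => Rpower x (a - 1) * exp (- x))
    (at_right 0) (Rbar_locally p_infty).

Definition omega (a t : R) : R := Rpower t (a - 1) / Gamma a.

(** Derivative at [t] of a function on the interval [0,T]: the usual two-sided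
    derivative inside the interval, one-sided at its end points. *)
Definition is_deriv_on {H : HilbertSpace} (T : R) (f : R -> H) (t : R) (l : H)
    : Prop :=
  filterdiff f (within (fun s => 0 <= s <= T) (locally t))
    (fun h : R => scal h l).

(** v' + A v + sum_(1 <= j <= m) (omega_(alpha_j) * B_j v) - kappa v = g on
    (0,T], v(0) = u0.  The convolutions are improper Riemann integrals in H,
    the kernel being singular at s = t.  No regularity of A v, B_j v or v' is
    required beyond what the equation itself needs. *)
Definition is_solution {H : HilbertSpace} (A : operator H) (m : nat)
    (B : nat -> operator H) (alpha : nat -> R) (kappa T : R) (u0 : H)
    (g v : R -> H) : Prop :=
  continuous_on (fun t => 0 <= t <= T) v /\
  v 0 = u0 /\
  forall t, 0 < t <= T ->
    dom A (v t) /\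
    exists (dv : H) (I : nat -> H),
      is_deriv_on T v t dv /\
      (forall j, (1 <= j <= m)%nat ->
         is_RInt_gen (fun s => scal (omega (alpha j) (t - s)) (B j (v s)))
           (at_right 0) (at_left t) (I j)) /\
      minus (plus (plus dv (A (v t))) (sum_n_m I 1 m)) (scal kappa (v t)) = g t.

(* Main.v *)
Require Import Defs.
From Stdlib Require Import Reals Lra Lia Classical ClassicalEpsilon FunctionalExtensionality.
From Coquelicot Require Import Coquelicot.
Open Scope R_scope.

(* Differentiating the equation in time, y = A v' solves the second kind Volterra
   equation y = F + N * y, where N = kappa E - sum_j (A E * omega_j) B_j A^-1
   satisfies |N(t)| <= C t^(alpha-1) and F collects A E * g', N (A u0) and
   E' (A u0 - g(0)). The convolution A E * h makes sense after subtracting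
   h(t), because h is Lipschitz away from 0 with constant O(t^(alpha-2)). In the
   norm sup t^(1-alpha) e^(-lambda t) |y(t)| the map y -> F + N * y is a
   contraction for large lambda, hence y = O(t^(alpha-1)). The function
   u0 + int A^-1 y solves the equation; it equals v because A^-1 applied to the
   difference satisfies an equation with bounded operators only, which leads to
   a homogeneous Volterra equation with the same kernel. The factor |A u0| in the
   conclusion is a positive constant, as u0 <> 0. *)

(** A solution is only assumed to satisfy the equation pointwise, so it cannot be differentiated in
    time; hence y is constructed on its own and identified with A v' afterwards. The unbounded
    operators are tamed by applying S = A^-1 throughout. The derivative - A E of E has norm of order
    1/r, which is not integrable, whereas S E has the bounded derivative - E. Likewise B_j enters
    through B_j S, bounded by domination with theta = 0, and through the extension of S B_j, bounded
    by domination with theta = 2. The bounds |E(t)| <= 1 and |A E(t)| <= 1/t come from energy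
    identities rather than from a spectral decomposition. Functions and kernels are measured by
    t^(a-1); this class is stable under convolution because a product of two such singularities is
    dominated by a sum, and the contraction gets its small factor by spending half of the exponent
    a. The construction runs on (0,T+1), which makes T an interior point. *)

Section Hilbert.
Context {H : HilbertSpace}.
Implicit Types x y z w l : H.

(** * Inner product algebra and the Cauchy-Schwarz inequality *)

Lemma inner_plus_r x y z : inner x (plus y z) = inner x y + inner x z.
Proof. now rewrite inner_sym, inner_plus_l, !(inner_sym _ x). Qed.

Lemma inner_scal_r (a : R) x y : inner x (scal a y) = a * inner x y.
Proof. now rewrite inner_sym, inner_scal_l, inner_sym. Qed.

Lemma inner_zero_l x : inner zero x = 0.
Proof.
replace (zero : H) with (scal 0 x : H) by apply (scal_zero_l x).
rewrite inner_scal_l; ring.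
Qed.

Lemma inner_zero_r x : inner x zero = 0.
Proof. rewrite inner_sym; apply inner_zero_l. Qed.

Lemma inner_opp_l x y : inner (opp x) y = - inner x y.
Proof.
replace (opp x) with (scal (-1) x) by apply (scal_opp_one x).
rewrite inner_scal_l; ring.
Qed.

Lemma inner_opp_r x y : inner x (opp y) = - inner x y.
Proof. rewrite inner_sym, inner_opp_l, inner_sym; ring. Qed.

Lemma inner_minus_l x y z : inner (minus x y) z = inner x z - inner y z.
Proof. unfold minus; rewrite inner_plus_l, inner_opp_l; ring. Qed.

Lemma inner_minus_r x y z : inner x (minus y z) = inner x y - inner x z.
Proof. unfold minus; rewrite inner_plus_r, inner_opp_r; ring. Qed.

Lemma inner_self_eq0 x : inner x x = 0 -> x = zero.
Proof.
intros Hx; rewrite inner_norm in Hx.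
apply (norm_eq_zero x); simpl in Hx; nra.
Qed.

Lemma inner_ext x y : (forall w, inner x w = inner y w) -> x = y.
Proof.
intros Hxy; apply plus_reg_r with (opp y); rewrite plus_opp_r.
apply inner_self_eq0; rewrite inner_plus_l, inner_opp_l, Hxy; ring.
Qed.

Lemma inner_ge0 x : 0 <= inner x x.
Proof. rewrite inner_norm; apply pow2_ge_0. Qed.

Lemma Cauchy_Schwarz x y : Rabs (inner x y) <= norm x * norm y.
Proof.
pose proof (norm_ge_0 x) as Hx; pose proof (norm_ge_0 y) as Hy.
apply Rsqr_incr_0; [|apply Rabs_pos|now apply Rmult_le_pos].
rewrite <- Rsqr_abs; unfold Rsqr.
(* Expanding this square gives |y|^2 (|x|^2 |y|^2 - (x,y)^2) >= 0. *)
pose proof (inner_ge0 (minus (scal (inner y y) x) (scal (inner x y) y))) as HH.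
rewrite inner_minus_l, !inner_minus_r, !inner_scal_l, !inner_scal_r in HH.
rewrite (inner_sym _ y x) in HH.
destruct (Req_dec (norm y) 0) as [H0|H0].
- assert (y = zero) as -> by now apply (norm_eq_zero y).
  rewrite inner_zero_r; nra.
- rewrite !inner_norm in HH; simpl in HH.
  set (b := norm y) in *; set (a := norm x) in *; set (c := inner x y) in *.
  assert (0 < b * b) by nra.
  assert (0 <= b * b * (a * a * (b * b) - c * c)) by nra.
  nra.
Qed.

Lemma inner_le_norm x y : inner x y <= norm x * norm y.
Proof. eapply Rle_trans; [apply Rle_abs|apply Cauchy_Schwarz]. Qed.

End Hilbert.

(* [inner_expand] matches the operations up to conversion, because Coquelicot
   lemmas state them through different paths of the algebraic hierarchy. *)
Ltac inner_step :=
  match goal with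
  | |- context [@inner ?H (@plus ?G ?x ?y) ?z] =>
      rewrite (inner_plus_l _ x y z :
        @inner H (@plus G x y) z = @inner H x z + @inner H y z)
  | |- context [@inner ?H (@minus ?G ?x ?y) ?z] =>
      rewrite (inner_minus_l x y z :
        @inner H (@minus G x y) z = @inner H x z - @inner H y z)
  | |- context [@inner ?H (@opp ?G ?x) ?z] =>
      rewrite (inner_opp_l x z : @inner H (@opp G x) z = - @inner H x z)
  | |- context [@inner ?H (@scal ?K ?G ?a ?x) ?z] =>
      rewrite (inner_scal_l _ a x z : @inner H (@scal K G a x) z = a * @inner H x z)
  | |- context [@inner ?H (@zero ?G) ?z] =>
      rewrite (inner_zero_l z : @inner H (@zero G) z = 0)
  | |- context [@inner ?H ?z (@plus ?G ?x ?y)] =>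
      rewrite (inner_plus_r z x y :
        @inner H z (@plus G x y) = @inner H z x + @inner H z y)
  | |- context [@inner ?H ?z (@minus ?G ?x ?y)] =>
      rewrite (inner_minus_r z x y :
        @inner H z (@minus G x y) = @inner H z x - @inner H z y)
  | |- context [@inner ?H ?z (@opp ?G ?x)] =>
      rewrite (inner_opp_r z x : @inner H z (@opp G x) = - @inner H z x)
  | |- context [@inner ?H ?z (@scal ?K ?G ?a ?x)] =>
      rewrite (inner_scal_r a z x : @inner H z (@scal K G a x) = a * @inner H z x)
  | |- context [@inner ?H ?z (@zero ?G)] =>
      rewrite (inner_zero_r z : @inner H z (@zero G) = 0)
  end.
Ltac inner_expand := repeat inner_step.

(* Identities in H are reduced to identities between real numbers by pairing
   both sides with an arbitrary vector. *)
Ltac hring := apply inner_ext; intro; inner_expand; ring.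
Ltac hfield := apply inner_ext; intro; inner_expand; field.

Lemma norm_congr {H : HilbertSpace} (x y : H) : x = y -> norm x = norm y.
Proof. now intros ->. Qed.

(* [hnorm y] rewrites with y the argument of the first norm for which this is
   a vector space identity. *)
Tactic Notation "hnorm" uconstr(y) :=
  match goal with
  | |- context [@norm ?K ?V ?x] =>
      rewrite (norm_congr x y : _ -> @norm K V x = _) by hring
  end.

Ltac real_ball :=
  unfold ball in *; simpl in *; unfold AbsRing_ball, abs, minus, plus, opp in *; simpl in *.
Ltac real_ball_in Hb :=
  unfold ball in Hb; simpl in Hb; unfold AbsRing_ball, abs, minus, plus, opp in Hb; simpl in Hb.

Ltac rmin_bounds :=
  repeat match goal with
  | _ : context [Rmin ?x ?y] |- _ =>
      lazymatch goal with
      | _ : Rmin x y <= x |- _ => fail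
      | _ => pose proof (Rmin_l x y); pose proof (Rmin_r x y)
      end
  | |- context [Rmin ?x ?y] =>
      lazymatch goal with
      | _ : Rmin x y <= x |- _ => fail
      | _ => pose proof (Rmin_l x y); pose proof (Rmin_r x y)
      end
  end.

(** * Norms, limits, derivatives and bounded linear maps in H *)

Section Hilbert2.
Context {H : HilbertSpace}.
Implicit Types x y z w l : H.

Lemma hnorm_scal (a : R) x : norm (scal a x) = Rabs a * norm x.
Proof.
assert (norm (scal a x) ^ 2 = (Rabs a * norm x) ^ 2).
{ rewrite <- inner_norm; inner_expand; rewrite inner_norm.
  simpl; rewrite Rmult_1_r.
  replace (Rabs a * norm x * (Rabs a * norm x * 1)) with
    ((Rabs a * Rabs a) * (norm x * norm x)) by ring.
  rewrite <- Rabs_mult, (Rabs_pos_eq (a * a)) by nra; ring. }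
pose proof (norm_ge_0 (scal a x)); pose proof (norm_ge_0 x); pose proof (Rabs_pos a).
assert (0 <= Rabs a * norm x) by nra; simpl in *; nra.
Qed.

Lemma hnorm_opp x : norm (opp x) = norm x.
Proof. exact (norm_opp x). Qed.

Lemma hnorm_zero : norm (zero : H) = 0.
Proof. exact norm_zero. Qed.

Lemma hnorm_triangle x y : norm (plus x y) <= norm x + norm y.
Proof. exact (norm_triangle x y). Qed.

Lemma norm_minus_sym x y : norm (minus x y) = norm (minus y x).
Proof. rewrite <- hnorm_opp; f_equal; hring. Qed.

Lemma norm_minus_tri x y z : norm (minus x z) <= norm (minus x y) + norm (minus y z).
Proof.
hnorm (plus (minus x y) (minus y z)).
apply hnorm_triangle.
Qed.

Lemma norm_minus_le x y : norm (minus x y) <= norm x + norm y.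
Proof.
unfold minus; eapply Rle_trans; [apply hnorm_triangle|].
now rewrite hnorm_opp; apply Rle_refl.
Qed.

Lemma norm_le_minus x y : norm x <= norm y + norm (minus x y).
Proof.
replace x with (plus y (minus x y)) at 1 by hring.
apply hnorm_triangle.
Qed.

(** Testing with a [w] in [D] at distance e from x bounds |x|^2 by M |x| up to errors of order e.
    This turns estimates of scalar products over [dom A] into norm estimates. *)
Lemma dense_norm_le (D : H -> Prop) x (M : R) :
  dense D -> 0 <= M -> (forall w, D w -> inner x w <= M * norm w) -> norm x <= M.
Proof.
intros HD HM Hx.
destruct (Rle_lt_dec (norm x) M) as [|Hlt]; [assumption|exfalso].
pose proof (norm_ge_0 x).
(* Small enough that |x|^2 - |x| e > M (|x| + e), that is (|x| + M) e < (|x| - M) |x|. *)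
set (e := (norm x - M) * norm x / (2 * (norm x + M + 1))).
assert (0 < e).
{ unfold e; apply Rdiv_lt_0_compat; nra. }
destruct (HD x e) as (w & Hw & Hwx); [assumption|].
specialize (Hx w Hw).
assert (inner x w = inner x x + inner x (minus w x)) as E by (inner_expand; ring).
pose proof (Cauchy_Schwarz x (minus w x)) as HC.
pose proof (norm_le_minus w x) as Hn.
pose proof (Rabs_le_between (inner x (minus w x)) (norm x * norm (minus w x))) as [Hb _].
specialize (Hb HC).
rewrite E, inner_norm in Hx.
assert (norm x ^ 2 - norm x * e <= M * (norm x + e)).
{ pose proof (norm_ge_0 (minus w x)). nra. }
assert ((norm x - M) * norm x <= (norm x + M) * e) by nra.
assert ((norm x + M) * e < (norm x + M + 1) * e) by nra.
assert ((norm x + M + 1) * e = (norm x - M) * norm x / 2) by (unfold e; field; lra).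
nra.
Qed.

Lemma filterlim_hnorm {T : Type} (F : (T -> Prop) -> Prop) {FF : Filter F} (f : T -> H) y :
  filterlim f F (locally y) <->
  (forall eps : R, 0 < eps -> F (fun t => norm (minus (f t) y) < eps)).
Proof.
pose proof (filterlim_locally_ball_norm (F := F) f y) as [H1 H2]; split; intros Hf.
- intros eps He; exact (H1 Hf (mkposreal eps He)).
- apply H2; intros [eps He]; exact (Hf eps He).
Qed.

Lemma continuous_hnorm (f : R -> H) t :
  continuous f t <->
  (forall eps : R, 0 < eps ->
     exists d, 0 < d /\ forall s, Rabs (s - t) < d -> norm (minus (f s) (f t)) < eps).
Proof.
split; intros Hf.
- intros eps He; destruct (proj1 (filterlim_hnorm (locally t) f (f t)) Hf eps He) as [d Hd]; exists d; split; [apply cond_pos|exact Hd].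
- apply (proj2 (filterlim_hnorm (locally t) f (f t))); intros eps He.
  destruct (Hf eps He) as (d & Hd & Hd'); exists (mkposreal d Hd); exact Hd'.
Qed.

Lemma is_derive_hnorm (f : R -> H) (t : R) l :
  is_derive f t l <->
  (forall eps : R, 0 < eps ->
     exists d, 0 < d /\ forall s, Rabs (s - t) < d ->
       norm (minus (minus (f s) (f t)) (scal (s - t) l)) <= eps * Rabs (s - t)).
Proof.
split.
- intros [_ Hd] eps He.
  destruct (Hd t (fun P HP => HP) (mkposreal eps He)) as [d Hd'].
  exists d; split; [apply cond_pos|]; intros s Hs; exact (Hd' s Hs).
- intros Hd; split; [apply is_linear_scal_l|].
  intros x Hx; assert (t = x) as <-
  by exact (is_filter_lim_locally_unique (V := R_NormedModule) t x Hx).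
  intros [eps He]; destruct (Hd eps He) as (d & Hd0 & Hd').
  exists (mkposreal d Hd0); intros s Hs; exact (Hd' s Hs).
Qed.

Lemma continuous_derive (f : R -> H) (t : R) l : is_derive f t l -> continuous f t.
Proof. intros Hd; apply (ex_derive_continuous f t); now exists l. Qed.

Lemma is_derive_ext_near (f g : R -> H) (t d : R) l :
  0 < d -> (forall s, Rabs (s - t) < d -> f s = g s) -> is_derive f t l -> is_derive g t l.
Proof.
intros Hd Hfg; apply is_derive_ext_loc.
exists (mkposreal d Hd); intros s Hs; apply Hfg; exact Hs.
Qed.

Lemma is_derive_ext_open (f g : R -> H) (a b t : R) l :
  a < t < b -> (forall s, a < s < b -> f s = g s) -> is_derive f t l -> is_derive g t l.
Proof.
intros Ht Hfg; apply (is_derive_ext_near f g t (Rmin (t - a) (b - t))).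
- apply Rmin_pos; lra.
- intros s Hs; rmin_bounds; apply Rabs_def2 in Hs; apply Hfg; lra.
Qed.

Lemma continuous_ext_near (f g : R -> H) (t d : R) :
  0 < d -> (forall s, Rabs (s - t) < d -> f s = g s) -> continuous f t -> continuous g t.
Proof.
intros Hd Hfg; apply continuous_ext_loc.
exists (mkposreal d Hd); intros s Hs; apply Hfg; exact Hs.
Qed.

Lemma is_derive_inner (f g : R -> H) (t : R) lf lg :
  is_derive f t lf -> is_derive g t lg ->
  is_derive (fun s => inner (f s) (g s)) t (inner lf (g t) + inner (f t) lg).
Proof.
intros Hf Hg.
pose proof (continuous_derive _ _ _ Hg) as Cg.
rewrite is_derive_hnorm in Hf, Hg. rewrite continuous_hnorm in Cg.
assert (HR : forall (q : R -> R) (l : R),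
  (forall eps, 0 < eps -> exists d, 0 < d /\ forall s, Rabs (s - t) < d ->
     Rabs (q s - q t - (s - t) * l) <= eps * Rabs (s - t)) -> is_derive q t l).
{ intros q l Hd; split; [apply is_linear_scal_l|].
  intros x Hx; assert (t = x) as <-
  by exact (is_filter_lim_locally_unique (V := R_NormedModule) t x Hx).
  intros [eps He]; destruct (Hd eps He) as (d & Hd0 & Hd').
  exists (mkposreal d Hd0); intros s Hs; exact (Hd' s Hs). }
apply HR; intros eps He.
set (A := norm (g t) + 1); set (B := norm (f t) + 1); set (C := norm lf + 1).
pose proof (norm_ge_0 (g t)); pose proof (norm_ge_0 (f t)); pose proof (norm_ge_0 lf).
assert (0 < A) by (unfold A; lra). assert (0 < B) by (unfold B; lra).
assert (0 < C) by (unfold C; lra).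
destruct (Hf (eps / (3 * A))) as (d1 & Hd1 & K1); [apply Rdiv_lt_0_compat; lra|].
destruct (Hg (eps / (3 * B))) as (d2 & Hd2 & K2); [apply Rdiv_lt_0_compat; lra|].
destruct (Cg (Rmin 1 (eps / (3 * C)))) as (d3 & Hd3 & K3).
{ apply Rmin_pos; [lra|apply Rdiv_lt_0_compat; lra]. }
exists (Rmin d1 (Rmin d2 d3)); split; [repeat apply Rmin_pos; assumption|].
intros s Hs.
assert (Rabs (s - t) < d1) as S1 by (eapply Rlt_le_trans; [exact Hs|apply Rmin_l]).
assert (Rabs (s - t) < d2) as S2.
{ eapply Rlt_le_trans; [exact Hs|]. eapply Rle_trans; [apply Rmin_r|apply Rmin_l]. }
assert (Rabs (s - t) < d3) as S3.
{ eapply Rlt_le_trans; [exact Hs|]. eapply Rle_trans; [apply Rmin_r|apply Rmin_r]. }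
specialize (K1 s S1); specialize (K2 s S2); specialize (K3 s S3).
set (r1 := minus (minus (f s) (f t)) (scal (s - t) lf)) in *.
set (r2 := minus (minus (g s) (g t)) (scal (s - t) lg)) in *.
set (r3 := minus (g s) (g t)) in *.
(* The increment minus its linear part, written with the remainders of f and g and the increment of
   g; each of the three terms is at most eps/3 |s - t|. *)
replace (inner (f s) (g s) - inner (f t) (g t)
   - (s - t) * (inner lf (g t) + inner (f t) lg))
 with (inner r1 (g s) + (s - t) * inner lf r3 + inner (f t) r2)
 by (unfold r1, r2, r3; inner_expand; ring).
pose proof (Rabs_pos (s - t)) as Hp.
assert (norm (g s) <= A) as Hgs.
{ pose proof (norm_le_minus (g s) (g t)) as Hgg; fold r3 in Hgg.
  pose proof (Rmin_l 1 (eps / (3 * C))). unfold A; lra. }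
assert (norm r3 <= eps / (3 * C)) as Hr3.
{ pose proof (Rmin_r 1 (eps / (3 * C))). lra. }
pose proof (norm_ge_0 r1); pose proof (norm_ge_0 r2); pose proof (norm_ge_0 r3).
pose proof (norm_ge_0 (g s)).
assert (Rabs (inner r1 (g s)) <= eps / 3 * Rabs (s - t)).
{ eapply Rle_trans; [apply Cauchy_Schwarz|].
  apply Rle_trans with ((eps / (3 * A) * Rabs (s - t)) * A).
  - apply Rmult_le_compat; assumption.
  - right; field; lra. }
assert (Rabs ((s - t) * inner lf r3) <= eps / 3 * Rabs (s - t)).
{ rewrite Rabs_mult, (Rmult_comm (eps / 3)). apply Rmult_le_compat_l; [assumption|].
  eapply Rle_trans; [apply Cauchy_Schwarz|].
  apply Rle_trans with (C * (eps / (3 * C))).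
  - apply Rmult_le_compat; try assumption; unfold C; lra.
  - right; field; lra. }
assert (Rabs (inner (f t) r2) <= eps / 3 * Rabs (s - t)).
{ eapply Rle_trans; [apply Cauchy_Schwarz|].
  apply Rle_trans with (B * (eps / (3 * B) * Rabs (s - t))).
  - apply Rmult_le_compat; try assumption; unfold B; lra.
  - right; field; lra. }
eapply Rle_trans; [apply Rabs_triang|].
eapply Rle_trans; [apply Rplus_le_compat_r, Rabs_triang|]. lra.
Qed.

Lemma is_derive_inner_l (f : R -> H) (t : R) l w :
  is_derive f t l -> is_derive (fun s => inner (f s) w) t (inner l w).
Proof.
intros Hf.
replace (inner l w) with (inner l w + inner (f t) zero) by (rewrite inner_zero_r; ring).
apply (is_derive_inner f (fun _ => w)); [assumption|apply @is_derive_const].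
Qed.

Lemma nondecreasing_of_derive (q p : R -> R) a b :
  a <= b -> (forall s, a <= s <= b -> is_derive q s (p s)) ->
  (forall s, a <= s <= b -> 0 <= p s) -> q a <= q b.
Proof.
intros Hab Hq Hp.
destruct (MVT_gen q a b p) as (c & Hc & E); rewrite ?Rmin_left, ?Rmax_right in * by lra.
- intros x Hx; apply Hq; lra.
- intros x Hx; apply continuity_pt_filterlim.
  apply (ex_derive_continuous q); exists (p x); apply Hq; lra.
- specialize (Hp c Hc); nra.
Qed.

(** Pairing q with the fixed vector w = q b - q a makes Phi |w| - (q, w) a nondecreasing real
    function; dividing its increment by |w| gives the bound. *)
Lemma mean_value (q p : R -> H) (Phi phi : R -> R) a b :
  a <= b -> (forall s, a <= s <= b -> is_derive q s (p s)) ->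
  (forall s, a <= s <= b -> is_derive Phi s (phi s)) ->
  (forall s, a <= s <= b -> norm (p s) <= phi s) ->
  norm (minus (q b) (q a)) <= Phi b - Phi a.
Proof.
intros Hab Hq HPhi Hp.
set (w := minus (q b) (q a)).
assert (Phi a * norm w - inner (q a) w <= Phi b * norm w - inner (q b) w) as Hm.
{ apply (nondecreasing_of_derive (fun s => Phi s * norm w - inner (q s) w)
     (fun s => phi s * norm w - inner (p s) w)); [assumption| |].
  - intros s Hs; apply @is_derive_minus.
    + apply (is_derive_ext (fun t => scal (Phi t) (norm w))); [reflexivity|].
      apply (is_derive_scal_l Phi s (phi s) (norm w)), HPhi, Hs.
    + apply is_derive_inner_l, Hq, Hs.
  - intros s Hs; specialize (Hp s Hs).
    pose proof (inner_le_norm (p s) w); pose proof (norm_ge_0 w); nra. }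
assert (norm w ^ 2 = inner (q b) w - inner (q a) w) as E
  by (rewrite <- inner_norm; unfold w at 1; apply inner_minus_l).
pose proof (norm_ge_0 w).
destruct (Req_dec (norm w) 0) as [Hw0|Hw0].
- rewrite Hw0.
  apply Rle_minus_r; rewrite Rplus_0_l.
  apply (nondecreasing_of_derive Phi phi); try assumption.
  intros s Hs; exact (Rle_trans _ _ _ (norm_ge_0 (p s)) (Hp s Hs)).
- simpl in E; nra.
Qed.

Lemma is_derive_scal_id l (t : R) : is_derive (fun s : R => scal s l) t l.
Proof.
apply is_derive_hnorm; intros eps He; exists 1; split; [lra|]; intros s _.
hnorm zero.
rewrite hnorm_zero; apply Rmult_le_pos; [lra|apply Rabs_pos].
Qed.

(** [mean_value] applied to q s - s l. The order of a and b is left free because time increments of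
    either sign occur. *)
Lemma mean_value_const (q p : R -> H) l (eps a b : R) :
  (forall s, Rmin a b <= s <= Rmax a b -> is_derive q s (p s)) ->
  (forall s, Rmin a b <= s <= Rmax a b -> norm (minus (p s) l) <= eps) ->
  norm (minus (minus (q b) (q a)) (scal (b - a) l)) <= eps * Rabs (b - a).
Proof.
assert (Hlt : forall a b, a <= b -> (forall s, a <= s <= b -> is_derive q s (p s)) ->
  (forall s, a <= s <= b -> norm (minus (p s) l) <= eps) ->
  norm (minus (minus (q b) (q a)) (scal (b - a) l)) <= eps * (b - a)).
{ intros a' b' Hab Hq Hp.
  hnorm (minus (minus (q b') (scal b' l)) (minus (q a') (scal a' l))).
  replace (eps * (b' - a')) with (eps * b' - eps * a') by ring.
  apply (mean_value (fun s => minus (q s) (scal s l)) (fun s => minus (p s) l)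
    (fun s => eps * s) (fun _ => eps)); try assumption.
  - intros s Hs; apply @is_derive_minus; [now apply Hq|].
    apply is_derive_scal_id.
  - intros s Hs; auto_derive; [exact I|ring]. }
intros Hq Hp; destruct (Rle_lt_dec a b) as [Hab|Hab].
- rewrite Rmin_left, Rmax_right in * by lra.
  rewrite Rabs_pos_eq by lra; now apply Hlt.
- rewrite Rmin_right, Rmax_left in * by lra.
  hnorm (opp (minus (minus (q a) (q b)) (scal (a - b) l))).
  rewrite hnorm_opp, Rabs_left by lra; replace (- (b - a)) with (a - b) by ring.
  apply Hlt; try assumption; lra.
Qed.

(** The real mean value theorem applied to each (q r, w) gives an estimate uniform in [w], because p
    is continuous at t in norm; [dense_norm_le] then removes [w]. It serves where differentiability
    is known only after pairing with [dom A]. *)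
Lemma weak_derive (D : H -> Prop) (q p : R -> H) t d :
  dense D -> 0 < d ->
  (forall s w, Rabs (s - t) < d -> D w -> is_derive (fun r => inner (q r) w) s (inner (p s) w)) ->
  continuous p t -> is_derive q t (p t).
Proof.
intros HD Hd Hq Hp; apply is_derive_hnorm; intros eps He.
rewrite continuous_hnorm in Hp; destruct (Hp eps He) as (d' & Hd' & Hp').
exists (Rmin d d'); split; [now apply Rmin_pos|]; intros s Hs.
rmin_bounds.
apply (dense_norm_le D); [assumption|apply Rmult_le_pos; [lra|apply Rabs_pos]|].
intros w Hw.
destruct (MVT_gen (fun r => inner (q r) w) t s (fun r => inner (p r) w)) as (c & Hc & E).
- intros x Hx; apply Hq; [|assumption].
  apply Rabs_def1; apply Rabs_def2 in Hs;
    unfold Rmin, Rmax in Hx; destruct (Rle_dec t s); lra.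
- intros x Hx; apply continuity_pt_filterlim, (ex_derive_continuous (fun r => inner (q r) w)).
  exists (inner (p x) w); apply Hq; [|assumption].
  apply Rabs_def1; apply Rabs_def2 in Hs;
    unfold Rmin, Rmax in Hx; destruct (Rle_dec t s); lra.
- assert (Rabs (c - t) < d') as Hct.
  { apply Rabs_def1; apply Rabs_def2 in Hs;
    unfold Rmin, Rmax in Hc; destruct (Rle_dec t s); lra. }
  inner_expand; rewrite E.
  replace (inner (p c) w * (s - t) - (s - t) * inner (p t) w)
    with ((s - t) * inner (minus (p c) (p t)) w) by (inner_expand; ring).
  eapply Rle_trans; [apply Rle_abs|]; rewrite Rabs_mult.
  pose proof (Cauchy_Schwarz (minus (p c) (p t)) w) as HC.
  specialize (Hp' c Hct).
  pose proof (norm_ge_0 w); pose proof (Rabs_pos (s - t)).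
  replace (eps * Rabs (s - t) * norm w) with (Rabs (s - t) * (eps * norm w)) by ring.
  apply Rmult_le_compat_l; [assumption|]; nra.
Qed.

Lemma linear_minus (L : H -> H) x y : is_linear L -> L (minus x y) = minus (L x) (L y).
Proof.
intros HL; unfold minus; rewrite (linear_plus L HL).
replace (opp y) with (scal (-1) y) by apply (scal_opp_one y).
rewrite (linear_scal L HL); f_equal; apply (scal_opp_one (L y)).
Qed.

Lemma linear_scal' (L : H -> H) (c : R) x : is_linear L -> L (scal c x) = scal c (L x).
Proof. intros HL; exact (linear_scal L HL c x). Qed.

Lemma linear_zero' (L : H -> H) : is_linear L -> L zero = zero.
Proof.
intros HL; replace (zero : H) with (scal 0 zero : H) by apply (scal_zero_l (zero : H)).
rewrite (linear_scal L HL); rewrite !(scal_zero_l (_ : H)); reflexivity.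
Qed.

Lemma linear_lim {T : Type} (F : (T -> Prop) -> Prop) {FF : Filter F} (L : H -> H)
  (f : T -> H) y :
  is_linear L -> filterlim f F (locally y) -> filterlim (fun t => L (f t)) F (locally (L y)).
Proof.
intros HL Hf; apply (filterlim_comp _ _ _ f L F (locally y) (locally (L y)) Hf).
apply (linear_cont L), HL.
Qed.

Lemma linear_continuous (L : H -> H) (f : R -> H) t :
  is_linear L -> continuous f t -> continuous (fun s => L (f s)) t.
Proof. intros HL Hf; exact (linear_lim (locally t) L f (f t) HL Hf). Qed.

Lemma linear_derive (L : H -> H) (f : R -> H) (t : R) y :
  is_linear L -> is_derive f t y -> is_derive (fun s => L (f s)) t (L y).
Proof.
intros HL Hf; destruct (linear_norm L HL) as (M & HM & Hb).
apply is_derive_hnorm; intros eps He; rewrite is_derive_hnorm in Hf.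
destruct (Hf (eps / M)) as (d & Hd & Hd'); [now apply Rdiv_lt_0_compat|].
exists d; split; [assumption|]; intros s Hs; specialize (Hd' s Hs).
rewrite <- (norm_congr (L (minus (minus (f s) (f t)) (scal (s - t) y))))
  by (rewrite !linear_minus, (linear_scal L HL) by assumption; reflexivity).
eapply Rle_trans; [apply Hb|].
apply (Rmult_le_compat_l M) in Hd'; [|lra].
eapply Rle_trans; [exact Hd'|right; field; lra].
Qed.

Lemma is_linear_build (L : H -> H) (M : R) :
  (forall x y, L (plus x y) = plus (L x) (L y)) ->
  (forall (a : R) x, L (scal a x) = scal a (L x)) ->
  (forall x, norm (L x) <= M * norm x) -> is_linear L.
Proof.
intros Hp Hs Hb; split; [assumption|exact Hs|].
(* The constant inside [is_linear] has to be positive. *)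
exists (Rabs M + 1); split; [pose proof (Rabs_pos M); lra|].
intros x; eapply Rle_trans; [apply Hb|].
apply Rmult_le_compat_r; [apply norm_ge_0|]; pose proof (Rle_abs M); lra.
Qed.

Lemma scal_linear (c : R) : is_linear (fun x : H => scal c x).
Proof.
apply (is_linear_build _ (Rabs c)); [intros; hring|intros; hring|].
intros x; rewrite hnorm_scal; lra.
Qed.

Lemma opp_linear : is_linear (fun x : H => opp x).
Proof.
apply (is_linear_build _ 1); [intros; hring|intros; hring|].
intros x; rewrite hnorm_opp; lra.
Qed.

End Hilbert2.

(** * Real powers and one-sided neighbourhoods *)

Lemma Rpower_pos x y : 0 < Rpower x y.
Proof. apply exp_pos. Qed.

Lemma Rpower_base_1 c : Rpower 1 c = 1.
Proof. unfold Rpower; now rewrite ln_1, Rmult_0_r, exp_0. Qed.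

Lemma is_derive_Rpower x y : 0 < x -> is_derive (fun s => Rpower s y) x (y * Rpower x (y - 1)).
Proof. intros Hx; apply is_derive_Reals, derivable_pt_lim_power, Hx. Qed.

Lemma Rpower_le_neg x y c : 0 < x <= y -> c <= 0 -> Rpower y c <= Rpower x c.
Proof.
intros Hxy Hc; replace c with (- (- c)) by ring; rewrite !(Rpower_Ropp _ (- c)).
apply Rinv_le_contravar; [apply Rpower_pos|apply Rle_Rpower_l; lra].
Qed.

Lemma Rpower_split x c : 0 < x -> Rpower x c = x * Rpower x (c - 1).
Proof.
intros Hx; rewrite <- (Rpower_1 x) at 2 by assumption.
rewrite <- Rpower_plus; f_equal; ring.
Qed.

Lemma Rpower_lim_0 a : 0 < a -> filterlim (fun s => Rpower s a) (at_right 0) (locally 0).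
Proof.
intros Ha; apply filterlim_locally; intros [eps He].
exists (mkposreal (Rpower eps (/ a)) (Rpower_pos _ _)); intros s Hs Hs0.
real_ball.
replace (s + - 0) with s in Hs by ring; rewrite Rabs_pos_eq in Hs by lra.
rewrite Ropp_0, Rplus_0_r, Rabs_pos_eq by apply Rlt_le, Rpower_pos.
replace eps with (Rpower (Rpower eps (/ a)) a).
- apply Rlt_Rpower_l; lra.
- rewrite Rpower_mult, Rinv_l, Rpower_1; lra.
Qed.

Lemma at_right_between a b : a < b -> at_right a (fun x => a < x < b).
Proof.
intros Hab; assert (0 < b - a) as Hd by lra; exists (mkposreal _ Hd); intros y Hy Hay.
apply Rabs_def2 in Hy; simpl in Hy; split; [assumption|].
unfold minus, plus, opp in Hy; simpl in Hy; lra.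
Qed.

Lemma at_left_between a b : a < b -> at_left b (fun x => a < x < b).
Proof.
intros Hab; assert (0 < b - a) as Hd by lra; exists (mkposreal _ Hd); intros y Hy Hay.
apply Rabs_def2 in Hy; simpl in Hy; split; [|assumption].
unfold minus, plus, opp in Hy; simpl in Hy; lra.
Qed.

Lemma filterlim_Rminus (x y : R) :
  filterlim (fun z : R * R => fst z - snd z) (filter_prod (locally x) (locally y))
    (locally (x - y)).
Proof.
apply (filterlim_comp_2 (G := locally x) (H := locally (opp y))
  (fun z : R * R => fst z) (fun z : R * R => opp (snd z)) Rplus).
- apply filterlim_fst.
- eapply filterlim_comp; [apply filterlim_snd|apply (filterlim_opp (V := R_NormedModule))].
- apply (filterlim_plus (V := R_NormedModule)).
Qed.

Lemma continuous_reflect t s : continuous (fun s : R => t - s) s.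
Proof. apply (ex_derive_continuous (fun s : R => t - s)); auto_derive; exact I. Qed.

Lemma reflect_at_left t : filterlim (fun s => t - s) (at_left t) (at_right 0).
Proof.
intros P [d HP]; exists d; intros y Hy Hyt; apply HP; [|lra].
real_ball; replace (t - y + - 0) with (- (y + - t)) by ring; rewrite Rabs_Ropp; exact Hy.
Qed.

(** * Dominated improper integrals over (0,t) *)

Section Integral.
Context {H : HilbertSpace}.
Implicit Types f g : R -> H.

Lemma lim_witness f (l : H) e t : filterlim f (at_right 0) (locally l) -> 0 < e -> 0 < t ->
  exists s, 0 < s < t /\ norm (minus (f s) l) < e.
Proof.
intros Hf He Ht.
apply (filter_ex (F := at_right 0)), filter_and; [now apply at_right_between|].
exact (proj1 (filterlim_hnorm (at_right 0) f l) Hf e He).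
Qed.

Lemma is_RInt_continuous f a b :
  (forall s, Rmin a b <= s <= Rmax a b -> continuous f s) -> is_RInt f a b (RInt f a b).
Proof.
intros Hf; apply (RInt_correct f), (ex_RInt_continuous f); exact Hf.
Qed.

Lemma between_minmax a b x y s :
  a < x < b -> a < y < b -> Rmin x y <= s <= Rmax x y -> a < s < b.
Proof. unfold Rmin, Rmax; destruct (Rle_dec x y); lra. Qed.

Lemma is_derive_RInt_open f a b c t :
  (forall s, a < s < b -> continuous f s) -> a < c < b -> a < t < b ->
  is_derive (fun s => RInt f c s) t (f t).
Proof.
intros Hf Hc Ht; apply (is_derive_RInt f (fun s => RInt f c s) c t); [|now apply Hf].
assert (0 < Rmin (t - a) (b - t)) as Hd by (apply Rmin_pos; lra).
exists (mkposreal _ Hd); intros y Hy; apply is_RInt_continuous; intros s Hs; apply Hf.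
apply Rabs_def2 in Hy; simpl in Hy; unfold minus, plus, opp in Hy; simpl in Hy.
rmin_bounds.
apply (between_minmax a b c y); [assumption|lra|assumption].
Qed.

Lemma is_RInt_gen_primitive f (P : R -> H) a b l0 l1 :
  a < b ->
  (forall x y, a < x < b -> a < y < b -> is_RInt f x y (minus (P y) (P x))) ->
  filterlim P (at_right a) (locally l0) -> filterlim P (at_left b) (locally l1) ->
  is_RInt_gen f (at_right a) (at_left b) (minus l1 l0).
Proof.
intros Hab HP H0 H1 Q [eps HQ].
destruct eps as [eps He].
assert (0 < eps / 2) as He2 by lra.
pose proof (proj1 (filterlim_hnorm (at_right a) P l0) H0 _ He2) as K0.
pose proof (proj1 (filterlim_hnorm (at_left b) P l1) H1 _ He2) as K1.
apply (Filter_prod _ _ _ (fun x => a < x < b /\ norm (minus (P x) l0) < eps / 2)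
  (fun y => a < y < b /\ norm (minus (P y) l1) < eps / 2)).
- apply filter_and; [now apply at_right_between|exact K0].
- apply filter_and; [now apply at_left_between|exact K1].
- intros x y [Hx Hx'] [Hy Hy']; exists (minus (P y) (P x)); split; [now apply HP|].
  apply HQ, (norm_compat1 (K := R_AbsRing) (V := H)).
  apply Rle_lt_trans with (norm (minus (minus (P y) l1) (minus (P x) l0))).
  + right; apply norm_congr; hring.
  + eapply Rle_lt_trans; [apply norm_minus_le|simpl; lra].
Qed.

Lemma is_RInt_gen_derive f (P : R -> H) a b l0 l1 :
  a < b ->
  (forall s, a < s < b -> is_derive P s (f s)) -> (forall s, a < s < b -> continuous f s) ->
  filterlim P (at_right a) (locally l0) -> filterlim P (at_left b) (locally l1) ->
  is_RInt_gen f (at_right a) (at_left b) (minus l1 l0).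
Proof.
intros Hab HP Hf; apply is_RInt_gen_primitive; [assumption|].
intros x y Hx Hy; apply (is_RInt_derive P f).
- intros s Hs; apply HP, (between_minmax a b x y); assumption.
- intros s Hs; apply Hf, (between_minmax a b x y); assumption.
Qed.

Lemma RInt_dominated f (Phi phi : R -> R) a b c x y :
  (forall s, a < s < b -> continuous f s) ->
  (forall s, a < s < b -> is_derive Phi s (phi s)) ->
  (forall s, a < s < b -> norm (f s) <= phi s) ->
  a < c < b -> a < x < b -> a < y < b -> x <= y ->
  norm (minus (RInt f c y) (RInt f c x)) <= Phi y - Phi x.
Proof.
intros Hf HPhi Hb Hc Hx Hy Hxy.
apply (mean_value (fun s => RInt f c s) f Phi phi); try assumption.
- intros s Hs; apply (is_derive_RInt_open f a b); try assumption; lra.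
- intros s Hs; apply HPhi; lra.
- intros s Hs; apply Hb; lra.
Qed.

(** The increments of Phi dominate those of the primitive P of f. As Phi has limits at both ends, P
    is Cauchy there, and the difference of its limits is the integral. Comparing P with Phi near the
    ends carries the bound to the limit. *)
Lemma int_exists f (Phi phi : R -> R) a b La Lb :
  a < b ->
  (forall s, a < s < b -> continuous f s) ->
  (forall s, a < s < b -> is_derive Phi s (phi s)) ->
  (forall s, a < s < b -> norm (f s) <= phi s) ->
  filterlim Phi (at_right a) (locally La) -> filterlim Phi (at_left b) (locally Lb) ->
  exists l, is_RInt_gen f (at_right a) (at_left b) l /\ norm l <= Lb - La.
Proof.
intros Hab Hf HPhi Hb HLa HLb.
set (c := (a + b) / 2); assert (a < c < b) as Hc by (unfold c; lra).
set (P := fun s => RInt f c s).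
assert (Hdom : forall x y, a < x < b -> a < y < b ->
  norm (minus (P y) (P x)) <= Rabs (Phi y - Phi x)).
{ intros x y Hx Hy; destruct (Rle_lt_dec x y) as [Hxy|Hxy].
  - eapply Rle_trans; [|apply Rle_abs].
    apply (RInt_dominated f Phi phi a b); assumption.
  - rewrite norm_minus_sym, Rabs_minus_sym; eapply Rle_trans; [|apply Rle_abs].
    apply (RInt_dominated f Phi phi a b); try assumption; lra. }
assert (Hlim : forall (F : (R -> Prop) -> Prop) L, ProperFilter F ->
  F (fun x => a < x < b) -> filterlim Phi F (locally L) ->
  exists l, filterlim P F (locally l)).
{ intros F L FF HF HL.
  apply (filterlim_locally_cauchy (U := H)); intros [eps He].
  assert (0 < eps / 2) as He2 by lra.
  pose proof (proj1 (filterlim_locally _ _) HL (mkposreal _ He2)) as HL'.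
  exists (fun x => a < x < b /\ ball L (eps / 2) (Phi x)); split.
  - apply filter_and; assumption.
  - intros u v [Hu Hu'] [Hv Hv']; apply (norm_compat1 (K := R_AbsRing) (V := H)); simpl.
    eapply Rle_lt_trans; [now apply Hdom|].
    real_ball.
    apply Rabs_def2 in Hu'; apply Rabs_def2 in Hv'; apply Rabs_def1; lra. }
destruct (Hlim (at_right a) La) as [l0 Hl0]; [apply at_right_proper_filter| |assumption|].
{ now apply at_right_between. }
destruct (Hlim (at_left b) Lb) as [l1 Hl1]; [apply at_left_proper_filter| |assumption|].
{ now apply at_left_between. }
exists (minus l1 l0); split.
- apply (is_RInt_gen_primitive f P); try assumption.
  intros x y Hx Hy.
  replace (minus (P y) (P x)) with (RInt f x y).
  + apply is_RInt_continuous; intros s Hs; apply Hf, (between_minmax a b x y); assumption.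
  + unfold P; rewrite <- (RInt_Chasles f c x y).
    * hring.
    * apply (ex_RInt_continuous f); intros s Hs; apply Hf, (between_minmax a b c x); assumption.
    * apply (ex_RInt_continuous f); intros s Hs; apply Hf, (between_minmax a b x y); assumption.
- apply Rnot_lt_le; intros Hlt.
  set (e := (norm (minus l1 l0) - (Lb - La)) / 4).
  assert (0 < e) as He by (unfold e; lra).
  pose proof (proj1 (filterlim_hnorm (at_right a) P l0) Hl0 _ He) as K0.
  pose proof (proj1 (filterlim_hnorm (at_left b) P l1) Hl1 _ He) as K1.
  pose proof (proj1 (filterlim_locally _ _) HLa (mkposreal _ He)) as K2.
  pose proof (proj1 (filterlim_locally _ _) HLb (mkposreal _ He)) as K3.
  assert (a < c) as Hac by lra; assert (c < b) as Hcb by lra.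
  pose proof (filter_and (F := at_right a) _ _ (at_right_between a c Hac)
    (filter_and (F := at_right a) _ _ K0 K2)) as Ka.
  pose proof (filter_and (F := at_left b) _ _ (at_left_between c b Hcb)
    (filter_and (F := at_left b) _ _ K1 K3)) as Kb.
  destruct (filter_ex (F := at_right a) _ Ka) as (x & Hx & Hx0 & Hx2).
  destruct (filter_ex (F := at_left b) _ Kb) as (y & Hy & Hy1 & Hy3).
  assert (norm (minus (P y) (P x)) <= Phi y - Phi x) as Hxy
    by (apply (RInt_dominated f Phi phi a b); try assumption; lra).
  real_ball_in Hx2; real_ball_in Hy3.
  apply Rabs_def2 in Hx2; apply Rabs_def2 in Hy3.
  assert (norm (minus l1 l0) <= norm (minus (P y) (P x)) + (norm (minus (P y) l1) + norm (minus (P x) l0))).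
  { eapply Rle_trans; [|apply Rplus_le_compat_l, norm_minus_le].
    rewrite (norm_minus_sym (minus (P y) l1)).
    hnorm (plus (minus (P y) (P x)) (minus (minus (P x) l0) (minus (P y) l1))).
    apply hnorm_triangle. }
  unfold e in *; lra.
Qed.

(** Improper at both ends, with the filters used in [is_solution]: the convolutions are singular at
    0 as well as at t. [Int] is meaningful only where [is_int] holds. *)
Definition is_int f t (l : H) := is_RInt_gen f (at_right 0) (at_left t) l.
Definition Int f t : H := RInt_gen f (at_right 0) (at_left t).

Lemma is_int_unique f t l : is_int f t l -> Int f t = l.
Proof. intros Hf; apply (is_RInt_gen_unique f l), Hf. Qed.

Lemma filter_prod_between (P : R * R -> Prop) a b :
  a < b -> (forall x y, a < x < b -> a < y < b -> P (x, y)) ->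
  filter_prod (at_right a) (at_left b) P.
Proof.
intros Hab HP; apply (Filter_prod _ _ _ (fun x => a < x < b) (fun x => a < x < b)).
- now apply at_right_between.
- now apply at_left_between.
- assumption.
Qed.

Lemma is_int_ext f g t l :
  0 < t -> (forall s, 0 < s < t -> f s = g s) -> is_int f t l -> is_int g t l.
Proof.
intros Ht Hfg; apply is_RInt_gen_ext.
apply filter_prod_between; [assumption|]; intros x y Hx Hy s Hs; apply Hfg.
apply (between_minmax 0 t x y); try assumption; simpl in Hs; lra.
Qed.

Lemma is_int_plus f g t l1 l2 :
  is_int f t l1 -> is_int g t l2 -> is_int (fun s => plus (f s) (g s)) t (plus l1 l2).
Proof. intros Hf Hg; exact (is_RInt_gen_plus f g l1 l2 Hf Hg). Qed.

Lemma is_int_minus f g t l1 l2 :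
  is_int f t l1 -> is_int g t l2 -> is_int (fun s => minus (f s) (g s)) t (minus l1 l2).
Proof. intros Hf Hg; exact (is_RInt_gen_minus f g l1 l2 Hf Hg). Qed.

Lemma is_int_scal f t (k : R) l :
  is_int f t l -> is_int (fun s => scal k (f s)) t (scal k l).
Proof. intros Hf; exact (is_RInt_gen_scal f k l Hf). Qed.

Lemma is_RInt_linear (L : H -> H) f a b l :
  is_linear L -> is_RInt f a b l -> is_RInt (fun s => L (f s)) a b (L l).
Proof.
intros HL Hf.
pose proof (linear_lim (Riemann_fine a b) L _ _ HL Hf) as HLf.
eapply filterlim_ext; [|exact HLf].
intros p; simpl; rewrite (linear_scal L HL).
apply (f_equal (fun v : H => scal (sign (b - a)) v)).
apply (SF_cons_ind (fun p => L (Riemann_sum f p) = Riemann_sum (fun s => L (f s)) p)).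
- intros x; apply linear_zero', HL.
- intros x y IH; rewrite !Riemann_sum_cons, <- IH, <- (linear_scal L HL).
  apply (linear_plus L HL).
Qed.

Lemma is_int_linear (L : H -> H) f t l :
  is_linear L -> is_int f t l -> is_int (fun s => L (f s)) t (L l).
Proof.
intros HL Hf Q [[eps He] HQ].
destruct (linear_norm L HL) as (M & HM & Hb).
assert (0 < eps / M) as He2 by (apply Rdiv_lt_0_compat; assumption).
assert (locally l (fun y => norm (minus y l) < eps / M)) as Hl.
{ apply (proj1 (filterlim_hnorm (locally l) (fun y => y) l)); [|assumption].
  apply filterlim_id. }
specialize (Hf _ Hl); unfold filtermapi in *.
eapply filter_imp; [|exact Hf].
intros [x y] (z & Hz & Hzl); exists (L z); split; [now apply is_RInt_linear|].
apply HQ, (norm_compat1 (K := R_AbsRing) (V := H)); simpl.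
rewrite <- (norm_congr (L (minus z l))) by now apply linear_minus.
eapply Rle_lt_trans; [apply Hb|].
apply (Rmult_lt_compat_l M) in Hzl; [|assumption].
replace eps with (M * (eps / M)) by (field; lra); exact Hzl.
Qed.

(** The substitution moves the dependence on t from the interval into the integrand. *)
Lemma is_int_rescale f t l :
  0 < t -> is_int f t l -> is_int (fun s => scal t (f (t * s))) 1 l.
Proof.
intros Ht Hf Q HQ; specialize (Hf Q HQ); unfold filtermapi in *.
destruct Hf as [A B [[d1 Hd1] HA] [[d2 Hd2] HB] HAB].
assert (Hd1' : 0 < d1 / t) by now apply Rdiv_lt_0_compat.
assert (Hd2' : 0 < d2 / t) by now apply Rdiv_lt_0_compat.
apply (Filter_prod _ _ _ (fun x => A (t * x)) (fun y => B (t * y))).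
- exists (mkposreal _ Hd1'); intros y Hy Hy0; apply HA; [|nra].
  real_ball.
  replace (t * y + - 0) with (t * (y + - 0)) by ring.
  rewrite Rabs_mult, (Rabs_pos_eq t) by lra.
  apply (Rmult_lt_compat_l t) in Hy; [|assumption].
  replace d1 with (t * (d1 / t)) by (field; lra); exact Hy.
- exists (mkposreal _ Hd2'); intros y Hy Hy0; apply HB; [|nra].
  real_ball.
  replace (t * y + - t) with (t * (y + - 1)) by ring.
  rewrite Rabs_mult, (Rabs_pos_eq t) by lra.
  apply (Rmult_lt_compat_l t) in Hy; [|assumption].
  replace d2 with (t * (d2 / t)) by (field; lra); exact Hy.
- intros x y Hx Hy; destruct (HAB _ _ Hx Hy) as (z & Hz & HQz).
  exists z; split; [|assumption]; simpl in *.
  eapply is_RInt_ext; [|apply (is_RInt_comp_lin f t 0 x y z); rewrite !Rplus_0_r; exact Hz].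
  intros s _; simpl; now rewrite Rplus_0_r.
Qed.

(** The two end singularities are added, not multiplied, so that the bound has an explicit
    primitive; [beta_bound] reduces products to such sums. *)
Definition sing (a M t : R) f : Prop :=
  (forall s, 0 < s < t -> continuous f s) /\
  (forall s, 0 < s < t ->
     norm (f s) <= M * (Rpower s (a - 1) + Rpower (t - s) (a - 1))).

Lemma sing_int a M t f :
  0 < a -> 0 < t -> sing a M t f ->
  is_int f t (Int f t) /\ norm (Int f t) <= M * (2 / a * Rpower t a).
Proof.
intros Ha Ht [Hc Hb].
(* The chosen primitive of the bound rises by 2 M t^a / a from 0 to t. *)
destruct (int_exists f (fun s => M / a * (Rpower s a - Rpower (t - s) a))
  (fun s => M * (Rpower s (a - 1) + Rpower (t - s) (a - 1))) 0 t
  (M / a * (0 - Rpower t a)) (M / a * (Rpower t a - 0))) as (l & Hl & Hn); try assumption.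
- intros s Hs.
  assert (is_derive (fun r => Rpower (t - r) a) s (-1 * (a * Rpower (t - s) (a - 1)))) as Hd.
  { apply (is_derive_comp (fun r => Rpower r a) (fun r => t - r)).
    - apply is_derive_Rpower; lra.
    - auto_derive; [exact I|ring]. }
  replace (M * (Rpower s (a - 1) + Rpower (t - s) (a - 1))) with
    (M / a * (a * Rpower s (a - 1) - -1 * (a * Rpower (t - s) (a - 1)))) by (field; lra).
  apply (is_derive_scal (fun r => Rpower r a - Rpower (t - r) a)).
  apply @is_derive_minus; [apply is_derive_Rpower; lra|exact Hd].
- apply (filterlim_comp _ _ _ (fun s => Rpower s a - Rpower (t - s) a)
    (fun r => M / a * r) _ (locally (0 - Rpower t a))).
  + apply (filterlim_comp_2 (G := locally 0) (H := locally (Rpower t a))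
      (fun s => Rpower s a) (fun s => Rpower (t - s) a) Rminus).
    * now apply Rpower_lim_0.
    * apply (filterlim_filter_le_1 (F := locally 0)); [apply filter_le_within|].
      replace (Rpower t a) with (Rpower (t - 0) a) by (f_equal; ring).
      apply (ex_derive_continuous (fun s => Rpower (t - s) a) 0).
      exists (-1 * (a * Rpower (t - 0) (a - 1))).
      apply (is_derive_comp (fun r => Rpower r a) (fun r => t - r)).
      -- apply is_derive_Rpower; lra.
      -- auto_derive; [exact I|ring].
    * apply filterlim_Rminus.
  + apply (filterlim_scal_r (V := R_NormedModule)).
- apply (filterlim_comp _ _ _ (fun s => Rpower s a - Rpower (t - s) a)
    (fun r => M / a * r) _ (locally (Rpower t a - 0))).
  + apply (filterlim_comp_2 (G := locally (Rpower t a)) (H := locally 0)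
      (fun s => Rpower s a) (fun s => Rpower (t - s) a) Rminus).
    * apply (filterlim_filter_le_1 (F := locally t)); [apply filter_le_within|].
      apply (ex_derive_continuous (fun s => Rpower s a) t).
      exists (a * Rpower t (a - 1)); now apply is_derive_Rpower.
    * apply (filterlim_comp _ _ _ (fun s => t - s) (fun r => Rpower r a) _ (at_right 0)).
      -- apply reflect_at_left.
      -- now apply Rpower_lim_0.
    * apply filterlim_Rminus.
  + apply (filterlim_scal_r (V := R_NormedModule)).
- rewrite (is_int_unique _ _ _ Hl); split; [exact Hl|].
  eapply Rle_trans; [exact Hn|right; field; lra].
Qed.

End Integral.

(** Compactness of [c,d] for properties of intervals that can be concatenated: the supremum m of the
    points reached from c is itself reached, and the local hypothesis at m would lead beyond it
    unless m = d. *)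
Lemma interval_cover (P : R -> R -> Prop) c d :
  c <= d -> (forall x y z, c <= x <= y -> y <= z <= d -> P x y -> P y z -> P x z) ->
  (forall x, c <= x <= d -> exists e, 0 < e /\
     forall u v, c <= u <= v -> v <= d -> x - e < u -> v < x + e -> P u v) -> P c d.
Proof.
intros Hcd Htr Hloc.
destruct (completeness (fun x => c <= x <= d /\ P c x)) as [m [Hm1 Hm2]].
- exists d; intros x [Hx _]; lra.
- exists c; split; [lra|].
  destruct (Hloc c) as (e & He & Hp); [lra|]; apply Hp; lra.
- assert (P c c) as Pc.
  { destruct (Hloc c) as (e & He & Hp); [lra|]; apply Hp; lra. }
  assert (c <= m) as Hcm by (apply Hm1; split; [lra|assumption]).
  assert (m <= d) as Hmd by (apply Hm2; intros x [Hx _]; lra).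
  destruct (Hloc m) as (e & He & Hp); [lra|].
  assert (exists x, m - e < x /\ c <= x <= d /\ P c x) as (x & Hx1 & Hx2 & Hx3).
  { destruct (classic (exists x, m - e < x /\ c <= x <= d /\ P c x)) as [|Hn]; [assumption|].
    exfalso; assert (m <= m - e); [|lra].
    apply Hm2; intros y Hy; apply Rnot_lt_le; intros Hlt; apply Hn; now exists y. }
  assert (x <= m) as Hxm by (apply Hm1; now split).
  set (v := Rmin (m + e / 2) d).
  assert (v <= m + e / 2) by apply Rmin_l; assert (v <= d) by apply Rmin_r.
  assert (m <= v) by (apply Rmin_glb; lra).
  assert (P c v) as Hv by (apply (Htr c x v); try lra; [assumption|apply Hp; lra]).
  assert (v <= m) by (apply Hm1; split; [lra|assumption]).
  assert (v = d) as E; [|rewrite E in Hv; exact Hv].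
  unfold v, Rmin in *; destruct (Rle_dec (m + e / 2) d); lra.
Qed.

(** * Dominated convergence and continuity of parameter integrals *)

Section Convergence.
Context {H : HilbertSpace}.
Implicit Types f g : R -> H.

Lemma sing_le a M M' t f : M <= M' -> sing a M t f -> sing a M' t f.
Proof.
intros HM [Hc Hb]; split; [assumption|]; intros s Hs.
eapply Rle_trans; [now apply Hb|]; apply Rmult_le_compat_r; [|assumption].
pose proof (Rpower_pos s (a - 1)); pose proof (Rpower_pos (t - s) (a - 1)); lra.
Qed.

Lemma sing_minus a M N t f g :
  sing a M t f -> sing a N t g -> sing a (M + N) t (fun s => minus (f s) (g s)).
Proof.
intros [Hc Hb] [Hc' Hb']; split.
- intros s Hs; apply (continuous_minus f g); auto.
- intros s Hs; eapply Rle_trans; [apply norm_minus_le|].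
  specialize (Hb s Hs); specialize (Hb' s Hs); lra.
Qed.

(* Near the end points r^(a-1) = r^(a/2) r^(a/2-1) gains a small factor, so
   domination holds with a small constant for the exponent a/2. *)
Lemma sing_int_small a M t (eta : R) : 0 < a < 1 -> 0 < M -> 0 < t -> 0 < eta ->
  exists c d eps, 0 < c <= d /\ d < t /\ 0 < eps /\
  forall f, sing a M t f -> (forall s, c <= s <= d -> norm (f s) <= eps) ->
    norm (Int f t) <= eta.
Proof.
intros Ha HM Ht Heta.
set (b := a / 2); assert (0 < b) as Hb by (unfold b; lra).
pose proof (Rpower_pos t b) as Htb.
set (e0 := eta * b / (2 * Rpower t b)).
assert (0 < e0) as He0 by (apply Rdiv_lt_0_compat; [nra|lra]).
set (c := Rmin (t / 3) (Rpower (e0 / (2 * M)) (/ b))).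
assert (0 < c) as Hc by (apply Rmin_pos; [lra|apply Rpower_pos]).
assert (c <= t / 3) as Hct by apply Rmin_l.
assert (2 * M * Rpower c b <= e0) as Hcb.
{ assert (Rpower c b <= e0 / (2 * M)) as Hp.
  { replace (e0 / (2 * M)) with (Rpower (Rpower (e0 / (2 * M)) (/ b)) b).
    - apply Rle_Rpower_l; [lra|split; [assumption|apply Rmin_r]].
    - rewrite Rpower_mult, Rinv_l, Rpower_1; try lra; apply Rdiv_lt_0_compat; lra. }
  apply (Rmult_le_compat_l (2 * M)) in Hp; [|lra].
  replace (2 * M * (e0 / (2 * M))) with e0 in Hp by (field; lra); exact Hp. }
exists c, (t - c), (e0 * Rpower t (b - 1)).
pose proof (Rpower_pos t (b - 1)).
split; [lra|]; split; [lra|]; split; [nra|].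
intros f [Hf Hn] Hmid.
assert (Hend : forall s r, 0 < s < c -> s <= r ->
  M * (Rpower s (a - 1) + Rpower r (a - 1)) <= e0 * Rpower s (b - 1)).
{ intros s r Hs Hr.
  assert (Rpower r (a - 1) <= Rpower s (a - 1)) by (apply Rpower_le_neg; lra).
  assert (Rpower s (a - 1) = Rpower s b * Rpower s (b - 1)) as E
    by (rewrite <- Rpower_plus; f_equal; unfold b; lra).
  assert (Rpower s b <= Rpower c b) by (apply Rle_Rpower_l; lra).
  pose proof (Rpower_pos s (b - 1)).
  apply Rle_trans with (2 * M * Rpower c b * Rpower s (b - 1)); [|nra].
  apply Rle_trans with (2 * M * (Rpower s b * Rpower s (b - 1))); [nra|].
  rewrite <- Rmult_assoc; apply Rmult_le_compat_r; nra. }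
assert (sing b e0 t f) as Hs; [|destruct (sing_int b e0 t f) as [_ Hle]; try assumption].
2:{ eapply Rle_trans; [exact Hle|]; right; unfold e0; field; lra. }
split; [assumption|]; intros s Hs.
pose proof (Rpower_pos s (b - 1)); pose proof (Rpower_pos (t - s) (b - 1)).
destruct (Rlt_le_dec s c) as [Hsc|Hsc]; [|destruct (Rlt_le_dec (t - s) c) as [Hsd|Hsd]].
- eapply Rle_trans; [now apply Hn|]; eapply Rle_trans; [apply (Hend s (t - s)); lra|].
  apply Rmult_le_compat_l; lra.
- eapply Rle_trans; [now apply Hn|]; rewrite Rplus_comm.
  eapply Rle_trans; [apply (Hend (t - s) s); lra|].
  apply Rmult_le_compat_l; lra.
- eapply Rle_trans; [apply Hmid; lra|]; apply Rmult_le_compat_l; [lra|].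
  assert (Rpower t (b - 1) <= Rpower s (b - 1)); [|lra].
  apply Rpower_le_neg; [lra|unfold b; lra].
Qed.

(** [interval_cover] turns local convergence into uniform convergence on a segment inside (0,t);
    what remains near the ends is small by the common domination and [sing_int_small]. The filter is
    general because it will be a neighbourhood of a time in one use and a punctured neighbourhood of
    0 in another. *)
Lemma dominated_convergence {T : Type} (F : (T -> Prop) -> Prop) {FF : Filter F}
  (fp : T -> R -> H) f a M t :
  0 < a < 1 -> 0 < t -> F (fun p => sing a M t (fp p)) -> sing a M t f ->
  (forall s, 0 < s < t -> forall eps, 0 < eps -> exists d, 0 < d /\
     F (fun p => forall r, Rabs (r - s) < d -> norm (minus (fp p r) (f r)) < eps)) ->
  filterlim (fun p => Int (fp p) t) F (locally (Int f t)).
Proof.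
intros Ha Ht Hfp Hf Hloc.
apply (filterlim_hnorm F); intros eta Heta.
set (M' := Rabs M + 1).
assert (0 < M') by (unfold M'; pose proof (Rabs_pos M); lra).
assert (M <= M') by (unfold M'; pose proof (Rle_abs M); lra).
destruct (sing_int_small a (M' + M') t (eta / 2)) as (c & d & eps & Hcd & Hd & Heps & Hsmall);
  try lra.
assert (F (fun p => forall s, c <= s <= d -> norm (minus (fp p s) (f s)) <= eps)) as Hunif.
{ apply (interval_cover (fun u v =>
    F (fun p => forall s, u <= s <= v -> norm (minus (fp p s) (f s)) <= eps))); [lra| |].
  - intros x y z Hxy Hyz K1 K2.
    apply (filter_imp (fun p => (forall s, x <= s <= y -> norm (minus (fp p s) (f s)) <= eps) /\
      (forall s, y <= s <= z -> norm (minus (fp p s) (f s)) <= eps)));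
      [|now apply filter_and].
    intros p [P1 P2] s Hs; destruct (Rle_lt_dec s y); [apply P1|apply P2]; lra.
  - intros x Hx; destruct (Hloc x) with (eps := eps) as (e & He & HF); try lra.
    exists e; split; [assumption|]; intros u v Hu Hv Hue Hve.
    apply (filter_imp _ _) with (2 := HF); intros p Hp s Hs.
    left; apply Hp, Rabs_def1; lra. }
apply (filter_imp (fun p => sing a M t (fp p) /\
  forall s, c <= s <= d -> norm (minus (fp p s) (f s)) <= eps)); [|now apply filter_and].
intros p [Hp1 Hp2].
assert (sing a M' t (fp p)) as Hp3 by now apply sing_le with M.
assert (sing a M' t f) as Hf3 by now apply sing_le with M.
destruct (sing_int a M' t (fp p)) as [I1 _]; try lra; [assumption|].
destruct (sing_int a M' t f) as [I2 _]; try lra; [assumption|].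
rewrite <- (norm_congr (Int (fun s => minus (fp p s) (f s)) t)).
- apply Rle_lt_trans with (eta / 2); [|lra]; apply Hsmall; [|assumption].
  now apply sing_minus.
- apply is_int_unique, is_int_minus; assumption.
Qed.

Lemma continuous2_norm (g : R * R -> H) t s :
  continuous g (t, s) -> forall eps, 0 < eps -> exists d, 0 < d /\
  forall t' s', Rabs (t' - t) < d -> Rabs (s' - s) < d ->
    norm (minus (g (t', s')) (g (t, s))) < eps.
Proof.
intros Hg eps He.
destruct (proj1 (filterlim_hnorm (locally (t, s)) g (g (t, s))) Hg eps He) as [[d Hd] HP].
exists d; split; [assumption|]; intros t' s' Ht Hs; apply HP; split; assumption.
Qed.

(** The substitution s = t r brings all integrals to (0,1), where [dominated_convergence] applies.
    The factor t^b becomes t^(a+b), which is bounded near t0. Convolutions use b = a - 1, and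
    [maxreg] uses b = -1. *)
Lemma int_parametric_continuous (phi : R -> R -> H) a b M T t0 :
  0 < a < 1 -> 0 < t0 < T ->
  (forall t s, 0 < s < t -> t < T -> continuous (fun p : R * R => phi (fst p) (snd p)) (t, s)) ->
  (forall t s, 0 < s < t -> t < T ->
     norm (phi t s) <= M * Rpower t b * (Rpower s (a - 1) + Rpower (t - s) (a - 1))) ->
  continuous (fun t => Int (phi t) t) t0.
Proof.
intros Ha Ht0 Hphi Hb.
assert (Hslice : forall t, 0 < t < T -> sing a (M * Rpower t b) t (phi t)).
{ intros t Ht; split; intros s Hs; [|now apply Hb].
  apply (continuous_comp_2 (fun _ : R => t) (fun s : R => s) phi).
  - apply continuous_const.
  - apply continuous_id.
  - apply Hphi; lra. }
set (psi := fun t r : R => scal t (phi t (t * r)) : H).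
assert (Hpsi : forall t r, 0 < t < T -> 0 < r < 1 ->
  continuous (fun p : R * R => psi (fst p) (snd p)) (t, r)).
{ intros t r Ht Hr; unfold psi.
  apply (continuous_scal (fun p : R * R => fst p) (fun p => phi (fst p) (fst p * snd p))).
  - apply continuous_fst.
  - apply (continuous_comp_2 (fun p : R * R => fst p) (fun p : R * R => fst p * snd p) phi).
    + apply continuous_fst.
    + apply (continuous_mult (fun p : R * R => fst p) (fun p : R * R => snd p));
        [apply continuous_fst|apply continuous_snd].
    + apply Hphi; simpl; nra. }
assert (Hsing : forall t, 0 < t < T -> sing a (M * Rpower t (a + b)) 1 (psi t)).
{ intros t Ht; split; intros r Hr.
  - apply (continuous_comp_2 (fun _ : R => t) (fun r : R => r) psi).
    + apply continuous_const.
    + apply continuous_id.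
    + now apply Hpsi.
  - unfold psi; rewrite hnorm_scal, Rabs_pos_eq by lra.
    assert (norm (phi t (t * r)) <= _) as Hp by (apply Hb; nra).
    replace (t - t * r) with (t * (1 - r)) in Hp by ring.
    rewrite <- !Rpower_mult_distr in Hp by lra.
    apply (Rmult_le_compat_l t) in Hp; [|lra].
    eapply Rle_trans; [exact Hp|right].
    rewrite Rpower_plus, (Rpower_split t a) by lra; ring. }
assert (Hloc : exists d, 0 < d /\ forall t, Rabs (t - t0) < d ->
  0 < t < T /\ Rpower t (a + b) <= Rpower t0 (a + b) + 1).
{ assert (continuous (fun t => Rpower t (a + b)) t0) as Hc.
  { apply (ex_derive_continuous (fun t => Rpower t (a + b)) t0).
    eexists; apply is_derive_Rpower; lra. }
  destruct (proj1 (filterlim_locally _ _) Hc (mkposreal 1 Rlt_0_1)) as [[d Hd] HP].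
  exists (Rmin d (Rmin t0 (T - t0))); split; [repeat apply Rmin_pos; lra|].
  intros t Ht.
  rmin_bounds.
  assert (Rabs (t - t0) < d) as Htd by lra.
  specialize (HP t Htd); apply Rabs_def2 in HP; simpl in HP.
  unfold minus, plus, opp in HP; simpl in HP.
  apply Rabs_def2 in Ht; split; lra. }
destruct Hloc as (d0 & Hd0 & Hloc).
apply (continuous_ext_near (fun t => Int (psi t) 1) _ t0 d0); [assumption| |].
{ intros t Ht; destruct (Hloc t Ht) as [Ht' _].
  apply is_int_unique, is_int_rescale; [lra|].
  apply (sing_int a (M * Rpower t b) t); try lra; now apply Hslice. }
set (M' := Rabs M * (Rpower t0 (a + b) + 1)).
assert (HM' : forall t, Rabs (t - t0) < d0 -> sing a M' 1 (psi t)).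
{ intros t Ht; destruct (Hloc t Ht) as [Ht' Hp].
  apply sing_le with (M * Rpower t (a + b)); [|now apply Hsing].
  pose proof (Rpower_pos t (a + b)); pose proof (Rle_abs M); pose proof (Rabs_pos M).
  unfold M'; apply Rle_trans with (Rabs M * Rpower t (a + b)).
  - apply Rmult_le_compat_r; lra.
  - apply Rmult_le_compat_l; lra. }
apply (dominated_convergence (locally t0) psi (psi t0) a M' 1); try lra.
- exists (mkposreal d0 Hd0); exact HM'.
- apply HM'; rewrite Rminus_diag, Rabs_R0; assumption.
- intros s Hs eps He.
  destruct (continuous2_norm _ t0 s (Hpsi t0 s ltac:(lra) Hs) (eps / 2)) as (d & Hd & HP); [lra|].
  simpl in HP; exists d; split; [assumption|].
  exists (mkposreal d Hd); intros t Ht r Hr.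
  eapply Rle_lt_trans; [apply (norm_minus_tri _ (psi t0 s))|].
  rewrite (norm_minus_sym (psi t0 s)).
  assert (norm (minus (psi t r) (psi t0 s)) < eps / 2) by (apply HP; assumption).
  assert (norm (minus (psi t0 r) (psi t0 s)) < eps / 2).
  { apply HP; [|assumption]; rewrite Rminus_diag, Rabs_R0; assumption. }
  lra.
Qed.

End Convergence.

(** One of s and t - s is at least t/2, and its power is at most (t/2)^(a-1) <= 2 t^(a-1). *)
Lemma beta_bound a s t : 0 < a < 1 -> 0 < s < t ->
  Rpower s (a - 1) * Rpower (t - s) (a - 1) <=
  2 * Rpower t (a - 1) * (Rpower s (a - 1) + Rpower (t - s) (a - 1)).
Proof.
intros Ha Hs.
assert (Hhalf : Rpower (t / 2) (a - 1) <= 2 * Rpower t (a - 1)).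
{ replace t with (2 * (t / 2)) at 2 by field.
  rewrite <- Rpower_mult_distr by lra.
  assert (Rpower 2 (- (1)) <= Rpower 2 (a - 1)) as Hp by (apply Rle_Rpower; lra).
  rewrite Rpower_Ropp, Rpower_1 in Hp by lra.
  pose proof (Rpower_pos (t / 2) (a - 1)); nra. }
pose proof (Rpower_pos s (a - 1)); pose proof (Rpower_pos (t - s) (a - 1)).
destruct (Rle_lt_dec (t / 2) s).
- assert (Rpower s (a - 1) <= Rpower (t / 2) (a - 1)) by (apply Rpower_le_neg; lra); nra.
- assert (Rpower (t - s) (a - 1) <= Rpower (t / 2) (a - 1)) by (apply Rpower_le_neg; lra); nra.
Qed.

(** * Convolutions with singular operator kernels *)

Section Convolution.
Context {H : HilbertSpace} (a T : R).
Implicit Types f g : R -> H.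
Implicit Types k K : R -> H -> H.

Definition bounded_fn (M : R) f : Prop :=
  (forall t, 0 < t < T -> continuous f t) /\
  (forall t, 0 < t < T -> norm (f t) <= M * Rpower t (a - 1)).

Definition kernel (N : R) k : Prop :=
  (forall r, 0 < r < T -> is_linear (k r)) /\
  (forall x r, 0 < r < T -> continuous (fun r => k r x) r) /\
  (forall r x, 0 < r < T -> norm (k r x) <= N * Rpower r (a - 1) * norm x).

Definition conv k f t : H := Int (fun s => k (t - s) (f s)) t.

(** Near r the operators have a common bound, which upgrades continuity in r for fixed x to joint
    continuity. The exponent a is any number below 1, so that a = 0 covers A E(r), whose norm is of
    order 1/r. *)
Lemma kernel_continuous2 N k r x : a < 1 -> kernel N k -> 0 < r < T ->
  continuous (fun p : R * H => k (fst p) (snd p)) (r, x).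
Proof.
intros Ha (Hl & Hc & Hb) Hr.
apply (proj2 (filterlim_hnorm (locally (r, x)) (fun p : R * H => k (fst p) (snd p)) (k r x))).
intros eps He.
set (C := Rabs N * Rpower (r / 2) (a - 1) + 1).
assert (0 < C) as HC.
{ unfold C; pose proof (Rabs_pos N); pose proof (Rpower_pos (r / 2) (a - 1)); nra. }
destruct (proj1 (continuous_hnorm _ _) (Hc x r Hr) (eps / 2)) as (d & Hd & Hd'); [lra|].
assert (0 < Rmin d (Rmin (r / 2) (T - r))) as Hm by (repeat apply Rmin_pos; lra).
assert (locally x (fun y => norm (minus y x) < eps / 2 / C)) as Hx.
{ apply (proj1 (filterlim_hnorm (locally x) (fun y => y) x)); [apply filterlim_id|].
  apply Rdiv_lt_0_compat; lra. }
destruct Hx as [[e Hepos] Hx].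
assert (0 < Rmin e (Rmin d (Rmin (r / 2) (T - r)))) as Hm' by (now apply Rmin_pos).
exists (mkposreal _ Hm'); intros [r' x'] [Hr' Hx']; simpl in *.
assert (norm (minus x' x) < eps / 2 / C) as Hxx.
{ apply Hx; eapply ball_le; [|exact Hx']; simpl; apply Rmin_l. }
real_ball_in Hr'.
pose proof (Rmin_r e (Rmin d (Rmin (r / 2) (T - r)))).
pose proof (Rmin_l d (Rmin (r / 2) (T - r))); pose proof (Rmin_r d (Rmin (r / 2) (T - r))).
rmin_bounds.
assert (Rabs (r' - r) < d) as Hrd by (unfold Rminus; lra).
apply Rabs_def2 in Hr'.
eapply Rle_lt_trans; [apply (norm_minus_tri _ (k r' x))|].
specialize (Hd' r' Hrd).
assert (norm (minus (k r' x') (k r' x)) <= eps / 2); [|lra].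
rewrite <- (norm_congr (k r' (minus x' x))) by (apply linear_minus, Hl; lra).
eapply Rle_trans; [apply Hb; lra|].
apply Rle_trans with (C * (eps / 2 / C)); [|right; field; lra].
assert (Rpower r' (a - 1) <= Rpower (r / 2) (a - 1)) by (apply Rpower_le_neg; lra).
pose proof (Rpower_pos r' (a - 1)); pose proof (Rle_abs N); pose proof (Rabs_pos N).
assert (N * Rpower r' (a - 1) <= C).
{ apply Rle_trans with (Rabs N * Rpower r' (a - 1)); [nra|unfold C; nra]. }
pose proof (norm_ge_0 (minus x' x)).
apply Rle_trans with (C * norm (minus x' x)); [nra|].
apply Rmult_le_compat_l; lra.
Qed.

Context (Ha : 0 < a < 1).

Lemma kernel_fn_continuous2 N M k f r s : kernel N k -> bounded_fn M f ->
  0 < r < T -> 0 < s < T -> continuous (fun p : R * R => k (fst p) (f (snd p))) (r, s).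
Proof.
intros Hk Hf Hr Hs.
apply (continuous_comp_2 (fun p : R * R => fst p) (fun p : R * R => f (snd p)) k).
- apply continuous_fst.
- apply (continuous_comp (fun p : R * R => snd p) f); [apply continuous_snd|now apply Hf].
- apply (kernel_continuous2 N); try assumption; apply Ha.
Qed.

Lemma conv_continuous2 N M k f t s : kernel N k -> bounded_fn M f -> 0 < s < t -> t < T ->
  continuous (fun p : R * R => k (fst p - snd p) (f (snd p))) (t, s).
Proof.
intros Hk Hf Hs Ht.
apply (continuous_comp_2 (fun p : R * R => fst p - snd p) (fun p : R * R => f (snd p)) k).
- apply (continuous_minus (V := R_NormedModule) (fun p : R * R => fst p) (fun p : R * R => snd p));
    [apply continuous_fst|apply continuous_snd].
- apply (continuous_comp (fun p : R * R => snd p) f); [apply continuous_snd|apply Hf; simpl; lra].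
- apply (kernel_continuous2 N); try assumption; simpl; lra.
Qed.

Lemma kernel_fn_continuous N M k f (tau s : R) : kernel N k -> bounded_fn M f ->
  0 < tau - s < T -> 0 < s < T -> continuous (fun s => k (tau - s) (f s)) s.
Proof.
intros Hk Hf Hr Hs.
apply (continuous_comp_2 (fun s : R => tau - s) (fun s : R => s) (fun r s => k r (f s))).
- apply continuous_reflect.
- apply continuous_id.
- apply (kernel_fn_continuous2 N M); assumption.
Qed.

Lemma kernel_bound N k r x : 0 <= N -> kernel N k -> 0 < r < T ->
  forall M, norm x <= M -> norm (k r x) <= N * Rpower r (a - 1) * M.
Proof.
intros HN (_ & _ & Hb) Hr M HM; eapply Rle_trans; [now apply Hb|].
apply Rmult_le_compat_l; [|assumption].
apply Rmult_le_pos; [assumption|apply Rlt_le, Rpower_pos].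
Qed.

Lemma conv_norm_bound N M k f t s : 0 <= N -> 0 <= M -> kernel N k -> bounded_fn M f ->
  0 < s < t -> t < T ->
  norm (k (t - s) (f s)) <=
    2 * N * M * Rpower t (a - 1) * (Rpower s (a - 1) + Rpower (t - s) (a - 1)).
Proof.
intros HN HM Hk Hf Hs Ht.
eapply Rle_trans; [apply (kernel_bound N) with (M := M * Rpower s (a - 1)); try assumption|].
- lra.
- apply Hf; lra.
- pose proof (beta_bound a s t Ha Hs) as Hbeta.
  apply Rle_trans with (N * M * (Rpower s (a - 1) * Rpower (t - s) (a - 1))); [right; ring|].
  eapply Rle_trans; [apply Rmult_le_compat_l; [nra|exact Hbeta]|right; ring].
Qed.

Lemma conv_sing N M k f t : 0 <= N -> 0 <= M -> kernel N k -> bounded_fn M f -> 0 < t < T ->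
  sing a (2 * N * M * Rpower t (a - 1)) t (fun s => k (t - s) (f s)).
Proof.
intros HN HM Hk Hf Ht; split; intros s Hs.
- apply (kernel_fn_continuous N M); try assumption; lra.
- apply conv_norm_bound; try assumption; lra.
Qed.

Lemma conv_is_int N M k f t : 0 <= N -> 0 <= M -> kernel N k -> bounded_fn M f -> 0 < t < T ->
  is_int (fun s => k (t - s) (f s)) t (conv k f t).
Proof.
intros HN HM Hk Hf Ht.
apply (sing_int a (2 * N * M * Rpower t (a - 1))); try lra; now apply conv_sing.
Qed.

Lemma conv_norm N M k f t : 0 <= N -> 0 <= M -> kernel N k -> bounded_fn M f -> 0 < t < T ->
  norm (conv k f t) <= 4 / a * (N * M) * (Rpower t a * Rpower t (a - 1)).
Proof.
intros HN HM Hk Hf Ht.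
destruct (sing_int a (2 * N * M * Rpower t (a - 1)) t (fun s => k (t - s) (f s)))
  as [_ Hle]; try lra; [now apply conv_sing|].
eapply Rle_trans; [exact Hle|right; field; lra].
Qed.

(** The convolution is of order t^a t^(a-1) <= T^a t^(a-1), so it stays in the class, as the
    iteration in [volterra_exists] requires. *)
Lemma conv_bounded_fn N M k f : 0 <= N -> 0 <= M -> kernel N k -> bounded_fn M f ->
  bounded_fn (4 / a * (N * M) * Rpower T a) (conv k f).
Proof.
intros HN HM Hk Hf; split; intros t Ht.
- apply (int_parametric_continuous (fun t s => k (t - s) (f s)) a (a - 1) (2 * N * M) T);
    try assumption.
  + intros r s Hs Hr; apply (conv_continuous2 N M); assumption.
  + intros r s Hs Hr; now apply conv_norm_bound.
- eapply Rle_trans; [now apply (conv_norm N M)|].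
  rewrite (Rmult_assoc _ (Rpower T a)); apply Rmult_le_compat_l.
  + apply Rmult_le_pos; [|nra]; apply Rlt_le, Rdiv_lt_0_compat; lra.
  + apply Rmult_le_compat_r; [apply Rlt_le, Rpower_pos|apply Rle_Rpower_l; lra].
Qed.

Lemma conv_minus N M M' k f g t : 0 <= N -> 0 <= M -> 0 <= M' ->
  kernel N k -> bounded_fn M f -> bounded_fn M' g -> 0 < t < T ->
  conv k (fun s => minus (f s) (g s)) t = minus (conv k f t) (conv k g t).
Proof.
intros HN HM HM' Hk Hf Hg Ht; apply is_int_unique.
eapply is_int_ext; [lra| |apply is_int_minus;
  [apply (conv_is_int N M)|apply (conv_is_int N M')]; assumption].
intros s Hs; simpl; symmetry; apply linear_minus, Hk; lra.
Qed.

Lemma conv_plus_kernel N N' M k K f t : 0 <= N -> 0 <= N' -> 0 <= M ->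
  kernel N k -> kernel N' K -> bounded_fn M f -> 0 < t < T ->
  conv (fun r x => plus (k r x) (K r x)) f t = plus (conv k f t) (conv K f t).
Proof.
intros HN HN' HM Hk HK Hf Ht; apply is_int_unique.
apply is_int_plus; [apply (conv_is_int N M)|apply (conv_is_int N' M)]; assumption.
Qed.

Lemma conv_linear N M (L : H -> H) k f t : 0 <= N -> 0 <= M ->
  is_linear L -> kernel N k -> bounded_fn M f -> 0 < t < T ->
  conv (fun r x => L (k r x)) f t = L (conv k f t).
Proof.
intros HN HM HL Hk Hf Ht; apply is_int_unique.
apply (is_int_linear L); [assumption|apply (conv_is_int N M); assumption].
Qed.

Lemma conv_ext k K f g t : 0 < t < T ->
  (forall s, 0 < s < t -> k (t - s) (f s) = K (t - s) (g s)) ->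
  (exists l, is_int (fun s => k (t - s) (f s)) t l) -> conv k f t = conv K g t.
Proof.
intros Ht Hfg [l Hl]; unfold conv; rewrite (is_int_unique _ _ _ Hl); symmetry.
apply is_int_unique; eapply is_int_ext; [|exact Hfg|exact Hl]; lra.
Qed.

Lemma kernel_plus N N' k K : kernel N k -> kernel N' K ->
  kernel (N + N') (fun r x => plus (k r x) (K r x)).
Proof.
intros (L1 & C1 & B1) (L2 & C2 & B2); split; [|split].
- intros r Hr; apply (is_linear_build _ ((N + N') * Rpower r (a - 1))).
  + intros x y; rewrite (linear_plus _ (L1 r Hr)), (linear_plus _ (L2 r Hr)); hring.
  + intros c x; rewrite (linear_scal _ (L1 r Hr)), (linear_scal _ (L2 r Hr)); hring.
  + intros x; eapply Rle_trans; [apply hnorm_triangle|].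
    specialize (B1 r x Hr); specialize (B2 r x Hr); nra.
- intros x r Hr; apply (continuous_plus (fun r => k r x) (fun r => K r x)); auto.
- intros r x Hr; eapply Rle_trans; [apply hnorm_triangle|].
  specialize (B1 r x Hr); specialize (B2 r x Hr); nra.
Qed.

Lemma is_linear_comp (L L' : H -> H) :
  is_linear L -> is_linear L' -> is_linear (fun x => L (L' x)).
Proof.
intros HL HL'; destruct (linear_norm L HL) as (C & HC & HCb).
destruct (linear_norm L' HL') as (C' & HC' & HCb').
apply (is_linear_build _ (C * C')).
- intros x y; now rewrite (linear_plus L' HL'), (linear_plus L HL).
- intros c x; now rewrite (linear_scal L' HL'), (linear_scal L HL).
- intros x; eapply Rle_trans; [apply HCb|]; rewrite Rmult_assoc.
  apply Rmult_le_compat_l; [lra|apply HCb'].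
Qed.

Lemma kernel_comp_l N C (L : H -> H) k : 0 <= C -> is_linear L ->
  (forall x, norm (L x) <= C * norm x) -> kernel N k -> kernel (C * N) (fun r x => L (k r x)).
Proof.
intros HC HL Hb (L1 & C1 & B1); split; [|split].
- intros r Hr; apply (is_linear_comp L (k r)); auto.
- intros x r Hr; apply (linear_continuous L); auto.
- intros r x Hr; eapply Rle_trans; [apply Hb|]; rewrite !Rmult_assoc.
  apply Rmult_le_compat_l; [assumption|]; rewrite <- Rmult_assoc; now apply B1.
Qed.

Lemma kernel_opp N k : kernel N k -> kernel N (fun r x => opp (k r x)).
Proof.
intros Hk; rewrite <- (Rmult_1_l N).
apply (kernel_comp_l N 1 (fun x : H => opp x)); [lra|apply opp_linear| |assumption].
intros x; rewrite hnorm_opp; lra.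
Qed.

Lemma kernel_comp_r N C (L : H -> H) k : 0 <= N -> 0 <= C -> is_linear L ->
  (forall x, norm (L x) <= C * norm x) -> kernel N k -> kernel (C * N) (fun r x => k r (L x)).
Proof.
intros HN HC HL Hb Hk; pose proof Hk as (L1 & C1 & B1); split; [|split].
- intros r Hr; apply (is_linear_comp (k r) L); auto.
- intros x r Hr; apply C1; assumption.
- intros r x Hr; eapply Rle_trans; [apply (kernel_bound N) with (M := C * norm x); auto|].
  right; ring.
Qed.

Lemma kernel_scal_op N (c : R -> R) : (forall r, 0 < r < T -> continuous c r) ->
  (forall r, 0 < r < T -> Rabs (c r) <= N * Rpower r (a - 1)) ->
  kernel N (fun r x => scal (c r) x).
Proof.
intros Hc Hb; split; [|split].
- intros r Hr; apply (is_linear_build _ (Rabs (c r))).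
  + intros x y; hring.
  + intros b x; hring.
  + intros x; rewrite hnorm_scal; apply Rle_refl.
- intros x r Hr; apply (continuous_scal_l (K := R_AbsRing) c x r); now apply Hc.
- intros r x Hr; rewrite hnorm_scal; apply Rmult_le_compat_r; [apply norm_ge_0|now apply Hb].
Qed.

Lemma bounded_fn_linear M C (L : H -> H) f : 0 <= C -> is_linear L ->
  (forall x, norm (L x) <= C * norm x) -> bounded_fn M f ->
  bounded_fn (C * M) (fun t => L (f t)).
Proof.
intros HC HL Hb [Hc Hn]; split; intros t Ht.
- apply (linear_continuous L); auto.
- eapply Rle_trans; [apply Hb|]; rewrite Rmult_assoc.
  apply Rmult_le_compat_l; auto.
Qed.

Lemma bounded_fn_plus M M' f g : bounded_fn M f -> bounded_fn M' g ->
  bounded_fn (M + M') (fun t => plus (f t) (g t)).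
Proof.
intros [Hc Hn] [Hc' Hn']; split; intros t Ht.
- apply (continuous_plus f g); auto.
- eapply Rle_trans; [apply hnorm_triangle|].
  specialize (Hn t Ht); specialize (Hn' t Ht); lra.
Qed.

Lemma bounded_fn_minus M M' f g : bounded_fn M f -> bounded_fn M' g ->
  bounded_fn (M + M') (fun t => minus (f t) (g t)).
Proof.
intros [Hc Hn] [Hc' Hn']; split; intros t Ht.
- apply (continuous_minus f g); auto.
- eapply Rle_trans; [apply norm_minus_le|].
  specialize (Hn t Ht); specialize (Hn' t Ht); lra.
Qed.

Lemma kernel_apply N k x : kernel N k -> bounded_fn (N * norm x) (fun r => k r x).
Proof.
intros (L1 & C1 & B1); split; intros t Ht; [auto|].
eapply Rle_trans; [now apply B1|right; ring].
Qed.

End Convolution.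

(** * Improper integrals as functions of their upper end *)

Section Primitive.
Context {H : HilbertSpace} (T : R).

(** The integral converges at its two ends independently, and h is continuous at t, so the upper end
    may be placed at t itself. *)
Lemma is_int_limit (h : R -> H) t l : 0 < t < T ->
  (forall s, 0 < s < T -> continuous h s) -> is_int h t l ->
  filterlim (fun x => RInt h x t) (at_right 0) (locally l).
Proof.
intros Ht Hh Hl; apply (filterlim_hnorm (at_right 0)); intros eps He.
assert (0 < eps / 2) as He2 by lra.
assert (locally l (fun y => norm (minus y l) < eps / 2)) as Hball.
{ apply (proj1 (filterlim_hnorm (locally l) (fun y => y) l)); [apply filterlim_id|lra]. }
destruct (Hl _ Hball) as [Q R HQ HR HQR].
assert (continuous (fun y => RInt h t y) t) as Hc.
{ apply (continuous_derive _ _ (h t)), (is_derive_RInt_open h 0 T); assumption. }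
destruct (proj1 (continuous_hnorm _ _) Hc (eps / 2) He2) as (d & Hd & Hd').
assert (at_left t (fun y => R y /\ (0 < y < t /\ Rabs (y - t) < d))) as Hy.
{ apply filter_and; [exact HR|apply filter_and; [apply at_left_between; lra|]].
  exists (mkposreal d Hd); intros y Hy _; exact Hy. }
destruct (filter_ex (F := at_left t) _ Hy) as (y & Ry & Hyt & Hyd).
specialize (Hd' y Hyd); rewrite (RInt_point t h) in Hd'.
apply (filter_imp (fun x => Q x /\ 0 < x < t)).
2:{ apply filter_and; [exact HQ|apply at_right_between; lra]. }
intros x [Qx Hx].
destruct (HQR x y Qx Ry) as (z & Hz & Hzl); simpl in Hz.
assert (forall u v, 0 < u < T -> 0 < v < T -> ex_RInt h u v) as Hex.
{ intros u v Hu Hv; apply (ex_RInt_continuous h); intros s Hs.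
  apply Hh, (between_minmax 0 T u v); assumption. }
assert (RInt h x t = minus z (RInt h t y)) as ->.
{ rewrite <- (is_RInt_unique _ _ _ _ Hz), <- (RInt_Chasles h x t y) by (apply Hex; lra).
  hring. }
eapply Rle_lt_trans.
- hnorm (minus (minus z l) (minus (RInt h t y) zero)); apply norm_minus_le.
- apply Rlt_le_trans with (eps / 2 + eps / 2); [|lra].
  apply Rplus_lt_compat; [exact Hzl|exact Hd'].
Qed.

(** The improper part at 0 is common to all upper ends; t' may lie on either side of t. This is what
    makes [Int h] differentiable in its upper end. *)
Lemma is_int_shift (h : R -> H) t t' l : 0 < t < T -> 0 < t' < T ->
  (forall s, 0 < s < T -> continuous h s) -> is_int h t l ->
  is_int h t' (plus l (RInt h t t')).
Proof.
intros Ht Ht' Hh Hl.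
assert (forall u v, 0 < u < T -> 0 < v < T -> is_RInt h u v (RInt h u v)) as Hex.
{ intros u v Hu Hv; apply is_RInt_continuous; intros s Hs.
  apply Hh, (between_minmax 0 T u v); assumption. }
replace (plus l (RInt h t t')) with (minus (RInt h t t') (opp l)) by hring.
apply (is_RInt_gen_primitive h (fun x => RInt h t x)); [lra| | |].
- intros x y Hx Hy.
  replace (minus (RInt h t y) (RInt h t x)) with (RInt h x y).
  + apply Hex; lra.
  + rewrite <- (RInt_Chasles h t x y) by (eexists; apply Hex; lra); hring.
- apply (filterlim_ext_loc (fun x => opp (RInt h x t))).
  + apply (filter_imp (fun x => 0 < x < t)); [|apply at_right_between; lra].
    intros x Hx; apply (opp_RInt_swap h x t); eexists; apply Hex; lra.
  + apply (filterlim_comp _ _ _ (fun x => RInt h x t) opp _ (locally l)).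
    * now apply is_int_limit.
    * apply (filterlim_opp (V := H)).
- apply (filterlim_filter_le_1 (F := locally t')); [apply filter_le_within|].
  apply (continuous_derive (fun x => RInt h t x) t' (h t')).
  apply (is_derive_RInt_open h 0 T); assumption.
Qed.

Lemma Int_dominated (a M : R) (f : R -> H) t : 0 < a -> 0 <= M -> bounded_fn a T M f -> 0 < t < T ->
  is_int f t (Int f t) /\ norm (Int f t) <= M * (2 / a) * Rpower t a.
Proof.
intros Ha HM [Hc Hb] Ht; rewrite Rmult_assoc; apply sing_int; try lra; split.
- intros s Hs; apply Hc; lra.
- intros s Hs; eapply Rle_trans; [apply Hb; lra|]; apply Rmult_le_compat_l; [assumption|].
  pose proof (Rpower_pos (t - s) (a - 1)); lra.
Qed.

Lemma Int_derive (a M : R) (f : R -> H) t : 0 < a -> 0 <= M -> bounded_fn a T M f -> 0 < t < T ->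
  is_derive (Int f) t (f t).
Proof.
intros Ha HM Hf Ht.
apply (is_derive_ext_open (fun s => plus (Int f t) (RInt f t s)) _ 0 T); [assumption| |].
- intros s Hs; symmetry; apply is_int_unique, is_int_shift; try lra.
  + apply Hf.
  + now apply (Int_dominated a M).
- replace (f t) with (plus zero (f t) : H) by hring.
  apply (is_derive_plus (fun _ => Int f t) (fun s => RInt f t s)).
  + exact (is_derive_const (Int f t) t).
  + apply (is_derive_RInt_open f 0 T); [apply Hf|assumption|assumption].
Qed.

End Primitive.

(** * Differentiation of K * f when the derivative of K is singular at 0 but integrable *)

Section ConvolutionDerivative.
Context {H : HilbertSpace} (a T : R) (Ha : 0 < a < 1).
Context (K k : R -> H -> H) (K0 : H -> H) (f : R -> H) (N N' M : R).
Context (HN : 0 <= N) (HN' : 0 <= N') (HM : 0 <= M).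
Context (HK : kernel a T N K) (Hk : kernel a T N' k) (HK0 : is_linear K0).
Context (HKk : forall x r, 0 < r < T -> is_derive (fun r => K r x) r (k r x)).
Context (HKlim : forall x, filterlim (fun r => K r x) (at_right 0) (locally (K0 x))).
Context (Hf : bounded_fn a T M f).

(* Extending K by K0 to r <= 0 turns the difference quotients of the
   convolution into integrals over a fixed interval. *)
Let Kx (r : R) (x : H) : H := if Rle_dec r 0 then K0 x else K r x.

Lemma Kx_pos r x : 0 < r -> Kx r x = K r x.
Proof. intros Hr; unfold Kx; destruct (Rle_dec r 0); [lra|reflexivity]. Qed.

Lemma Kx_neg r x : r <= 0 -> Kx r x = K0 x.
Proof. intros Hr; unfold Kx; destruct (Rle_dec r 0); [reflexivity|lra]. Qed.

Lemma K_increment p q x : 0 < p <= q -> q < T ->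
  norm (minus (K q x) (K p x)) <= N' / a * norm x * (Rpower q a - Rpower p a).
Proof.
intros Hp Hq.
replace (N' / a * norm x * (Rpower q a - Rpower p a)) with
  (N' / a * norm x * Rpower q a - N' / a * norm x * Rpower p a) by ring.
apply (mean_value (fun r => K r x) (fun r => k r x) (fun r => N' / a * norm x * Rpower r a)
  (fun r => N' / a * norm x * (a * Rpower r (a - 1)))); [lra| | |].
- intros s Hs; apply HKk; lra.
- intros s Hs; apply (is_derive_scal (fun r => Rpower r a)), is_derive_Rpower; lra.
- intros s Hs; eapply Rle_trans; [apply Hk; lra|right; field; lra].
Qed.

(** Let p tend to 0 in [K_increment]. *)
Lemma K_increment0 q x : 0 < q < T ->
  norm (minus (K q x) (K0 x)) <= N' / a * norm x * Rpower q a.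
Proof.
intros Hq; apply Rnot_lt_le; intros Hlt.
set (e := norm (minus (K q x) (K0 x)) - N' / a * norm x * Rpower q a).
assert (0 < e) as He by (unfold e; lra).
destruct (lim_witness _ _ e q (HKlim x) He (proj1 Hq)) as (p & Hp2 & Hp1).
assert (norm (minus (K q x) (K p x)) <= N' / a * norm x * (Rpower q a - Rpower p a)) as Hi
  by (apply K_increment; lra).
pose proof (norm_minus_tri (K q x) (K p x) (K0 x)).
assert (0 <= N' / a * norm x * Rpower p a).
{ pose proof (norm_ge_0 x); pose proof (Rpower_pos p a).
  assert (0 <= N' / a) by (apply Rmult_le_pos; [assumption|apply Rlt_le, Rinv_0_lt_compat; lra]).
  apply Rmult_le_pos; [apply Rmult_le_pos|]; lra. }
unfold e in *; lra.
Qed.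

Lemma N'a_ge0 : 0 <= N' / a.
Proof. apply Rmult_le_pos; [assumption|apply Rlt_le, Rinv_0_lt_compat; lra]. Qed.

(** Writing r^a = r r^(a-1), every increment is at most a multiple of r^(a-1) |d|; for r + d <= 0
    this holds because r <= |d|. Divided by d, it is the integrable majorant of the difference
    quotients. *)
Lemma Kx_increment r d x : 0 < r < T -> r + d < T ->
  norm (minus (Kx (r + d) x) (Kx r x)) <= N' / a * norm x * (Rpower r (a - 1) * Rabs d).
Proof.
intros Hr Hd.
pose proof N'a_ge0; pose proof (norm_ge_0 x).
assert (0 <= N' / a * norm x) by now apply Rmult_le_pos.
rewrite (Kx_pos r) by lra.
destruct (Rle_lt_dec (r + d) 0) as [Hneg|Hpos].
- rewrite Kx_neg, norm_minus_sym by assumption; eapply Rle_trans; [apply K_increment0; lra|].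
  apply Rmult_le_compat_l; [assumption|].
  rewrite (Rpower_split r a), Rmult_comm by lra.
  apply Rmult_le_compat_l; [apply Rlt_le, Rpower_pos|rewrite Rabs_left; lra].
- rewrite Kx_pos by assumption; destruct (Rle_lt_dec 0 d) as [Hd0|Hd0].
  + eapply Rle_trans; [apply K_increment; lra|].
    apply Rmult_le_compat_l; [assumption|].
    rewrite (Rpower_split r a), (Rpower_split (r + d) a), (Rabs_pos_eq d) by lra.
    assert (Rpower (r + d) (a - 1) <= Rpower r (a - 1)) by (apply Rpower_le_neg; lra); nra.
  + rewrite norm_minus_sym; eapply Rle_trans; [apply K_increment; lra|].
    apply Rmult_le_compat_l; [assumption|].
    rewrite (Rpower_split r a), (Rpower_split (r + d) a), (Rabs_left d) by lra.
    assert (Rpower r (a - 1) <= Rpower (r + d) (a - 1)) by (apply Rpower_le_neg; lra); nra.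
Qed.

Lemma Kx_bound : exists C, 0 < C /\ forall r x, r < T -> norm (Kx r x) <= C * norm x.
Proof.
destruct (linear_norm K0 HK0) as (C0 & HC0 & Hb0).
pose proof N'a_ge0; pose proof (Rpower_pos T a).
exists (C0 + N' / a * Rpower T a).
assert (0 <= N' / a * Rpower T a) by (apply Rmult_le_pos; lra).
split; [lra|]; intros r x Hr; specialize (Hb0 x); pose proof (norm_ge_0 x).
destruct (Rle_lt_dec r 0) as [Hneg|Hpos].
- rewrite Kx_neg by assumption; nra.
- rewrite Kx_pos by assumption.
  eapply Rle_trans; [apply (norm_le_minus _ (K0 x))|].
  assert (norm (minus (K r x) (K0 x)) <= N' / a * norm x * Rpower r a)
    by (apply K_increment0; lra).
  assert (Rpower r a <= Rpower T a) by (apply Rle_Rpower_l; lra).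
  assert (0 <= N' / a * norm x) by (apply Rmult_le_pos; lra).
  nra.
Qed.

Lemma Kx_linear r x y : r < T -> Kx r (minus x y) = minus (Kx r x) (Kx r y).
Proof.
intros Hr; destruct (Rle_lt_dec r 0).
- rewrite !Kx_neg by assumption; now apply linear_minus.
- rewrite !Kx_pos by assumption; apply linear_minus, HK; lra.
Qed.

Lemma Kx_near0 r x : r < T -> norm (minus (Kx r x) (K0 x)) <= N' / a * norm x * Rpower (Rabs r) a.
Proof.
intros Hr; destruct (Rle_lt_dec r 0).
- rewrite Kx_neg by assumption; hnorm zero; rewrite hnorm_zero.
  pose proof N'a_ge0; pose proof (norm_ge_0 x); pose proof (Rpower_pos (Rabs r) a).
  apply Rmult_le_pos; [apply Rmult_le_pos|]; lra.
- rewrite Kx_pos, Rabs_pos_eq by lra; apply K_increment0; lra.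
Qed.

(** [Rpower 0 a] equals 1, since [ln 0] is 0 by convention; hence the separate alternative r = 0. *)
Lemma Rpower_small (c e : R) : 0 <= c -> 0 < e ->
  exists d, 0 < d /\ forall r, 0 <= r < d -> c * Rpower (Rabs r) a <= e \/ r = 0.
Proof.
intros Hc He.
exists (Rpower (e / (c + 1)) (/ a)); split; [apply Rpower_pos|]; intros r Hr.
destruct (Req_dec r 0) as [|Hr0]; [now right|left].
rewrite Rabs_pos_eq by lra.
apply Rle_trans with (c * Rpower (Rpower (e / (c + 1)) (/ a)) a).
- apply Rmult_le_compat_l; [assumption|apply Rle_Rpower_l; lra].
- rewrite Rpower_mult, Rinv_l, Rpower_1; try lra.
  + apply Rle_trans with ((c + 1) * (e / (c + 1))); [|right; field; lra].
    apply Rmult_le_compat_r; [|lra]; apply Rlt_le, Rdiv_lt_0_compat; lra.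
  + apply Rdiv_lt_0_compat; lra.
Qed.

Lemma Kx_joint0 x eps : 0 < T -> 0 < eps -> exists d, 0 < d /\ forall r y,
  Rabs r < d -> norm (minus y x) < d -> norm (minus (Kx r y) (K0 x)) <= eps.
Proof.
intros HT He.
destruct (Kx_bound) as (C & HC & HCb).
pose proof N'a_ge0; pose proof (norm_ge_0 x).
destruct (Rpower_small (N' / a * norm x) (eps / 2)) as (d1 & Hd1 & Hp); [|lra|].
{ now apply Rmult_le_pos. }
assert (0 < eps / 2 / C) by (apply Rdiv_lt_0_compat; lra).
exists (Rmin T (Rmin d1 (eps / 2 / C))); split; [repeat apply Rmin_pos; lra|].
intros r y Hr Hy.
rmin_bounds.
assert (r < T) as HrT by (pose proof (Rle_abs r); lra).
eapply Rle_trans; [apply (norm_minus_tri _ (Kx r x))|].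
assert (norm (minus (Kx r y) (Kx r x)) <= eps / 2).
{ rewrite <- (norm_congr (Kx r (minus y x))) by now apply Kx_linear.
  eapply Rle_trans; [now apply HCb|].
  apply Rle_trans with (C * (eps / 2 / C)); [|right; field; lra].
  apply Rmult_le_compat_l; lra. }
assert (norm (minus (Kx r x) (K0 x)) <= eps / 2); [|lra].
destruct (Rle_lt_dec r 0) as [Hneg|Hpos].
- rewrite Kx_neg by assumption; hnorm zero; rewrite hnorm_zero; lra.
- eapply Rle_trans; [now apply Kx_near0|].
  destruct (Hp r) as [|E]; [|assumption|lra].
  rewrite Rabs_pos_eq in Hr by lra; lra.
Qed.

Lemma Kx_fn_continuous tau s : 0 < s < T -> tau - s < T ->
  continuous (fun s => Kx (tau - s) (f s)) s.
Proof.
intros Hs Htau; destruct Hf as [Hfc Hfb].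
destruct (Rtotal_order s tau) as [Hlt|[Heq|Hgt]].
- apply (continuous_ext_near (fun s => K (tau - s) (f s)) _ s (tau - s)); [lra| |].
  + intros r Hr; rewrite Kx_pos; [reflexivity|]; apply Rabs_def2 in Hr; lra.
  + apply (kernel_fn_continuous a T Ha N M); try assumption; lra.
- subst tau; apply continuous_hnorm; intros eps He.
  destruct (Kx_joint0 (f s) (eps / 2)) as (d & Hd & Hd'); [lra|lra|].
  destruct (proj1 (continuous_hnorm _ _) (Hfc s Hs) d Hd) as (d2 & Hd2 & Hc).
  exists (Rmin d d2); split; [now apply Rmin_pos|]; intros r Hr.
  rmin_bounds.
  rewrite (Kx_neg (s - s)) by lra.
  eapply Rle_lt_trans; [apply Hd'|lra].
  + rewrite Rabs_minus_sym; lra.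
  + apply Hc; lra.
- apply (continuous_ext_near (fun s => K0 (f s)) _ s (s - tau)); [lra| |].
  + intros r Hr; rewrite Kx_neg; [reflexivity|]; apply Rabs_def2 in Hr; lra.
  + apply (linear_continuous K0); [assumption|now apply Hfc].
Qed.

Lemma Kx_sing t tau : 0 < t < T -> tau < T ->
  exists C, sing a C t (fun s => Kx (tau - s) (f s)).
Proof.
intros Ht Htau; destruct Kx_bound as (C & HC & HCb).
exists (C * M); split; intros s Hs.
- apply Kx_fn_continuous; lra.
- eapply Rle_trans; [apply HCb; lra|]; rewrite Rmult_assoc.
  apply Rmult_le_compat_l; [lra|].
  assert (norm (f s) <= M * Rpower s (a - 1)) by (apply Hf; lra).
  pose proof (Rpower_pos (t - s) (a - 1)); nra.
Qed.

(** For d < 0 the second integral runs backwards and removes the part of (0,t) on which the extended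
    kernel is K0. *)
Lemma conv_translate t d : 0 < t < T -> 0 < t + d < T ->
  conv K f (t + d) = plus (Int (fun s => Kx (t + d - s) (f s)) t)
    (RInt (fun s => Kx (t + d - s) (f s)) t (t + d)).
Proof.
intros Ht Hd; apply is_int_unique.
apply (is_int_ext (fun s => Kx (t + d - s) (f s))); [lra| |].
- intros s Hs; apply Kx_pos; lra.
- apply (is_int_shift T); try assumption.
  + intros s Hs; apply Kx_fn_continuous; lra.
  + destruct (Kx_sing t (t + d)) as [C HC]; try lra.
    apply (sing_int a C); try lra; assumption.
Qed.

Lemma conv_translate_tail t eps : 0 < t < T -> 0 < eps -> exists e, 0 < e /\
  forall d, Rabs d < e ->
  norm (minus (RInt (fun s => Kx (t + d - s) (f s)) t (t + d)) (scal d (K0 (f t))))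
    <= eps * Rabs d.
Proof.
intros Ht He.
destruct (Kx_joint0 (f t) eps) as (d1 & Hd1 & HK1); [lra|assumption|].
destruct (proj1 (continuous_hnorm _ _) (proj1 Hf t Ht) d1 Hd1) as (d2 & Hd2 & Hc).
exists (Rmin (Rmin t (T - t)) (Rmin d1 d2)); split; [repeat apply Rmin_pos; lra|].
intros d Hd.
rmin_bounds.
assert (Hdb : - t < d < T - t) by (apply Rabs_def2 in Hd; lra).
set (h := fun s => Kx (t + d - s) (f s)).
assert (is_RInt h t (t + d) (RInt h t (t + d))) as HI.
{ apply is_RInt_continuous; intros s Hs.
  assert (0 < s < T) by (apply (between_minmax 0 T t (t + d)); lra).
  apply Kx_fn_continuous; [assumption|].
  unfold Rmin, Rmax in Hs; destruct (Rle_dec t (t + d)); lra. }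
pose proof (is_RInt_const t (t + d) (K0 (f t))) as HIc.
replace (t + d - t) with d in HIc by ring.
pose proof (is_RInt_minus _ _ _ _ _ _ HI HIc) as HIm.
rewrite Rmult_comm; replace d with (t + d - t) at 3 by ring.
apply (norm_RInt_le_const_abs (V := H) _ t (t + d) _ eps) with (2 := HIm).
intros s Hs; unfold h.
apply HK1.
- unfold Rmin, Rmax in Hs; apply Rabs_def1; apply Rabs_def2 in Hd;
    destruct (Rle_dec t (t + d)); lra.
- apply Hc; unfold Rmin, Rmax in Hs; apply Rabs_def1; apply Rabs_def2 in Hd;
    destruct (Rle_dec t (t + d)); lra.
Qed.

Lemma conv_quotient_limit t : 0 < t < T ->
  filterlim (fun d => Int (fun s => scal (/ d)
      (minus (Kx (t + d - s) (f s)) (Kx (t - s) (f s)))) t)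
    (locally' 0) (locally (conv k f t)).
Proof.
intros Ht.
(* [Kx_increment] bounds the quotient by N'/a |f s| (t-s)^(a-1), and [beta_bound] turns s^(a-1)
   (t-s)^(a-1) into a sum with the factor 2 t^(a-1). *)
set (C := N' / a * M * (2 * Rpower t (a - 1))).
assert (HC : 0 <= N' * M) by now apply Rmult_le_pos.
apply (dominated_convergence (locally' 0)) with (a := a)
  (M := Rmax C (2 * N' * M * Rpower t (a - 1))); try lra.
- assert (0 < T - t) as HTt by lra.
  exists (mkposreal _ HTt); intros d Hd Hd0.
  real_ball_in Hd.
  rewrite Ropp_0, Rplus_0_r in Hd.
  assert (d < T - t) as HdT by (pose proof (Rle_abs d); lra).
  apply sing_le with C; [apply Rmax_l|]; split; intros s Hs.
  + apply (continuous_scal_r (/ d) (fun s => minus (Kx (t + d - s) (f s)) (Kx (t - s) (f s)))).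
    apply (continuous_minus (fun s => Kx (t + d - s) (f s)) (fun s => Kx (t - s) (f s)));
      apply Kx_fn_continuous; lra.
  + rewrite hnorm_scal.
    replace (t + d - s) with (t - s + d) by ring.
    eapply Rle_trans; [apply Rmult_le_compat_l; [apply Rabs_pos|apply Kx_increment; lra]|].
    rewrite Rabs_inv.
    apply Rabs_no_R0 in Hd0.
    apply Rle_trans with (N' / a * (norm (f s) * Rpower (t - s) (a - 1)));
      [right; field; split; [lra|assumption]|].
    unfold C; rewrite !Rmult_assoc; apply Rmult_le_compat_l; [apply N'a_ge0|].
    assert (norm (f s) <= M * Rpower s (a - 1)) as Hfs by (apply Hf; lra).
    pose proof (beta_bound a s t Ha Hs) as Hbeta; pose proof (Rpower_pos (t - s) (a - 1)).
    apply Rle_trans with (M * (Rpower s (a - 1) * Rpower (t - s) (a - 1))); [nra|].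
    rewrite <- Rmult_assoc with (r1 := 2); now apply Rmult_le_compat_l.
- apply sing_le with (2 * N' * M * Rpower t (a - 1)); [apply Rmax_r|].
  now apply (conv_sing a T).
- intros s Hs eps He.
  assert (continuous (fun p : R * R => k (fst p) (f (snd p))) (t - s, s)) as Hc.
  { apply (kernel_fn_continuous2 a T Ha N' M); try assumption; lra. }
  destruct (continuous2_norm _ _ _ Hc (eps / 4)) as (d & Hd & HP); [lra|]; simpl in HP.
  set (e := Rmin d (Rmin (t - s) (Rmin s (T - t)))).
  assert (0 < e) as He0 by (repeat apply Rmin_pos; lra).
  assert (e <= d /\ e <= t - s /\ e <= s /\ e <= T - t) as (E1 & E2 & E3 & E4).
  { pose proof (Rmin_l d (Rmin (t - s) (Rmin s (T - t)))).
    pose proof (Rmin_r d (Rmin (t - s) (Rmin s (T - t)))).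
    rmin_bounds.
    unfold e; repeat split; lra. }
  exists (e / 2); split; [lra|].
  assert (0 < e / 2) as He2 by lra.
  exists (mkposreal _ He2); intros dl; change R in dl; intros Hdl Hdl0 r Hr.
  real_ball_in Hdl.
  rewrite Ropp_0, Rplus_0_r in Hdl.
  assert (Hr' : s - e / 2 < r < s + e / 2) by (apply Rabs_def2 in Hr; lra).
  assert (Hdl' : - (e / 2) < dl < e / 2) by (apply Rabs_def2 in Hdl; lra).
  rewrite !Kx_pos by lra.
  assert (norm (minus (k (t - r) (f r)) (k (t - s) (f s))) < eps / 4) as Hn1
    by (apply HP; apply Rabs_def1; lra).
  (* The mean value inequality compares the increment with one fixed value of k, uniformly in r near
     s; this is the local uniform convergence that is required. *)
  assert (norm (minus (minus (K (t + dl - r) (f r)) (K (t - r) (f r)))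
     (scal (t + dl - r - (t - r)) (k (t - s) (f s)))) <= eps / 4 * Rabs (t + dl - r - (t - r)))
    as Hn2.
  { apply (mean_value_const (fun q => K q (f r)) (fun q => k q (f r))).
    - intros q Hq; apply HKk; unfold Rmin, Rmax in Hq; destruct (Rle_dec (t - r) (t + dl - r)); lra.
    - intros q Hq; left; apply HP; [|apply Rabs_def1; lra].
      unfold Rmin, Rmax in Hq; apply Rabs_def1; destruct (Rle_dec (t - r) (t + dl - r)); lra. }
  replace (t + dl - r - (t - r)) with dl in Hn2 by ring.
  eapply Rle_lt_trans; [apply (norm_minus_tri _ (k (t - s) (f s)))|].
  rewrite (norm_minus_sym (k (t - s) (f s))).
  assert (norm (minus (scal (/ dl) (minus (K (t + dl - r) (f r)) (K (t - r) (f r))))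
    (k (t - s) (f s))) <= eps / 4) as Hn3;
    [|apply Rle_lt_trans with (eps / 4 + eps / 4);
      [apply Rplus_le_compat; [exact Hn3|left; exact Hn1]|lra]].
  rewrite (norm_congr _ (scal (/ dl) (minus (minus (K (t + dl - r) (f r)) (K (t - r) (f r)))
     (scal dl (k (t - s) (f s)))))) by (hfield; assumption).
  rewrite hnorm_scal, Rabs_inv.
  apply Rabs_no_R0 in Hdl0; pose proof (Rabs_pos dl).
  apply Rle_trans with (/ Rabs dl * (eps / 4 * Rabs dl)); [|right; field; assumption].
  apply Rmult_le_compat_l; [apply Rlt_le, Rinv_0_lt_compat; lra|assumption].
Qed.

Lemma conv_derive t : 0 < t < T ->
  is_derive (conv K f) t (plus (K0 (f t)) (conv k f t)).
Proof.
intros Ht; apply is_derive_hnorm; intros eps He.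
destruct (conv_translate_tail t (eps / 2) Ht) as (e1 & He1 & Htail); [lra|].
assert (0 < eps / 2) as He2 by lra.
destruct (proj1 (filterlim_hnorm (locally' 0) _ _) (conv_quotient_limit t Ht) _ He2)
  as [[e2 He2'] Hq].
exists (Rmin (Rmin t (T - t)) (Rmin e1 e2)); split; [repeat apply Rmin_pos; lra|].
intros s Hs.
rmin_bounds.
destruct (Req_dec s t) as [->|Hst].
{ hnorm zero; rewrite hnorm_zero; apply Rmult_le_pos; [lra|apply Rabs_pos]. }
set (d := s - t) in *; replace s with (t + d) by (unfold d; lra).
assert (Hd0 : d <> 0) by (unfold d; lra).
assert (Hdb : - t < d < T - t) by (apply Rabs_def2 in Hs; lra).
rewrite conv_translate by lra.
assert (Hq' : norm (minus (Int (fun s => scal (/ d)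
      (minus (Kx (t + d - s) (f s)) (Kx (t - s) (f s)))) t) (conv k f t)) < eps / 2).
{ apply (Hq d); [|exact Hd0].
  real_ball.
  rewrite Ropp_0, Rplus_0_r; lra. }
set (D := Int (fun s => Kx (t + d - s) (f s)) t) in *.
set (rho := RInt (fun s => Kx (t + d - s) (f s)) t (t + d)).
assert (norm (minus rho (scal d (K0 (f t)))) <= eps / 2 * Rabs d) as Hrho
  by (apply Htail; lra).
assert (Int (fun s => scal (/ d) (minus (Kx (t + d - s) (f s)) (Kx (t - s) (f s)))) t =
  scal (/ d) (minus D (conv K f t))) as E.
{ apply is_int_unique.
  apply is_int_scal, is_int_minus.
  - destruct (Kx_sing t (t + d)) as [C HC]; try lra.
    apply (sing_int a C); try lra; assumption.
  - apply (is_int_ext (fun s => K (t - s) (f s))); [lra| |].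
    + intros r Hr; symmetry; apply Kx_pos; lra.
    + now apply (conv_is_int a T Ha N M). }
rewrite E in Hq'.
(* The remainder splits into d times the error of the quotient and the error of the tail; each takes
   eps/2. *)
rewrite (norm_congr _ (plus (scal d (minus (scal (/ d) (minus D (conv K f t))) (conv k f t)))
  (minus rho (scal d (K0 (f t)))))) by (hfield; assumption).
eapply Rle_trans; [apply hnorm_triangle|].
rewrite hnorm_scal; pose proof (Rabs_pos d).
apply Rle_trans with (Rabs d * (eps / 2) + eps / 2 * Rabs d).
- apply Rplus_le_compat; [|exact Hrho].
  apply Rmult_le_compat_l; [assumption|left; exact Hq'].
- right; field.
Qed.

End ConvolutionDerivative.

Lemma exp_mono x y : x <= y -> exp x <= exp y.
Proof. intros [Hxy| ->]; [left; now apply exp_increasing|lra]. Qed.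

(** Trades the exponential decay of the weight for a power of y = lambda (t - s), which produces the
    small factor lambda^(-b). *)
Lemma exp_neg_le_Rpower b y : 0 < b <= 1 -> 0 < y -> exp (- y) <= Rpower y (- b).
Proof.
intros Hb Hy; unfold Rpower; apply exp_mono.
assert (ln y <= y) as Hln.
{ rewrite <- (exp_ln y) at 2 by assumption; pose proof (exp_ineq1_le (ln y)); lra. }
destruct (Rle_lt_dec 0 (ln y)); nra.
Qed.

(** * Volterra equations of the second kind *)

Section Volterra.
Context {H : HilbertSpace} (a T : R) (Ha : 0 < a < 1).
Context (N : R) (k : R -> H -> H) (HN : 0 <= N) (Hk : kernel a T N k).

Definition weight (lam t : R) : R := Rpower t (a - 1) * exp (lam * t).

Lemma weight_bounds lam t : 0 <= lam -> 0 < t < T ->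
  Rpower t (a - 1) <= weight lam t <= exp (lam * T) * Rpower t (a - 1).
Proof.
intros Hl Ht; unfold weight; pose proof (Rpower_pos t (a - 1)).
assert (1 <= exp (lam * t)) by (rewrite <- exp_0; apply exp_mono; nra).
assert (exp (lam * t) <= exp (lam * T)) by (apply exp_mono; nra).
split; nra.
Qed.

(** The ratio of the exponential weights at s and t is exp (- lam (t - s)) <= (lam (t - s))^(-b)
    with b = a/2. Against (t - s)^(a-1) this leaves the integrable power (t - s)^(b-1) and the
    factor lam^(-b). *)
Lemma conv_contraction : exists lam, 0 < lam /\ forall (f : R -> H) M, 0 <= M ->
  (forall t, 0 < t < T -> continuous f t) ->
  (forall t, 0 < t < T -> norm (f t) <= M * weight lam t) ->
  forall t, 0 < t < T -> norm (conv k f t) <= M / 2 * weight lam t.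
Proof.
set (b := a / 2); assert (0 < b < 1) as Hb by (unfold b; lra).
pose proof (Rpower_pos T b) as HTb.
(* It will be the inverse of lam^(-b). The total constant is 4 N T^b / (b q), with 2 from
   [beta_bound] and 2/b from [sing_int]; this q makes it at most 1/2, and the added 1 keeps q
   positive when N = 0. *)
set (q := 8 * N * Rpower T b / b + 1).
assert (1 <= q) as Hq.
{ unfold q; assert (0 <= 8 * N * Rpower T b / b); [|lra].
  apply Rmult_le_pos; [|apply Rlt_le, Rinv_0_lt_compat; lra]; nra. }
exists (Rpower q (/ b)); split; [apply Rpower_pos|].
set (lam := Rpower q (/ b)); assert (0 < lam) as Hlam by apply Rpower_pos.
assert (Rpower lam (- b) = / q) as Hlb.
{ unfold lam; rewrite Rpower_Ropp, Rpower_mult, Rinv_l, Rpower_1 by lra; reflexivity. }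
intros f M HM Hc Hf t Ht.
set (C := N * M * exp (lam * t) * / q * (Rpower t b * (2 * Rpower t (b - 1)))).
assert (0 < / q) as Hq' by (apply Rinv_0_lt_compat; lra).
pose proof (exp_pos (lam * t)) as Het.
assert (0 <= N * M) as HNM by nra.
assert (0 <= N * M * exp (lam * t)) as H1 by (apply Rmult_le_pos; lra).
assert (0 <= N * M * exp (lam * t) * / q) as H2 by (apply Rmult_le_pos; lra).
assert (Hbf : bounded_fn a T (M * exp (lam * T)) f).
{ split; [assumption|]; intros s Hs; eapply Rle_trans; [now apply Hf|].
  rewrite Rmult_assoc; apply Rmult_le_compat_l; [assumption|].
  apply weight_bounds; lra. }
assert (sing b C t (fun s => k (t - s) (f s))) as Hs.
{ split; intros s Hs.
  - apply (kernel_fn_continuous a T Ha N (M * exp (lam * T))); try assumption; lra.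
  - eapply Rle_trans; [apply (kernel_bound a T N) with (M := M * weight lam s); try assumption|].
    + lra.
    + apply Hf; lra.
    + unfold weight.
      replace (lam * s) with (lam * t + - (lam * (t - s))) by ring; rewrite exp_plus.
      pose proof (exp_neg_le_Rpower b (lam * (t - s)) ltac:(lra) ltac:(nra)) as Hexp.
      rewrite <- Rpower_mult_distr, Hlb in Hexp by lra.
      pose proof (beta_bound b s t Hb Hs) as Hbeta.
      assert (Rpower (t - s) (a - 1) * Rpower (t - s) (- b) = Rpower (t - s) (b - 1)) as E1
        by (rewrite <- Rpower_plus; f_equal; unfold b; lra).
      assert (Rpower s (a - 1) = Rpower s b * Rpower s (b - 1)) as E2
        by (rewrite <- Rpower_plus; f_equal; unfold b; lra).
      assert (Rpower s b <= Rpower t b) as Hst by (apply Rle_Rpower_l; lra).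
      pose proof (Rpower_pos (t - s) (a - 1)); pose proof (Rpower_pos s (a - 1)).
      pose proof (Rpower_pos s (b - 1)); pose proof (Rpower_pos (t - s) (b - 1)).
      pose proof (Rpower_pos t (b - 1)); pose proof (Rpower_pos t b); pose proof (Rpower_pos s b).
      apply Rle_trans with (N * M * exp (lam * t) * (Rpower (t - s) (a - 1) * Rpower s (a - 1)
        * exp (- (lam * (t - s))))); [right; ring|].
      unfold C; rewrite !(Rmult_assoc (N * M * exp (lam * t))).
      apply Rmult_le_compat_l; [assumption|].
      apply Rle_trans with (Rpower (t - s) (a - 1) * Rpower s (a - 1) *
        (/ q * Rpower (t - s) (- b))); [apply Rmult_le_compat_l; [nra|assumption]|].
      replace (Rpower (t - s) (a - 1) * Rpower s (a - 1) * (/ q * Rpower (t - s) (- b)))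
        with (/ q * ((Rpower (t - s) (a - 1) * Rpower (t - s) (- b)) * Rpower s (a - 1))) by ring.
      rewrite E1, E2, (Rmult_assoc (/ q)); apply Rmult_le_compat_l; [lra|].
      apply Rle_trans with (Rpower t b * (Rpower s (b - 1) * Rpower (t - s) (b - 1))).
      * replace (Rpower (t - s) (b - 1) * (Rpower s b * Rpower s (b - 1))) with
          (Rpower s b * (Rpower s (b - 1) * Rpower (t - s) (b - 1))) by ring.
        apply Rmult_le_compat_r; [nra|assumption].
      * rewrite (Rmult_assoc (Rpower t b)); apply Rmult_le_compat_l; [lra|assumption]. }
destruct (sing_int b C t (fun s => k (t - s) (f s))) as [_ Hle]; try lra; [assumption|].
eapply Rle_trans; [exact Hle|].
unfold C, weight.
assert (Rpower t (a - 1) = Rpower t b * Rpower t (b - 1)) as E1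
  by (rewrite <- Rpower_plus; f_equal; unfold b; lra).
assert (Rpower t b <= Rpower T b) as HtT by (apply Rle_Rpower_l; lra).
rewrite E1.
apply Rle_trans with (M * (Rpower t b * Rpower t (b - 1) * exp (lam * t)) *
  (4 * N * Rpower T b / b * / q)).
- replace (N * M * exp (lam * t) * / q * (Rpower t b * (2 * Rpower t (b - 1)))
    * (2 / b * Rpower t b)) with
   (M * (Rpower t b * Rpower t (b - 1) * exp (lam * t)) * (4 * N * Rpower t b / b * / q))
   by (field; lra).
  pose proof (Rpower_pos t b); pose proof (Rpower_pos t (b - 1)).
  apply Rmult_le_compat_l.
  + apply Rmult_le_pos; [assumption|]; apply Rmult_le_pos; [nra|lra].
  + apply Rmult_le_compat_r; [lra|]; apply Rmult_le_compat_r.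
    * apply Rlt_le, Rinv_0_lt_compat; lra.
    * apply Rmult_le_compat_l; lra.
- assert (4 * N * Rpower T b / b * / q <= / 2) as Hhalf.
  { apply (Rmult_le_reg_r q); [lra|]; rewrite Rmult_assoc, Rinv_l by lra.
    rewrite Rmult_1_r; unfold q.
    replace (8 * N * Rpower T b / b) with (2 * (4 * N * Rpower T b / b)) by (field; lra); lra. }
  pose proof (Rpower_pos t b); pose proof (Rpower_pos t (b - 1)).
  assert (0 <= M * (Rpower t b * Rpower t (b - 1) * exp (lam * t))).
  { apply Rmult_le_pos; [assumption|]; apply Rmult_le_pos; [nra|lra]. }
  nra.
Qed.

Lemma half_pow_lim C eps : 0 < eps -> exists n, C * / 2 ^ n < eps.
Proof.
intros He.
destruct (nfloor_ex (Rabs C / eps + 1)) as (n & _ & Hn).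
{ assert (0 <= Rabs C / eps); [|lra].
  apply Rmult_le_pos; [apply Rabs_pos|apply Rlt_le, Rinv_0_lt_compat; assumption]. }
exists (S n).
assert (INR n + 1 <= 2 ^ S n) as Hp.
{ clear; induction n as [|n IH]; [simpl; lra|].
  rewrite S_INR; pose proof (pos_INR n); rewrite <- tech_pow_Rmult; lra. }
assert (Rabs C / eps < 2 ^ S n) as Hlt by lra.
assert (0 < 2 ^ S n) as Hpos by (apply pow_lt; lra).
apply (Rmult_lt_reg_r (2 ^ S n)); [assumption|].
rewrite Rmult_assoc, Rinv_l, Rmult_1_r by lra.
apply (Rmult_lt_compat_l eps) in Hlt; [|assumption].
replace (eps * (Rabs C / eps)) with (Rabs C) in Hlt by (field; lra).
pose proof (Rle_abs C); lra.
Qed.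

Lemma le_of_half_pow X Y C : (forall n, X <= Y + C * / 2 ^ n) -> X <= Y.
Proof.
intros Hn; apply Rnot_lt_le; intros Hlt.
destruct (half_pow_lim C (X - Y)) as [n Hn']; [lra|]; specialize (Hn n); lra.
Qed.

Lemma geometric_limit (u : nat -> H) C :
  (forall n, norm (minus (u (S n)) (u n)) <= C * / 2 ^ n) ->
  exists l, forall n, norm (minus l (u n)) <= 2 * C * / 2 ^ n.
Proof.
intros Hu.
assert (Hinc : forall n p, norm (minus (u (n + p)%nat) (u n)) <= 2 * C * / 2 ^ n - 2 * C * / 2 ^ (n + p)).
{ intros n p; induction p as [|p IH].
  - rewrite Nat.add_0_r; hnorm zero; rewrite hnorm_zero; lra.
  - rewrite Nat.add_succ_r.
    eapply Rle_trans; [apply (norm_minus_tri _ (u (n + p)%nat))|].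
    specialize (Hu (n + p)%nat).
    assert (0 < 2 ^ (n + p)) by (apply pow_lt; lra).
    rewrite <- (tech_pow_Rmult 2 (n + p)), Rinv_mult.
    lra. }
assert (HC : 0 <= C).
{ specialize (Hu 0%nat); simpl in Hu; rewrite Rinv_1 in Hu.
  pose proof (norm_ge_0 (minus (u 1%nat) (u 0%nat))); lra. }
assert (Hinc' : forall n p, norm (minus (u (n + p)%nat) (u n)) <= 2 * C * / 2 ^ n).
{ intros n p; eapply Rle_trans; [apply Hinc|].
  assert (0 < / 2 ^ (n + p)) by (apply Rinv_0_lt_compat, pow_lt; lra); nra. }
destruct (proj1 (filterlim_locally_cauchy (U := H) (F := eventually) u)) as [l Hl].
{ intros [eps He].
  destruct (half_pow_lim (4 * C) eps He) as [n Hn].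
  exists (fun p => (n <= p)%nat); split; [now exists n|].
  intros p q Hp Hq; apply (norm_compat1 (K := R_AbsRing) (V := H)); simpl.
  eapply Rle_lt_trans; [apply (norm_minus_tri _ (u n))|].
  rewrite (norm_minus_sym (u n)).
  pose proof (Hinc' n (p - n)%nat) as I1; pose proof (Hinc' n (q - n)%nat) as I2.
  replace (n + (p - n))%nat with p in I1 by lia; replace (n + (q - n))%nat with q in I2 by lia.
  lra. }
exists l; intros n; apply Rnot_lt_le; intros Hlt.
assert (0 < norm (minus l (u n)) - 2 * C * / 2 ^ n) as Hpos by lra.
destruct (proj1 (filterlim_hnorm eventually u l) Hl _ Hpos) as [p Hp].
specialize (Hp (n + p)%nat ltac:(lia)); specialize (Hinc' n p).
pose proof (norm_minus_tri l (u (n + p)%nat) (u n)) as Htri.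
rewrite (norm_minus_sym l (u (n + p)%nat)) in Htri; lra.
Qed.

(** Each use of u = k * u halves the weighted bound of u. *)
Lemma volterra_unique (u : R -> H) M : 0 <= M -> bounded_fn a T M u ->
  (forall t, 0 < t < T -> u t = conv k u t) -> forall t, 0 < t < T -> u t = zero.
Proof.
intros HM [Hc Hb] Hu t Ht.
destruct conv_contraction as (lam & Hlam & Hcontr).
assert (Hn : forall n t, 0 < t < T -> norm (u t) <= M * / 2 ^ n * weight lam t).
{ induction n as [|n IH]; intros s Hs.
  - simpl; rewrite Rinv_1, Rmult_1_r; eapply Rle_trans; [now apply Hb|].
    apply Rmult_le_compat_l; [assumption|]; apply weight_bounds; lra.
  - rewrite Hu by assumption.
    eapply Rle_trans; [apply (Hcontr u (M * / 2 ^ n)); try assumption|].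
    + apply Rmult_le_pos; [assumption|]; apply Rlt_le, Rinv_0_lt_compat, pow_lt; lra.
    + rewrite <- tech_pow_Rmult, Rinv_mult; right; field; apply pow_nonzero; lra. }
assert (norm (u t) <= 0) as Hle.
{ apply (le_of_half_pow _ _ (M * weight lam t)); intros n.
  specialize (Hn n t Ht); lra. }
apply (norm_eq_zero (u t)); pose proof (norm_ge_0 (u t)); lra.
Qed.

Lemma volterra_exists (F : R -> H) MF : 0 <= MF -> bounded_fn a T MF F ->
  exists (y : R -> H) M, 0 <= M /\ bounded_fn a T M y /\
    forall t, 0 < t < T -> y t = plus (F t) (conv k y t).
Proof.
intros HMF HF.
destruct conv_contraction as (lam & Hlam & Hcontr).
(* Picard iteration from 0; consecutive iterates differ by at most MF / 2^n in the weighted norm. *)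
set (u := fix u n := match n with
  | O => fun _ : R => zero : H
  | Datatypes.S p => fun t => plus (F t) (conv k (u p) t) end).
assert (Hu : forall n, exists M, 0 <= M /\ bounded_fn a T M (u n)).
{ induction n as [|n (M & HM & Hb)].
  - exists 0; split; [lra|]; split; intros t Ht; simpl.
    + apply continuous_const.
    + rewrite hnorm_zero; lra.
  - exists (MF + 4 / a * (N * M) * Rpower T a); split.
    + pose proof (Rpower_pos T a).
      assert (0 <= 4 / a) by (apply Rlt_le, Rdiv_lt_0_compat; lra).
      assert (0 <= 4 / a * (N * M)) by (apply Rmult_le_pos; nra); nra.
    + apply bounded_fn_plus; [assumption|]; now apply conv_bounded_fn. }
assert (Hd : forall n t, 0 < t < T ->
  norm (minus (u (S n) t) (u n t)) <= MF * weight lam t * / 2 ^ n).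
{ induction n as [|n IH]; intros t Ht.
  - assert (conv k (u 0%nat) t = zero) as E0.
    { apply (norm_eq_zero (conv k (u 0%nat) t)).
      assert (bounded_fn a T 0 (u 0%nat)) as Hb0.
      { split; intros s Hs; simpl; [apply continuous_const|rewrite hnorm_zero; lra]. }
      pose proof (conv_norm a T Ha N 0 k (u 0%nat) t HN (Rle_refl 0) Hk Hb0 Ht) as Hle.
      rewrite Rmult_0_r, Rmult_0_r, Rmult_0_l in Hle.
      pose proof (norm_ge_0 (conv k (u 0%nat) t)); lra. }
    change (u 1%nat t) with (plus (F t) (conv k (u 0%nat) t)); rewrite E0.
    simpl (2 ^ 0); rewrite Rinv_1, Rmult_1_r.
    change (u 0%nat t) with (zero : H).
    hnorm (F t); eapply Rle_trans; [now apply HF|].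
    apply Rmult_le_compat_l; [assumption|]; apply weight_bounds; lra.
  - destruct (Hu n) as (M1 & HM1 & Hb1); destruct (Hu (S n)) as (M2 & HM2 & Hb2).
    change (u (S (S n)) t) with (plus (F t) (conv k (u (S n)) t)).
    change (u (S n) t) with (plus (F t) (conv k (u n) t)).
    rewrite (norm_congr _ (conv k (fun s => minus (u (S n) s) (u n s)) t)).
    2:{ rewrite (conv_minus a T Ha N M2 M1) by assumption; hring. }
    eapply Rle_trans; [apply (Hcontr _ (MF * / 2 ^ n))|]; try assumption.
    + apply Rmult_le_pos; [assumption|]; apply Rlt_le, Rinv_0_lt_compat, pow_lt; lra.
    + intros s Hs; apply (continuous_minus (u (S n)) (u n)); [now apply Hb2|now apply Hb1].
    + intros s Hs; eapply Rle_trans; [now apply IH|right; ring].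
    + rewrite <- tech_pow_Rmult, Rinv_mult; right; field; apply pow_nonzero; lra. }
(* The range of t stands inside the existential, so that a limit can be chosen for every real t. *)
assert (Hlim : forall t, exists l, 0 < t < T ->
  forall n, norm (minus l (u n t)) <= 2 * (MF * weight lam t) * / 2 ^ n).
{ intros t; destruct (classic (0 < t < T)) as [Ht|Ht]; [|exists zero; tauto].
  destruct (geometric_limit (fun n => u n t) (MF * weight lam t)) as [l Hl].
  - intros n; now apply Hd.
  - now exists l. }
set (y := fun t => proj1_sig (constructive_indefinite_description _ (Hlim t))).
assert (Hy : forall t, 0 < t < T ->
  forall n, norm (minus (y t) (u n t)) <= 2 * (MF * weight lam t) * / 2 ^ n)
  by (intros t; apply (proj2_sig (constructive_indefinite_description _ (Hlim t)))).
assert (Hyb : bounded_fn a T (2 * MF * exp (lam * T)) y).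
{ split; intros t Ht.
  - apply continuous_hnorm; intros eps He.
    assert (Hw : exists d W, 0 < d /\ 0 < W /\ forall s, Rabs (s - t) < d ->
      0 < s < T /\ weight lam s <= W).
    { exists (Rmin (t / 2) (T - t)), (exp (lam * T) * Rpower (t / 2) (a - 1)).
      rmin_bounds.
      split; [apply Rmin_pos; lra|]; split.
      { apply Rmult_lt_0_compat; [apply exp_pos|apply Rpower_pos]. }
      intros s Hs; apply Rabs_def2 in Hs; split; [lra|].
      eapply Rle_trans; [apply weight_bounds; lra|].
      apply Rmult_le_compat_l; [apply Rlt_le, exp_pos|apply Rpower_le_neg; lra]. }
    destruct Hw as (d & W & Hd0 & HW & Hw).
    destruct (half_pow_lim (2 * (MF * W)) (eps / 3)) as [n Hn]; [lra|].
    assert (Hyn : forall s, Rabs (s - t) < d -> norm (minus (y s) (u n s)) < eps / 3).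
    { intros s Hs; destruct (Hw s Hs) as [Hs0 Hs1].
      eapply Rle_lt_trans; [now apply Hy|]; eapply Rle_lt_trans; [|exact Hn].
      apply Rmult_le_compat_r; [apply Rlt_le, Rinv_0_lt_compat, pow_lt; lra|nra]. }
    destruct (Hu n) as (M & _ & Hbn).
    destruct (proj1 (continuous_hnorm _ _) (proj1 Hbn t Ht) (eps / 3)) as (d' & Hd' & Hc); [lra|].
    exists (Rmin d d'); split; [now apply Rmin_pos|]; intros s Hs.
    rmin_bounds.
    assert (norm (minus (y s) (u n s)) < eps / 3) by (apply Hyn; lra).
    assert (norm (minus (y t) (u n t)) < eps / 3).
    { apply Hyn; rewrite Rminus_diag, Rabs_R0; assumption. }
    assert (norm (minus (u n s) (u n t)) < eps / 3) by (apply Hc; lra).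
    eapply Rle_lt_trans; [apply (norm_minus_tri _ (u n s))|].
    eapply Rle_lt_trans; [apply Rplus_le_compat_l, (norm_minus_tri _ (u n t))|].
    rewrite (norm_minus_sym (u n t) (y t)); lra.
  - specialize (Hy t Ht 0%nat); simpl in Hy; rewrite Rinv_1, Rmult_1_r in Hy.
    rewrite (norm_congr _ (y t)) in Hy by hring.
    pose proof (proj2 (weight_bounds lam t ltac:(lra) Ht)); nra. }
exists y, (2 * MF * exp (lam * T)).
assert (HM : 0 <= 2 * MF * exp (lam * T)) by (pose proof (exp_pos (lam * T)); nra).
split; [assumption|]; split; [assumption|]; intros t Ht.
(* Iterate n + 1 is F plus the convolution of iterate n, and both iterates are within O(2^-n) of y,
   so the residual vanishes. *)
assert (norm (minus (y t) (plus (F t) (conv k y t))) <= 0) as Hle.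
{ apply (le_of_half_pow _ _ (2 * (MF * weight lam t))); intros n.
  eapply Rle_trans; [apply (norm_minus_tri _ (u (S n) t))|].
  pose proof (Hy t Ht (S n)) as Hn.
  destruct (Hu n) as (M & HMn & Hbn).
  change (u (S n) t) with (plus (F t) (conv k (u n) t)) at 2.
  rewrite (norm_congr (minus (plus (F t) (conv k (u n) t)) (plus (F t) (conv k y t)))
    (opp (conv k (fun s => minus (y s) (u n s)) t))).
  2:{ rewrite (conv_minus a T Ha N (2 * MF * exp (lam * T)) M) by assumption; hring. }
  rewrite hnorm_opp.
  assert (norm (conv k (fun s => minus (y s) (u n s)) t) <=
    2 * MF * / 2 ^ n / 2 * weight lam t) as Hc.
  { apply Hcontr; try assumption.
    - apply Rmult_le_pos; [lra|]; apply Rlt_le, Rinv_0_lt_compat, pow_lt; lra.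
    - intros s Hs; apply (continuous_minus y (u n)); [now apply Hyb|now apply Hbn].
    - intros s Hs; eapply Rle_trans; [now apply Hy|right; ring]. }
  rewrite <- tech_pow_Rmult, Rinv_mult in Hn.
  lra. }
assert (minus (y t) (plus (F t) (conv k y t)) = zero) as E0.
{ apply (norm_eq_zero (minus (y t) (plus (F t) (conv k y t)))).
  pose proof (norm_ge_0 (minus (y t) (plus (F t) (conv k y t)))); lra. }
replace (y t) with (plus (minus (y t) (plus (F t) (conv k y t))) (plus (F t) (conv k y t)))
  at 1 by hring.
rewrite E0; hring.
Qed.

End Volterra.

Lemma Rle_limit_0 (X Y C t : R) : 0 < t -> (forall s, 0 < s < t -> X <= Y + s * C) -> X <= Y.
Proof.
intros Ht Hs; apply Rnot_lt_le; intros Hlt.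
set (s := Rmin (t / 2) ((X - Y) / (2 * (Rabs C + 1)))).
pose proof (Rabs_pos C); pose proof (Rle_abs C).
assert (0 < s) by (apply Rmin_pos; [lra|apply Rdiv_lt_0_compat; lra]).
assert (s <= t / 2) by apply Rmin_l.
assert (s <= (X - Y) / (2 * (Rabs C + 1))) as Hs2 by apply Rmin_r.
specialize (Hs s ltac:(lra)).
apply (Rmult_le_compat_r (2 * (Rabs C + 1))) in Hs2; [|lra].
replace ((X - Y) / (2 * (Rabs C + 1)) * (2 * (Rabs C + 1))) with (X - Y) in Hs2
  by (field; lra).
nra.
Qed.

Lemma is_derive_Req (f : R -> R) (t l l' : R) : is_derive f t l -> l = l' -> is_derive f t l'.
Proof. now intros Hf <-. Qed.

Lemma is_derive_Heq {H : HilbertSpace} (f : R -> H) (t : R) (l l' : H) :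
  is_derive f t l -> l = l' -> is_derive f t l'.
Proof. now intros Hf <-. Qed.

(** * The semigroup and the inverse of A *)

Section Operator.
Context {H : HilbertSpace} (A : operator H) (E E' : R -> H -> H) (S : H -> H).
Context (hA_sa : self_adjoint A) (hA_pos : positive_definite A).
Context (HSA : forall f, dom A (S f) /\ A (S f) = f).
Context (HAS : forall w, dom A w -> S (A w) = w) (HSc : compact_map S).
Context (hE : semigroup_exp A E).
Context (hE' : forall t x, 0 < t -> is_derive (fun s => E s x) t (E' t x)).
Implicit Types x y w : H.

Lemma A_sym u w : dom A u -> dom A w -> inner (A w) u = inner w (A u).
Proof.
intros Hu Hw; destruct hA_sa as [_ Hs].
apply (proj2 (Hs u (A u)) (conj Hu eq_refl) w Hw).
Qed.

Lemma A_ge0 w : dom A w -> 0 <= inner (A w) w.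
Proof.
intros Hw; destruct (classic (w = zero)) as [->|Hw0].
- rewrite inner_zero_r; lra.
- left; now apply hA_pos.
Qed.

Lemma A_dense : dense (dom A).
Proof. apply hA_sa. Qed.

Lemma A_opp w : dom A w -> dom A (opp w) /\ A (opp w) = opp (A w).
Proof.
intros Hw.
replace (opp w) with (scal (-1) w : H) by hring; split; [now apply dom_scal|].
rewrite op_scal by assumption; hring.
Qed.

Lemma S_plus x y : S (plus x y) = plus (S x) (S y).
Proof.
rewrite <- (HAS (plus (S x) (S y))).
- rewrite op_plus by apply HSA; now rewrite !(proj2 (HSA _)).
- apply dom_plus; apply HSA.
Qed.

Lemma S_scal (c : R) x : S (scal c x) = scal c (S x).
Proof.
rewrite <- (HAS (scal c (S x))).
- rewrite op_scal by apply HSA; now rewrite !(proj2 (HSA _)).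
- apply dom_scal; apply HSA.
Qed.

Lemma S_injective x y : S x = S y -> x = y.
Proof. intros Hxy; rewrite <- (proj2 (HSA x)), Hxy; apply HSA. Qed.

(** Otherwise there would be vectors of norm at most 1 with |S (u n)| > n, and no subsequence of S
    (u n) could converge, against compactness. *)
Lemma S_bounded : exists C, 0 < C /\ forall x, norm (S x) <= C * norm x.
Proof.
apply NNPP; intros Hn.
assert (forall n : nat, exists x, norm x <= 1 /\ INR n < norm (S x)) as Hx.
{ intros n; apply NNPP; intros Hn2; apply Hn.
  exists (INR n + 1); split; [pose proof (pos_INR n); lra|]; intros x.
  pose proof (norm_ge_0 x).
  destruct (Req_dec (norm x) 0) as [Hx0|Hx0].
  - rewrite Hx0; replace x with (zero : H) by (symmetry; now apply (norm_eq_zero x)).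
    replace (zero : H) with (scal 0 (zero : H) : H) by hring.
    rewrite S_scal, hnorm_scal, Rabs_R0; lra.
  - apply Rnot_lt_le; intros Hlt; apply Hn2; exists (scal (/ norm x) x).
    assert (0 < / norm x) by (apply Rinv_0_lt_compat; lra).
    rewrite S_scal, !hnorm_scal, Rabs_pos_eq by lra.
    split; [right; field; lra|].
    apply Rlt_le_trans with (/ norm x * ((INR n + 1) * norm x)).
    + replace (/ norm x * ((INR n + 1) * norm x)) with (INR n + 1) by (field; lra); lra.
    + apply Rmult_le_compat_l; lra. }
set (u := fun n => proj1_sig (constructive_indefinite_description _ (Hx n))).
assert (Hu : forall n, norm (u n) <= 1 /\ INR n < norm (S (u n)))
  by (intros n; apply (proj2_sig (constructive_indefinite_description _ (Hx n)))).
destruct (HSc u) as (phi & l & Hphi & Hl).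
{ exists 1; intros n; apply Hu. }
destruct (proj1 (filterlim_hnorm eventually _ _) Hl 1 Rlt_0_1) as [N HN].
assert (Hge : forall n, (n <= phi n)%nat).
{ induction n as [|n IH]; [lia|]; specialize (Hphi n); rewrite Nat.add_1_r in Hphi; lia. }
destruct (nfloor_ex (norm l + 1)) as (n & _ & Hn').
{ pose proof (norm_ge_0 l); lra. }
set (p := (N + n + 1)%nat).
assert (norm (minus (S (u (phi p))) l) < 1) as Hp by (apply HN; unfold p; lia).
pose proof (norm_le_minus (S (u (phi p))) l) as Hle.
destruct (Hu (phi p)) as [_ Hgt].
assert (INR n + 1 <= INR (phi p)) as Hnp.
{ rewrite <- S_INR; apply le_INR; specialize (Hge p); unfold p in *; lia. }
lra.
Qed.

Lemma S_linear : is_linear S.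
Proof.
split; [exact S_plus|exact S_scal|exact S_bounded].
Qed.

Lemma S_sym x y : inner (S x) y = inner x (S y).
Proof.
rewrite <- (proj2 (HSA y)) at 1; rewrite <- A_sym; try apply HSA.
now rewrite (proj2 (HSA x)).
Qed.

Lemma E_0 x : E 0 x = x.
Proof. apply hE. Qed.

Lemma E_linear t : 0 <= t -> is_linear (E t).
Proof. apply hE. Qed.

Lemma E_plus s t x : 0 <= s -> 0 <= t -> E (s + t) x = E s (E t x).
Proof. apply hE. Qed.

Lemma E_lim_0 x : filterlim (fun t => E t x) (at_right 0) (locally x).
Proof. apply hE. Qed.

Lemma E_generator x y :
  filterlim (fun t => scal (/ t) (minus (E t x) x)) (at_right 0) (locally y) <->
  (dom A x /\ y = opp (A x)).
Proof. apply hE. Qed.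

(** By the semigroup law the right difference quotient of E at t is the quotient at 0 taken on E t
    x. Its convergence, given by differentiability, is exactly membership in the domain of the
    generator; this yields the smoothing property for every x. *)
Lemma E'_eq t x : 0 < t -> dom A (E t x) /\ E' t x = opp (A (E t x)).
Proof.
intros Ht; apply E_generator; apply (filterlim_hnorm (at_right 0)); intros eps He.
pose proof (hE' t x Ht) as Hd; rewrite is_derive_hnorm in Hd.
destruct (Hd (eps / 2)) as (d & Hd0 & Hd'); [lra|].
exists (mkposreal d Hd0); intros s; change R in s; intros Hs Hs0.
real_ball_in Hs.
rewrite Ropp_0, Rplus_0_r in Hs.
specialize (Hd' (s + t)); replace (s + t - t) with s in Hd' by ring.
specialize (Hd' Hs); rewrite E_plus in Hd' by lra.
rewrite (norm_congr _ (scal (/ s) (minus (minus (E s (E t x)) (E t x)) (scal s (E' t x)))))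
  by (hfield; lra).
rewrite hnorm_scal, Rabs_inv, Rabs_pos_eq in * by lra.
apply Rle_lt_trans with (/ s * (eps / 2 * s)).
- apply Rmult_le_compat_l; [apply Rlt_le, Rinv_0_lt_compat; lra|exact Hd'].
- replace (/ s * (eps / 2 * s)) with (eps / 2) by (field; lra); lra.
Qed.

Lemma E_dom t x : 0 < t -> dom A (E t x).
Proof. intros Ht; now apply (E'_eq t x). Qed.

Lemma E_derive t x : 0 < t -> is_derive (fun s => E s x) t (opp (A (E t x))).
Proof. intros Ht; rewrite <- (proj2 (E'_eq t x Ht)); now apply hE'. Qed.

(** The square |E s x|^2 has derivative - 2 (A E s x, E s x) <= 0 for s > 0; strong continuity
    brings s to 0. *)
Lemma E_contraction t x : 0 <= t -> norm (E t x) <= norm x.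
Proof.
intros Ht; destruct (Req_dec t 0) as [->|Ht0]; [rewrite E_0; lra|].
assert (0 < t) as Htpos by lra.
assert (Hdec : forall s, 0 < s <= t -> norm (E t x) <= norm (E s x)).
{ intros s Hs.
  assert (- inner (E s x) (E s x) <= - inner (E t x) (E t x)) as Hm.
  { apply (nondecreasing_of_derive (fun r => - inner (E r x) (E r x))
      (fun r => - (inner (opp (A (E r x))) (E r x) + inner (E r x) (opp (A (E r x))))));
      [lra| |].
    - intros r Hr; apply (is_derive_opp (fun r => inner (E r x) (E r x))).
      apply (is_derive_inner (fun r => E r x) (fun r => E r x)); apply E_derive; lra.
    - intros r Hr; inner_expand.
      assert (0 <= inner (A (E r x)) (E r x)) by (apply A_ge0, E_dom; lra).
      rewrite (inner_sym _ (E r x) (A (E r x))); lra. }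
  rewrite !inner_norm in Hm; pose proof (norm_ge_0 (E t x)); pose proof (norm_ge_0 (E s x)).
  simpl in Hm; nra. }
apply Rnot_lt_le; intros Hlt.
assert (0 < norm (E t x) - norm x) as Hpos by lra.
destruct (lim_witness _ _ _ t (E_lim_0 x) Hpos Htpos) as (s & Hs2 & Hs1).
pose proof (Hdec s ltac:(lra)); pose proof (norm_le_minus (E s x) x); lra.
Qed.

Lemma E_A t x : 0 < t -> dom A x -> A (E t x) = E t (A x).
Proof.
intros Ht Hx.
assert (filterlim (fun s => E t (scal (/ s) (minus (E s x) x))) (at_right 0)
  (locally (E t (opp (A x))))) as Hlim.
{ apply (linear_lim (at_right 0) (E t)); [apply E_linear; lra|].
  apply E_generator; now split. }
assert (dom A (E t x) /\ E t (opp (A x)) = opp (A (E t x))) as [_ Heq].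
{ apply E_generator; apply (filterlim_ext_loc (fun s => E t (scal (/ s) (minus (E s x) x)))).
  - apply (filter_imp (fun s => 0 < s < 1)); [|apply at_right_between; lra].
    intros s Hs; rewrite (linear_scal (E t) (E_linear t ltac:(lra))).
    rewrite linear_minus by (apply E_linear; lra).
    rewrite <- !E_plus by lra; now rewrite Rplus_comm.
  - exact Hlim. }
replace (opp (A x)) with (scal (-1) (A x) : H) in Heq by hring.
rewrite (linear_scal (E t) (E_linear t ltac:(lra))) in Heq.
replace (A (E t x)) with (opp (opp (A (E t x)))) by hring; rewrite <- Heq; hring.
Qed.

(* The Lyapunov function is |u|^2 + 2 s (A u, u) + 2 s^2 |A u|^2 with u = E s x. *)
Lemma AE_bound_dom t x : 0 < t -> dom A x -> t * norm (A (E t x)) <= norm x.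
Proof.
intros Ht Hx.
set (Phi := fun s => inner (E s x) (E s x) + 2 * s * inner (E s (A x)) (E s x)
  + 2 * s ^ 2 * inner (E s (A x)) (E s (A x))).
assert (Hdec : forall s, 0 < s < t -> Phi t <= Phi s).
{ intros s Hs; apply Ropp_le_cancel.
  (* With b = A E r x, the terms in (b, E r x) and in (b, b) cancel, and - Phi has derivative 4 r^2
     (A b, b) >= 0. *)
  set (p := fun r => 4 * r ^ 2 * inner (A (E r (A x))) (E r (A x))).
  apply (nondecreasing_of_derive (fun r => - Phi r) p); [lra| |].
  - intros r Hr.
    assert (Hr0 : 0 < r) by lra.
    pose proof (E_derive r x Hr0) as D1; pose proof (E_derive r (A x) Hr0) as D2.
    set (b := E r (A x)) in *.
    assert (A (E r x) = b) as Eb by now apply E_A.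
    rewrite Eb in D1.
    assert (inner (A b) (E r x) = inner b b) as Ab.
    { rewrite A_sym, Eb; [reflexivity|now apply E_dom|now apply E_dom]. }
    assert (is_derive (fun s => inner (E s x) (E s x)) r (- (2 * inner b (E r x)))) as I1.
    { eapply is_derive_Req; [apply (is_derive_inner _ _ _ _ _ D1 D1)|].
      inner_expand; rewrite (inner_sym _ (E r x) b); ring. }
    assert (is_derive (fun s => inner (E s (A x)) (E s x)) r (- (2 * inner b b))) as I2.
    { eapply is_derive_Req; [apply (is_derive_inner _ _ _ _ _ D2 D1)|].
      inner_expand; rewrite Ab; unfold b; ring. }
    assert (is_derive (fun s => inner (E s (A x)) (E s (A x))) r (- (2 * inner (A b) b))) as I3.
    { eapply is_derive_Req; [apply (is_derive_inner _ _ _ _ _ D2 D2)|].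
      inner_expand; rewrite (inner_sym _ (E r (A x)) (A b)); unfold b; ring. }
    assert (is_derive (fun s => 2 * s) r 2) as P1 by (auto_derive; [exact I|ring]).
    assert (is_derive (fun s => 2 * s ^ 2) r (4 * r)) as P2 by (auto_derive; [exact I|ring]).
    pose proof (is_derive_mult _ _ _ _ _ P1 I2 Rmult_comm) as M2.
    pose proof (is_derive_mult _ _ _ _ _ P2 I3 Rmult_comm) as M3.
    pose proof (is_derive_opp _ _ _ (is_derive_plus _ _ _ _ _ (is_derive_plus _ _ _ _ _ I1 M2) M3))
      as Hd.
    eapply is_derive_Req; [exact Hd|].
    unfold p, plus, opp, mult; simpl; unfold b; ring.
  - intros r Hr; unfold p.
    assert (0 <= inner (A (E r (A x))) (E r (A x))) by (apply A_ge0, E_dom; lra).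
    pose proof (pow2_ge_0 r); nra. }
rewrite (E_A t x Ht Hx).
(* Phi t is at least 2 t^2 |A E t x|^2, while Phi s tends to at most |x|^2 as s tends to 0; [C]
   collects the terms of Phi s that carry a factor s. *)
assert (2 * (t * norm (E t (A x))) ^ 2 <= norm x ^ 2) as Hsq.
{ apply Rle_limit_0 with (t := t)
    (C := 2 * (norm (A x) * norm x) + 2 * t * norm (A x) ^ 2); [assumption|].
  intros s Hs; specialize (Hdec s Hs); unfold Phi in Hdec.
  assert (0 <= inner (E t (A x)) (E t x)) as H1
    by (rewrite <- E_A by assumption; now apply A_ge0, E_dom).
  pose proof (inner_ge0 (E t x)).
  rewrite !inner_norm in *.
  pose proof (inner_le_norm (E s (A x)) (E s x)) as H2.
  assert (norm (E s x) <= norm x) as H3 by (apply E_contraction; lra).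
  assert (norm (E s (A x)) <= norm (A x)) as H4 by (apply E_contraction; lra).
  pose proof (norm_ge_0 (E s x)) as H5; pose proof (norm_ge_0 (E s (A x))) as H6.
  assert (norm (E s x) ^ 2 <= norm x ^ 2) as H7 by (apply pow_incr; lra).
  assert (norm (E s (A x)) ^ 2 <= norm (A x) ^ 2) as H8 by (apply pow_incr; lra).
  assert (norm (E s (A x)) * norm (E s x) <= norm (A x) * norm x) as H9
    by (apply Rmult_le_compat; assumption).
  assert (2 * s * inner (E s (A x)) (E s x) <= 2 * s * (norm (A x) * norm x)).
  { apply Rmult_le_compat_l; lra. }
  assert (2 * s ^ 2 * norm (E s (A x)) ^ 2 <= s * (2 * t * norm (A x) ^ 2)).
  { apply Rle_trans with (2 * s ^ 2 * norm (A x) ^ 2); [apply Rmult_le_compat_l; nra|].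
    pose proof (pow2_ge_0 (norm (A x))).
    replace (2 * s ^ 2 * norm (A x) ^ 2) with (s * (2 * s * norm (A x) ^ 2)) by ring.
    apply Rmult_le_compat_l; [lra|]; apply Rmult_le_compat_r; lra. }
  assert (0 <= 2 * t * inner (E t (A x)) (E t x)) by nra.
  rewrite Rpow_mult_distr; nra. }
pose proof (norm_ge_0 x) as Hx0; pose proof (norm_ge_0 (E t (A x))).
assert (0 <= t * norm (E t (A x))) by nra.
simpl in Hsq; nra.
Qed.

(** E s x lies in [dom A] for s > 0, so the bound on [dom A] applies over the remaining time t - s;
    then s tends to 0. *)
Lemma AE_bound t x : 0 < t -> norm (A (E t x)) <= / t * norm x.
Proof.
intros Ht.
assert (t * norm (A (E t x)) <= norm x) as Hle.
{ apply Rle_limit_0 with (t := t) (C := norm (A (E t x))); [assumption|].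
  intros s Hs.
  assert ((t - s) * norm (A (E (t - s) (E s x))) <= norm (E s x)) as Hb
    by (apply AE_bound_dom; [lra|apply E_dom; lra]).
  rewrite <- E_plus in Hb by lra; replace (t - s + s) with t in Hb by ring.
  assert (norm (E s x) <= norm x) by (apply E_contraction; lra); nra. }
apply (Rmult_le_compat_l (/ t)) in Hle; [|apply Rlt_le, Rinv_0_lt_compat; assumption].
rewrite <- Rmult_assoc, Rinv_l, Rmult_1_l in Hle by lra; exact Hle.
Qed.

Lemma E_continuous t x : 0 < t -> continuous (fun s => E s x) t.
Proof. intros Ht; eapply continuous_derive, E_derive, Ht. Qed.

Lemma AE_continuous t x : 0 < t -> continuous (fun s => A (E s x)) t.
Proof.
intros Ht.
(* Half of the time is spent on smoothing, so that A acts on a vector independent of s. *)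
apply (continuous_ext_near (fun s => E (s - t / 2) (A (E (t / 2) x))) _ t (t / 2)); [lra| |].
- intros s Hs; apply Rabs_def2 in Hs.
  rewrite <- E_A by (try apply E_dom; lra); rewrite <- E_plus by lra.
  do 2 f_equal; lra.
- apply (continuous_comp (fun s => s - t / 2) (fun s => E s (A (E (t / 2) x)))).
  + apply (ex_derive_continuous (fun s : R => s - t / 2)); auto_derive; exact I.
  + apply E_continuous; lra.
Qed.

Lemma AE_linear t : 0 < t -> is_linear (fun x => A (E t x)).
Proof.
intros Ht; assert (HL := E_linear t ltac:(lra)).
apply (is_linear_build _ (/ t)).
- intros x y; rewrite (linear_plus _ HL), op_plus by (now apply E_dom); reflexivity.
- intros c x; rewrite (linear_scal _ HL), op_scal by (now apply E_dom); reflexivity.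
- intros x; now apply AE_bound.
Qed.

Lemma SE_derive t x : 0 < t -> is_derive (fun s => S (E s x)) t (opp (E t x)).
Proof.
intros Ht; pose proof (linear_derive S _ _ _ S_linear (E_derive t x Ht)) as Hd.
replace (opp (E t x)) with (S (opp (A (E t x)))); [exact Hd|].
replace (opp (A (E t x))) with (scal (-1) (A (E t x)) : H) by hring.
rewrite S_scal, HAS by (now apply E_dom); hring.
Qed.

(* With q = S d the first hypothesis says q' + A q = 0. *)
Lemma ode_unique (T : R) (d : R -> H) :
  (forall t, 0 < t < T -> is_derive (fun s => S (d s)) t (opp (d t))) ->
  filterlim (fun s => S (d s)) (at_right 0) (locally (zero : H)) ->
  forall t, 0 < t < T -> d t = zero.
Proof.
intros Hd Hlim t Ht.
apply S_injective; rewrite (linear_zero' S S_linear).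
apply inner_self_eq0; apply Rle_antisym; [|apply inner_ge0].
rewrite inner_norm.
assert (Hdec : forall s, 0 < s <= t -> norm (S (d t)) <= norm (S (d s))).
{ intros s Hs.
  assert (- inner (S (d s)) (S (d s)) <= - inner (S (d t)) (S (d t))) as Hm.
  { apply (nondecreasing_of_derive (fun r => - inner (S (d r)) (S (d r)))
      (fun r => - (inner (opp (d r)) (S (d r)) + inner (S (d r)) (opp (d r))))); [lra| |].
    - intros r Hr; apply (is_derive_opp (fun r => inner (S (d r)) (S (d r)))).
      apply (is_derive_inner (fun r => S (d r)) (fun r => S (d r))); apply Hd; lra.
    - intros r Hr; inner_expand; destruct (HSA (d r)) as [D1 D2].
      assert (0 <= inner (d r) (S (d r))) by (rewrite <- D2 at 1; now apply A_ge0).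
      rewrite (inner_sym _ (S (d r)) (d r)); lra. }
  rewrite !inner_norm in Hm.
  pose proof (norm_ge_0 (S (d t))); pose proof (norm_ge_0 (S (d s))).
  simpl in Hm; nra. }
apply Rnot_lt_le; intros Hlt.
assert (0 < norm (S (d t))) as Hpos.
{ pose proof (norm_ge_0 (S (d t))); simpl in Hlt; nra. }
destruct (lim_witness _ _ _ t Hlim Hpos (proj1 Ht)) as (s & Hs2 & Hs1).
rewrite (norm_congr _ (S (d s))) in Hs1 by hring; specialize (Hdec s ltac:(lra)); lra.
Qed.

(** The extension is the limit of B (E t x) as t tends to 0: E t x lies in [dom A] and tends to x,
    so these values are Cauchy. It is applied to S B_j, whose bound by the norm of H is known on
    [dom A]. *)
Lemma bounded_extension (B : H -> H) C : 0 <= C ->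
  (forall x y, dom A x -> dom A y -> B (plus x y) = plus (B x) (B y)) ->
  (forall (k : R) x, dom A x -> B (scal k x) = scal k (B x)) ->
  (forall x, dom A x -> norm (B x) <= C * norm x) ->
  exists L : H -> H, is_linear L /\ forall x, dom A x -> L x = B x.
Proof.
intros HC Hplus Hscal Hbd.
assert (Hminus : forall x y, dom A x -> dom A y ->
  norm (minus (B x) (B y)) <= C * norm (minus x y)).
{ intros x y Hx Hy; destruct (A_opp y Hy) as [Hoy _].
  assert (minus x y = plus x (scal (-1) y) :> H) as E0 by hring.
  rewrite <- (norm_congr (B (minus x y))).
  - apply Hbd; rewrite E0; apply dom_plus; [assumption|now apply dom_scal].
  - rewrite E0, Hplus, Hscal; try assumption; [hring|now apply dom_scal]. }
assert (Hlim : forall x, exists l, filterlim (fun t => B (E t x)) (at_right 0) (locally l)).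
{ intros x; apply (filterlim_locally_cauchy (U := H)); intros [eps He].
  assert (0 < eps / (2 * (C + 1))) as He2 by (apply Rdiv_lt_0_compat; lra).
  pose proof (proj1 (filterlim_hnorm (at_right 0) (fun t => E t x) x) (E_lim_0 x) _ He2) as Hx.
  exists (fun t => 0 < t < 1 /\ norm (minus (E t x) x) < eps / (2 * (C + 1))); split.
  - apply filter_and; [apply at_right_between; lra|exact Hx].
  - intros s t [Hs Hs'] [Ht Ht']; apply (norm_compat1 (K := R_AbsRing) (V := H)); simpl.
    eapply Rle_lt_trans; [apply Hminus; apply E_dom; lra|].
    pose proof (norm_minus_tri (E t x) x (E s x)) as Htri.
    rewrite (norm_minus_sym x (E s x)) in Htri.
    apply Rle_lt_trans with (C * (eps / (C + 1))).
    + apply Rmult_le_compat_l; [assumption|].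
      replace (eps / (C + 1)) with (eps / (2 * (C + 1)) + eps / (2 * (C + 1))) by (field; lra).
      lra.
    + apply (Rmult_lt_reg_r (C + 1)); [lra|].
      replace (C * (eps / (C + 1)) * (C + 1)) with (C * eps) by (field; lra); nra. }
set (L := fun x => proj1_sig (constructive_indefinite_description _ (Hlim x))).
assert (HL : forall x, filterlim (fun t => B (E t x)) (at_right 0) (locally (L x)))
  by (intros x; apply (proj2_sig (constructive_indefinite_description _ (Hlim x)))).
assert (Huniq : forall (p : R -> H) l l', filterlim p (at_right 0) (locally l) ->
  filterlim p (at_right 0) (locally l') -> l = l').
{ intros p l l'; apply (filterlim_locally_unique (V := H)). }
assert (Hpos : at_right 0 (fun t => 0 < t < 1)) by (apply at_right_between; lra).
exists L; split.
- apply (is_linear_build L C).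
  + intros x y; apply (Huniq (fun t => B (E t (plus x y)))); [apply HL|].
    apply (filterlim_ext_loc (fun t => plus (B (E t x)) (B (E t y)))).
    * apply (filter_imp (fun t => 0 < t < 1)); [|assumption]; intros t Ht.
      rewrite (linear_plus (E t)) by (apply E_linear; lra).
      symmetry; apply Hplus; apply E_dom; lra.
    * apply (filterlim_comp_2 (G := locally (L x)) (H := locally (L y))
        (fun t => B (E t x)) (fun t => B (E t y)) plus); try apply HL.
      apply (filterlim_plus (V := H)).
  + intros k x; apply (Huniq (fun t => B (E t (scal k x)))); [apply HL|].
    apply (filterlim_ext_loc (fun t => scal k (B (E t x)))).
    * apply (filter_imp (fun t => 0 < t < 1)); [|assumption]; intros t Ht.
      rewrite linear_scal' by (apply E_linear; lra).
      symmetry; apply Hscal; apply E_dom; lra.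
    * apply (linear_lim (at_right 0) (fun y : H => scal k y)); [apply scal_linear|apply HL].
  + intros x; apply Rnot_lt_le; intros Hlt.
    assert (0 < norm (L x) - C * norm x) as Hd by lra.
    destruct (lim_witness _ _ _ 1 (HL x) Hd Rlt_0_1) as (t & Ht2 & Ht1).
    pose proof (norm_le_minus (L x) (B (E t x))) as Hn.
    rewrite (norm_minus_sym (L x)) in Hn.
    assert (norm (B (E t x)) <= C * norm (E t x)) by (apply Hbd, E_dom; lra).
    assert (norm (E t x) <= norm x) by (apply E_contraction; lra).
    nra.
- intros x Hx; apply (Huniq (fun t => B (E t x))); [apply HL|].
  apply (filterlim_hnorm (at_right 0)); intros eps He.
  assert (0 < eps / (C + 1)) as He2 by (apply Rdiv_lt_0_compat; lra).
  pose proof (proj1 (filterlim_hnorm (at_right 0) (fun t => E t x) x) (E_lim_0 x) _ He2) as Hlx.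
  apply (filter_imp (fun t => norm (minus (E t x) x) < eps / (C + 1) /\ 0 < t < 1));
    [|apply filter_and; [exact Hlx|assumption]].
  intros t [Ht1 Ht2]; eapply Rle_lt_trans; [apply Hminus; [apply E_dom; lra|assumption]|].
  apply Rle_lt_trans with (C * (eps / (C + 1))); [apply Rmult_le_compat_l; lra|].
  apply (Rmult_lt_reg_r (C + 1)); [lra|].
  replace (C * (eps / (C + 1)) * (C + 1)) with (C * eps) by (field; lra); nra.
Qed.

(** * Maximal regularity: the function A (E * h) *)

Section Evolution.
Context (a T : R) (Ha : 0 < a < 1) (HT : 0 < T).

Lemma Rpower_weaken b t : a <= b -> 0 < t < T ->
  Rpower t (b - 1) <= Rpower T (b - a) * Rpower t (a - 1).
Proof.
intros Hb Ht.
replace (b - 1) with (b - a + (a - 1)) by ring; rewrite Rpower_plus.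
apply Rmult_le_compat_r; [apply Rlt_le, Rpower_pos|apply Rle_Rpower_l; lra].
Qed.

(** On a bounded interval 1 <= T^(1-a) r^(a-1), so bounded kernels such as E join the class of the
    singular ones. *)
Lemma kernel_of_bounded N (k : R -> H -> H) : 0 <= N ->
  (forall r, 0 < r < T -> is_linear (k r)) ->
  (forall x r, 0 < r < T -> continuous (fun r => k r x) r) ->
  (forall r x, 0 < r < T -> norm (k r x) <= N * norm x) ->
  kernel a T (N * Rpower T (1 - a)) k.
Proof.
intros HN Hl Hc Hb; split; [assumption|split; [assumption|]].
intros r x Hr; eapply Rle_trans; [now apply Hb|].
apply Rmult_le_compat_r; [apply norm_ge_0|].
pose proof (Rpower_weaken 1 r ltac:(lra) Hr) as Hp.
replace (1 - 1) with 0 in Hp by ring; rewrite Rpower_O in Hp by lra.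
rewrite Rmult_assoc; nra.
Qed.

Lemma lim_0_of_bound C d (f : R -> H) : 0 < d ->
  (forall t, 0 < t < d -> norm (f t) <= C * Rpower t a) ->
  filterlim f (at_right 0) (locally (zero : H)).
Proof.
intros Hd Hf; apply (filterlim_hnorm (at_right 0)); intros eps He.
assert (0 < eps / (Rabs C + 1)) as He'.
{ apply Rdiv_lt_0_compat; [assumption|pose proof (Rabs_pos C); lra]. }
pose proof (proj1 (filterlim_locally _ _) (Rpower_lim_0 a (proj1 Ha)) (mkposreal _ He')) as Hl.
apply (filter_imp (fun t => 0 < t < d /\ ball 0 (mkposreal _ He') (Rpower t a))).
2:{ apply filter_and; [now apply at_right_between|exact Hl]. }
intros t [Ht Hb].
real_ball_in Hb.
rewrite Ropp_0, Rplus_0_r, Rabs_pos_eq in Hb by apply Rlt_le, Rpower_pos.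
hnorm (f t); eapply Rle_lt_trans; [now apply Hf|].
pose proof (Rle_abs C); pose proof (Rabs_pos C); pose proof (Rpower_pos t a).
apply Rle_lt_trans with ((Rabs C + 1) * Rpower t a); [nra|].
apply (Rmult_lt_compat_l (Rabs C + 1)) in Hb; [|lra].
replace ((Rabs C + 1) * (eps / (Rabs C + 1))) with eps in Hb by (field; lra); exact Hb.
Qed.

Lemma conv_bounded_norm N M (k : R -> H -> H) (f : R -> H) t : 0 <= N -> 0 <= M ->
  (forall r, 0 < r < T -> is_linear (k r)) ->
  (forall x r, 0 < r < T -> continuous (fun r => k r x) r) ->
  (forall r x, 0 < r < T -> norm (k r x) <= N * norm x) ->
  bounded_fn a T M f -> 0 < t < T ->
  norm (conv k f t) <= N * M * (2 / a) * Rpower t a.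
Proof.
intros HN HM Hl Hc Hb Hf Ht; rewrite Rmult_assoc.
assert (Hk := kernel_of_bounded N k HN Hl Hc Hb).
apply (sing_int a (N * M) t (fun s => k (t - s) (f s))); try lra; split; intros s Hs.
- apply (kernel_fn_continuous a T Ha (N * Rpower T (1 - a)) M); try assumption; lra.
- eapply Rle_trans; [apply Hb; lra|].
  assert (norm (f s) <= M * Rpower s (a - 1)) by (apply Hf; lra).
  pose proof (Rpower_pos (t - s) (a - 1)).
  rewrite Rmult_assoc; apply Rmult_le_compat_l; nra.
Qed.

Lemma conv_bounded_lim_0 N M (k : R -> H -> H) (f : R -> H) : 0 <= N -> 0 <= M ->
  (forall r, 0 < r < T -> is_linear (k r)) ->
  (forall x r, 0 < r < T -> continuous (fun r => k r x) r) ->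
  (forall r x, 0 < r < T -> norm (k r x) <= N * norm x) ->
  bounded_fn a T M f -> filterlim (conv k f) (at_right 0) (locally (zero : H)).
Proof.
intros HN HM Hl Hc Hb Hf; apply (lim_0_of_bound (N * M * (2 / a)) T); [assumption|].
intros t Ht; now apply conv_bounded_norm.
Qed.

Lemma E_kernel : kernel a T (1 * Rpower T (1 - a)) E.
Proof.
apply kernel_of_bounded; [lra| | |].
- intros r Hr; apply E_linear; lra.
- intros x r Hr; apply E_continuous; lra.
- intros r x Hr; rewrite Rmult_1_l; apply E_contraction; lra.
Qed.

(** The exponent a - 2 is that of the derivative of t^(a-1). The function g' qualifies through the
    bound on t g'', and the power kernels omega_j qualify as well. *)
Definition holder (M : R) (h : R -> H) : Prop := bounded_fn a T M h /\
  forall s t, 0 < s <= t -> t < T ->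
    norm (minus (h t) (h s)) <= M * Rpower s (a - 2) * (t - s).

(* maxreg h is A (E * h), with the singularity of A E(t - s) at s = t removed
   by subtracting h t from h s. *)
Definition maxreg_integrand (h : R -> H) (t s : R) : H := A (E (t - s) (minus (h s) (h t))).
Definition maxreg (h : R -> H) (t : R) : H :=
  plus (Int (maxreg_integrand h t) t) (minus (h t) (E t (h t))).

(** For s >= t/2 the Lipschitz bound cancels the factor 1/(t - s) of A E; for s < t/2 that factor is
    at most 2/t, and h s and h t are bounded separately. *)
Lemma maxreg_integrand_bound M h t s : 0 <= M -> holder M h -> 0 < s < t -> t < T ->
  norm (maxreg_integrand h t s) <=
    4 * M * Rpower t (-1) * (Rpower s (a - 1) + Rpower (t - s) (a - 1)).
Proof.
intros HM [[Hc Hb] Hh] Hs Ht.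
eapply Rle_trans; [apply AE_bound; lra|].
replace (-1) with (- (1)) by ring; rewrite Rpower_Ropp, Rpower_1 by lra.
pose proof (Rpower_pos (t - s) (a - 1)); pose proof (Rpower_pos s (a - 1)).
assert (0 < / t) by (apply Rinv_0_lt_compat; lra).
apply Rle_trans with (4 * M * / t * Rpower s (a - 1)).
2:{ apply Rmult_le_compat_l; [|lra]; apply Rmult_le_pos; lra. }
destruct (Rle_lt_dec (t / 2) s) as [Hts|Hts].
- rewrite norm_minus_sym.
  assert (norm (minus (h t) (h s)) <= M * Rpower s (a - 2) * (t - s)) as Hd by (apply Hh; lra).
  rewrite (Rpower_split s (a - 1)) by lra; replace (a - 1 - 1) with (a - 2) by ring.
  apply Rle_trans with (/ (t - s) * (M * Rpower s (a - 2) * (t - s))).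
  + apply Rmult_le_compat_l; [apply Rlt_le, Rinv_0_lt_compat; lra|assumption].
  + pose proof (Rpower_pos s (a - 2)).
    apply Rle_trans with (M * Rpower s (a - 2) * 1); [right; field; lra|].
    replace (4 * M * / t * (s * Rpower s (a - 2))) with (M * Rpower s (a - 2) * (4 * (s * / t)))
      by ring.
    apply Rmult_le_compat_l; [apply Rmult_le_pos; lra|].
    apply Rle_trans with (4 * ((t / 2) * / t));
      [replace (4 * ((t / 2) * / t)) with 2 by (field; lra); lra|].
    apply Rmult_le_compat_l; [lra|]; apply Rmult_le_compat_r; lra.
- assert (norm (h s) <= M * Rpower s (a - 1)) by (apply Hb; lra).
  assert (norm (h t) <= M * Rpower t (a - 1)) by (apply Hb; lra).
  assert (Rpower t (a - 1) <= Rpower s (a - 1)) by (apply Rpower_le_neg; lra).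
  pose proof (norm_minus_le (h s) (h t)).
  apply Rle_trans with (2 * / t * (2 * M * Rpower s (a - 1))); [|right; ring].
  apply Rmult_le_compat.
  + apply Rlt_le, Rinv_0_lt_compat; lra.
  + apply norm_ge_0.
  + replace (2 * / t) with (/ (t / 2)) by (field; lra).
    apply Rinv_le_contravar; lra.
  + nra.
Qed.

Lemma maxreg_integrand_continuous M h t s : holder M h -> 0 < s < t -> t < T ->
  continuous (fun p : R * R => maxreg_integrand h (fst p) (snd p)) (t, s).
Proof.
intros [[Hc Hb] Hh] Hs Ht.
apply (continuous_comp_2 (fun p : R * R => fst p - snd p)
  (fun p : R * R => minus (h (snd p)) (h (fst p))) (fun r x => A (E r x))).
- apply (continuous_minus (V := R_NormedModule) (fun p : R * R => fst p) (fun p : R * R => snd p));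
    [apply continuous_fst|apply continuous_snd].
- apply (continuous_minus (fun p : R * R => h (snd p)) (fun p : R * R => h (fst p))).
  + apply (continuous_comp (fun p : R * R => snd p) h); [apply continuous_snd|apply Hc; simpl; lra].
  + apply (continuous_comp (fun p : R * R => fst p) h); [apply continuous_fst|apply Hc; simpl; lra].
- apply (kernel_continuous2 0 T 1 (fun r x => A (E r x))); simpl; try lra; split; [|split].
  + intros r Hr; apply AE_linear; lra.
  + intros x r Hr; apply AE_continuous; lra.
  + intros r x Hr; rewrite Rmult_1_l; replace (0 - 1) with (- (1)) by ring.
    rewrite Rpower_Ropp, Rpower_1 by lra; apply AE_bound; lra.
Qed.

Lemma maxreg_sing M h t : 0 <= M -> holder M h -> 0 < t < T ->
  sing a (4 * M * Rpower t (-1)) t (maxreg_integrand h t).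
Proof.
intros HM Hh Ht; split; intros s Hs.
- apply (continuous_comp_2 (fun _ : R => t) (fun s : R => s) (maxreg_integrand h)).
  + apply continuous_const.
  + apply continuous_id.
  + apply (maxreg_integrand_continuous M); try assumption; lra.
- apply maxreg_integrand_bound; try assumption; lra.
Qed.

Lemma maxreg_is_int M h t : 0 <= M -> holder M h -> 0 < t < T ->
  is_int (maxreg_integrand h t) t (Int (maxreg_integrand h t) t).
Proof.
intros HM Hh Ht; apply (sing_int a (4 * M * Rpower t (-1))); try lra; now apply maxreg_sing.
Qed.

Lemma maxreg_bounded_fn M h : 0 <= M -> holder M h ->
  bounded_fn a T ((8 / a + 2) * M) (maxreg h).
Proof.
intros HM Hh; pose proof Hh as [[Hc Hb] _]; split; intros t Ht.
- apply (continuous_plus (fun t => Int (maxreg_integrand h t) t)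
    (fun t => minus (h t) (E t (h t)))).
  + apply (int_parametric_continuous (maxreg_integrand h) a (-1) (4 * M) T); try assumption.
    * intros r s Hs Hr; now apply (maxreg_integrand_continuous M).
    * intros r s Hs Hr; now apply maxreg_integrand_bound.
  + apply (continuous_minus h (fun t => E t (h t))); [now apply Hc|].
    apply (continuous_comp_2 (fun t : R => t) h E); [apply continuous_id|now apply Hc|].
    apply (kernel_continuous2 a T (1 * Rpower T (1 - a))); [lra|apply E_kernel|assumption].
- destruct (sing_int a (4 * M * Rpower t (-1)) t (maxreg_integrand h t)) as [_ Hle];
    try lra; [now apply maxreg_sing|].
  unfold maxreg; eapply Rle_trans; [apply hnorm_triangle|].
  assert (norm (h t) <= M * Rpower t (a - 1)) by now apply Hb.
  assert (norm (E t (h t)) <= norm (h t)) by (apply E_contraction; lra).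
  pose proof (norm_minus_le (h t) (E t (h t))).
  replace (4 * M * Rpower t (-1) * (2 / a * Rpower t a)) with
    (8 / a * M * Rpower t (a - 1)) in Hle; [lra|].
  assert (Rpower t (a - 1) = Rpower t (-1) * Rpower t a) as ->
    by (rewrite <- Rpower_plus; f_equal; ring).
  generalize (Rpower t (-1)); intros q; field; lra.
Qed.

(** Identifies [maxreg h] with A (E * h). The integral of E (t - s) (h t) over (0,t) is S (h t) - S
    (E t (h t)), with primitive S (E (t - s) (h t)); this is the term that [maxreg] adds outside its
    integral. *)
Lemma S_maxreg M h t : 0 <= M -> holder M h -> 0 < t < T -> S (maxreg h t) = conv E h t.
Proof.
intros HM Hh Ht; pose proof Hh as [Hf _].
pose proof S_linear as HS.
unfold maxreg; rewrite (linear_plus S HS), linear_minus by assumption.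
assert (is_int (fun s => E (t - s) (h t)) t (minus (S (h t)) (S (E t (h t))))) as I1.
{ apply (is_RInt_gen_derive _ (fun s => S (E (t - s) (h t)))); [lra| | | |].
  - intros s Hs.
    eapply is_derive_Heq.
    + apply (is_derive_comp (fun r => S (E r (h t))) (fun s => t - s) s).
      * apply SE_derive; lra.
      * instantiate (1 := -1); auto_derive; [exact I|ring].
    + hring.
  - intros s Hs; apply (continuous_comp (fun s => t - s) (fun r => E r (h t))).
    + apply continuous_reflect.
    + apply E_continuous; lra.
  - apply (filterlim_filter_le_1 (F := locally 0)); [apply filter_le_within|].
    replace (S (E t (h t))) with (S (E (t - 0) (h t))) by (do 2 f_equal; ring).
    apply (continuous_comp (fun s => t - s) (fun r => S (E r (h t)))).
    + apply continuous_reflect.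
    + apply linear_continuous; [assumption|apply E_continuous; lra].
  - apply (filterlim_comp _ _ _ (fun s => t - s) (fun r => S (E r (h t))) _ (at_right 0)).
    + apply reflect_at_left.
    + apply (linear_lim (at_right 0) S); [assumption|apply E_lim_0]. }
rewrite <- (is_int_unique _ _ _ I1).
symmetry; apply is_int_unique.
eapply is_int_ext; [lra| |apply is_int_plus; [apply (is_int_linear S);
  [assumption|now apply (maxreg_is_int M)]|rewrite (is_int_unique _ _ _ I1); exact I1]].
intros s Hs; simpl; unfold maxreg_integrand; rewrite HAS by (apply E_dom; lra).
rewrite linear_minus by (apply E_linear; lra); hring.
Qed.

(** The derivative - A E of E is too singular for [conv_derive], whereas S E has derivative - E. So
    S (E * h) is differentiated first, and [weak_derive] removes S through (x, w) = (S x, A w) for w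
    in [dom A]. *)
Lemma maxreg_derive M h t : 0 <= M -> holder M h -> 0 < t < T ->
  is_derive (fun s => S (maxreg h s)) t (minus (h t) (maxreg h t)).
Proof.
intros HM Hh Ht; pose proof Hh as [Hf _]; pose proof S_linear as HS.
destruct S_bounded as (C & HC & HCb).
assert (HN : 0 <= 1 * Rpower T (1 - a)) by (pose proof (Rpower_pos T (1 - a)); lra).
assert (HE := E_kernel).
assert (Hm : forall s, 0 < s < T -> S (maxreg h s) = conv E h s)
  by (intros s Hs; now apply (S_maxreg M)).
pose proof (opp_linear (H := H)) as Hlin.
pose proof (kernel_opp a T _ _ HE) as HEo.
assert (HQ : forall s, 0 < s < T ->
  is_derive (fun r => S (conv E h r)) s (S (minus (h s) (maxreg h s)))).
{ intros s Hs.
  apply (is_derive_ext_open (conv (fun r x => S (E r x)) h) _ 0 T); [assumption| |].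
  - intros r Hr; now apply (conv_linear a T Ha (1 * Rpower T (1 - a)) M).
  - eapply is_derive_Heq.
    + apply (conv_derive a T Ha (fun r x => S (E r x)) (fun r x => opp (E r x)) S h
        (C * (1 * Rpower T (1 - a))) (1 * Rpower T (1 - a)) M); try assumption; try nra.
      * apply kernel_comp_l; try assumption; lra.
      * intros x r Hr; apply SE_derive; lra.
      * intros x; apply (linear_lim (at_right 0) S); [assumption|apply E_lim_0].
    + rewrite linear_minus, Hm by assumption.
      rewrite (conv_linear a T Ha (1 * Rpower T (1 - a)) M (fun x : H => opp x));
        try assumption; hring. }
apply (is_derive_ext_open (conv E h) _ 0 T); [assumption| |].
- intros r Hr; symmetry; now apply Hm.
- apply (weak_derive (dom A) (conv E h) (fun s => minus (h s) (maxreg h s)) t (Rmin t (T - t))).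
  + apply A_dense.
  + apply Rmin_pos; lra.
  + intros s w Hs Hw.
    rmin_bounds; apply Rabs_def2 in Hs.
    apply (is_derive_ext (fun r => inner (S (conv E h r)) (A w))).
    * intros r; rewrite S_sym, HAS by assumption; reflexivity.
    * eapply is_derive_Req; [apply is_derive_inner_l, HQ; lra|].
      rewrite S_sym, HAS by assumption; reflexivity.
  + apply (continuous_minus h (maxreg h)); [now apply Hf|].
    now apply (maxreg_bounded_fn M).
Qed.

Lemma S_maxreg_norm M h t : 0 <= M -> holder M h -> 0 < t < T ->
  norm (S (maxreg h t)) <= 1 * M * (2 / a) * Rpower t a.
Proof.
intros HM Hh Ht; rewrite (S_maxreg M) by assumption.
apply conv_bounded_norm; try assumption; try lra.
- intros r Hr; apply E_linear; lra.
- intros x r Hr; apply E_continuous; lra.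
- intros r x Hr; rewrite Rmult_1_l; apply E_contraction; lra.
- apply Hh.
Qed.

Lemma maxreg_plus M M' h h' t : 0 <= M -> 0 <= M' -> holder M h -> holder M' h' -> 0 < t < T ->
  maxreg (fun s => plus (h s) (h' s)) t = plus (maxreg h t) (maxreg h' t).
Proof.
intros HM HM' Hh Hh' Ht; unfold maxreg.
rewrite (linear_plus (E t)) by (apply E_linear; lra).
rewrite (is_int_unique (maxreg_integrand (fun s => plus (h s) (h' s)) t) t
  (plus (Int (maxreg_integrand h t) t) (Int (maxreg_integrand h' t) t))); [hring|].
eapply is_int_ext; [lra| |apply is_int_plus;
  [now apply (maxreg_is_int M)|now apply (maxreg_is_int M')]].
intros s Hs; unfold maxreg_integrand; simpl.
rewrite <- (linear_plus (fun x => A (E (t - s) x))) by (apply AE_linear; lra).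
do 2 f_equal; hring.
Qed.

Lemma maxreg_scal M h (c : R) t : 0 <= M -> holder M h -> 0 < t < T ->
  maxreg (fun s => scal c (h s)) t = scal c (maxreg h t).
Proof.
intros HM Hh Ht; unfold maxreg.
rewrite (linear_scal (E t)) by (apply E_linear; lra).
rewrite (is_int_unique (maxreg_integrand (fun s => scal c (h s)) t) t
  (scal c (Int (maxreg_integrand h t) t))); [hring|].
eapply is_int_ext; [lra| |apply is_int_scal; now apply (maxreg_is_int M)].
intros s Hs; unfold maxreg_integrand; simpl.
rewrite <- (linear_scal (fun x => A (E (t - s) x))) by (apply AE_linear; lra).
do 2 f_equal; hring.
Qed.

(* omega_b is the case c = / Gamma b. *)
Definition pow_kernel (c b t : R) : R := c * Rpower t (b - 1).

Lemma pow_kernel_bound c b t : a <= b -> 0 < t < T ->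
  Rabs (pow_kernel c b t) <= Rabs c * Rpower T (b - a) * Rpower t (a - 1).
Proof.
intros Hb Ht; unfold pow_kernel.
rewrite Rabs_mult, (Rabs_pos_eq (Rpower _ _)) by apply Rlt_le, Rpower_pos.
rewrite Rmult_assoc; apply Rmult_le_compat_l; [apply Rabs_pos|now apply Rpower_weaken].
Qed.

Lemma pow_kernel_continuous c b t : 0 < t -> continuous (pow_kernel c b) t.
Proof.
intros Ht; apply (ex_derive_continuous (pow_kernel c b) t).
exists (c * ((b - 1) * Rpower t (b - 1 - 1))).
apply (is_derive_scal (fun s => Rpower s (b - 1))); now apply is_derive_Rpower.
Qed.

(** Monotonicity of t^b suffices: since s^b <= t^b, one has t (s^(b-1) - t^(b-1)) <= (t - s) s^(b-1)
    <= t (t - s) s^(b-2). *)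
Lemma pow_kernel_lipschitz c b s t : a <= b < 1 -> 0 < s <= t -> t < T ->
  Rabs (pow_kernel c b t - pow_kernel c b s) <=
    Rabs c * Rpower T (b - a) * Rpower s (a - 2) * (t - s).
Proof.
intros Hb Hs Ht; unfold pow_kernel.
replace (c * Rpower t (b - 1) - c * Rpower s (b - 1)) with
  (c * (Rpower t (b - 1) - Rpower s (b - 1))) by ring.
rewrite Rabs_mult, !Rmult_assoc; apply Rmult_le_compat_l; [apply Rabs_pos|].
assert (Rpower t (b - 1) <= Rpower s (b - 1)) as Hle by (apply Rpower_le_neg; lra).
rewrite Rabs_left1 by lra.
assert (Rpower s (b - 2) <= Rpower T (b - a) * Rpower s (a - 2)) as H2.
{ replace (b - 2) with (b - a + (a - 2)) by ring; rewrite Rpower_plus.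
  apply Rmult_le_compat_r; [apply Rlt_le, Rpower_pos|apply Rle_Rpower_l; lra]. }
apply Rle_trans with (Rpower s (b - 2) * (t - s)).
2:{ rewrite <- Rmult_assoc; apply Rmult_le_compat_r; lra. }
assert (s * Rpower s (b - 1) <= t * Rpower t (b - 1)) as H1.
{ rewrite <- !Rpower_split by lra; apply Rle_Rpower_l; lra. }
assert (Rpower s (b - 1) = s * Rpower s (b - 2)) as E1.
{ rewrite (Rpower_split s (b - 1)) by lra; do 2 f_equal; ring. }
pose proof (Rpower_pos s (b - 2)).
apply (Rmult_le_reg_l t); [lra|].
rewrite E1 in H1 |- *.
assert (0 <= Rpower s (b - 2) * (t - s) ^ 2) by (apply Rmult_le_pos; [lra|apply pow2_ge_0]).
nra.
Qed.

Lemma pow_kernel_holder c b x : a <= b < 1 ->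
  holder (Rabs c * Rpower T (b - a) * norm x) (fun s => scal (pow_kernel c b s) x).
Proof.
intros Hb; split; [split|].
- intros t Ht; apply (continuous_scal_l (K := R_AbsRing) (pow_kernel c b) x t).
  apply pow_kernel_continuous; lra.
- intros t Ht; rewrite hnorm_scal.
  pose proof (pow_kernel_bound c b t ltac:(lra) Ht); pose proof (norm_ge_0 x); nra.
- intros s t Hs Ht.
  hnorm (scal (pow_kernel c b t - pow_kernel c b s) x); rewrite hnorm_scal.
  pose proof (pow_kernel_lipschitz c b s t Hb Hs Ht); pose proof (norm_ge_0 x); nra.
Qed.

(** The operator (A E * omega)(r) of the overview, for omega (s) = c s^(b-1). *)
Definition smoothed_kernel (c b r : R) (x : H) : H :=
  maxreg (fun s => scal (pow_kernel c b s) x) r.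

Lemma pow_kernel_const_ge0 c b : 0 <= Rabs c * Rpower T (b - a).
Proof. apply Rmult_le_pos; [apply Rabs_pos|apply Rlt_le, Rpower_pos]. Qed.

Lemma pow_kernel_const_norm_ge0 c b x : 0 <= Rabs c * Rpower T (b - a) * norm x.
Proof. apply Rmult_le_pos; [apply pow_kernel_const_ge0|apply norm_ge_0]. Qed.

Lemma smoothed_kernel_norm c b r x : a <= b < 1 -> 0 < r < T ->
  norm (smoothed_kernel c b r x) <=
    (8 / a + 2) * (Rabs c * Rpower T (b - a)) * Rpower r (a - 1) * norm x.
Proof.
intros Hb Hr.
pose proof (maxreg_bounded_fn _ _ (pow_kernel_const_norm_ge0 c b x)
  (pow_kernel_holder c b x Hb)) as [_ Hn].
eapply Rle_trans; [now apply Hn|right; ring].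
Qed.

Lemma smoothed_kernel_kernel c b : a <= b < 1 ->
  kernel a T ((8 / a + 2) * (Rabs c * Rpower T (b - a))) (smoothed_kernel c b).
Proof.
intros Hb; split; [|split].
- intros r Hr; eapply is_linear_build.
  + intros x y; unfold smoothed_kernel.
    rewrite <- (maxreg_plus _ _ _ _ r (pow_kernel_const_norm_ge0 c b x)
      (pow_kernel_const_norm_ge0 c b y) (pow_kernel_holder c b x Hb)
      (pow_kernel_holder c b y Hb) Hr).
    f_equal; apply functional_extensionality; intros s; hring.
  + intros d x; unfold smoothed_kernel.
    rewrite <- (maxreg_scal _ _ d r (pow_kernel_const_norm_ge0 c b x)
      (pow_kernel_holder c b x Hb) Hr).
    f_equal; apply functional_extensionality; intros s; hring.
  + intros x; now apply smoothed_kernel_norm.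
- intros x r Hr; apply (maxreg_bounded_fn _ _ (pow_kernel_const_norm_ge0 c b x)
    (pow_kernel_holder c b x Hb)); assumption.
- intros r x Hr; now apply smoothed_kernel_norm.
Qed.

Lemma pow_kernel_kernel c b : a <= b ->
  kernel a T (Rabs c * Rpower T (b - a)) (fun r x => scal (pow_kernel c b r) x).
Proof.
intros Hb; apply kernel_scal_op.
- intros r Hr; apply pow_kernel_continuous; lra.
- intros r Hr; apply pow_kernel_bound; lra.
Qed.

Lemma kernel_zero : kernel a T 0 (fun _ _ => zero : H).
Proof.
split; [|split].
- intros r Hr; apply (is_linear_build _ 0); [intros; hring|intros; hring|].
  intros x; rewrite hnorm_zero; lra.
- intros x r Hr; apply continuous_const.
- intros r x Hr; rewrite hnorm_zero; lra.
Qed.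

(** One induction for all finite sums of kernels. [P] relates a sum to a companion sum, such as its
    derivative or its image under S; when there is no companion, a dummy one is supplied. *)
Lemma sum_pair (P : (R -> H -> H) -> (R -> H -> H) -> Prop) (p q : nat -> R -> H -> H) m :
  P (fun _ _ => zero) (fun _ _ => zero) ->
  (forall k1 l1 k2 l2, P k1 l1 -> P k2 l2 ->
     P (fun r x => plus (k1 r x) (k2 r x)) (fun r x => plus (l1 r x) (l2 r x))) ->
  (forall j, (1 <= j <= m)%nat -> P (p j) (q j)) ->
  P (fun r x => sum_n_m (fun j => p j r x) 1 m) (fun r x => sum_n_m (fun j => q j r x) 1 m).
Proof.
intros H0 Hplus; induction m as [|n IH]; intros Hpq.
- assert (forall u : nat -> R -> H -> H,
    (fun _ _ => zero) = (fun r x => sum_n_m (fun j => u j r x) 1 0 : H)) as E0.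
  { intros u; apply functional_extensionality; intros r; apply functional_extensionality; intros x.
    now rewrite sum_n_m_zero by lia. }
  rewrite (E0 p) in H0 at 1; now rewrite (E0 q) in H0.
- assert (forall u : nat -> R -> H -> H,
    (fun r x => plus (sum_n_m (fun j => u j r x) 1 n) (u (Datatypes.S n) r x)) =
    (fun r x => sum_n_m (fun j => u j r x) 1 (Datatypes.S n) : H)) as E1.
  { intros u; apply functional_extensionality; intros r; apply functional_extensionality; intros x.
    now rewrite sum_n_Sm by lia. }
  assert (Hs := Hplus _ _ _ _ (IH (fun j Hj => Hpq j ltac:(lia))) (Hpq (Datatypes.S n) ltac:(lia))).
  cbv beta in Hs; now rewrite (E1 p), (E1 q) in Hs.
Qed.

Lemma kernel_sum (p : nat -> R -> H -> H) m :
  (forall j, (1 <= j <= m)%nat -> exists N, 0 <= N /\ kernel a T N (p j)) ->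
  exists N, 0 <= N /\ kernel a T N (fun r x => sum_n_m (fun j => p j r x) 1 m).
Proof.
intros Hp; apply (sum_pair (fun k _ => exists N, 0 <= N /\ kernel a T N k) p p m); [| |exact Hp].
- exists 0; split; [lra|apply kernel_zero].
- intros k1 _ k2 _ (N1 & HN1 & Hk1) (N2 & HN2 & Hk2).
  exists (N1 + N2); split; [lra|now apply kernel_plus].
Qed.

(** * The memory term *)

Section Memory.
Context (c b : nat -> R) (L : nat -> H -> H) (kappa : R).

Definition memory (m : nat) (r : R) (x : H) : H :=
  sum_n_m (fun j => scal (pow_kernel (c j) (b j) r) (L j x)) 1 m.
Definition smoothed_memory (m : nat) (r : R) (x : H) : H :=
  sum_n_m (fun j => smoothed_kernel (c j) (b j) r (L j x)) 1 m.
(* The kernel kappa E - sum_j (A E * omega_j) L_j of the Volterra equations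
   for A v' and for the difference of two solutions. *)
Definition volterra_kernel (m : nat) (r : R) (x : H) : H :=
  minus (scal kappa (E r x)) (smoothed_memory m r x).

Context (m : nat) (HL : forall j, (1 <= j <= m)%nat -> is_linear (L j)).

Lemma memory_kernel : (forall j, (1 <= j <= m)%nat -> a <= b j) ->
  exists N, 0 <= N /\ kernel a T N (memory m).
Proof.
intros Hb'; apply kernel_sum; intros j Hj.
destruct (linear_norm _ (HL j Hj)) as (C & HC & HCb).
pose proof (pow_kernel_const_ge0 (c j) (b j)).
exists (C * (Rabs (c j) * Rpower T (b j - a))); split; [nra|].
apply (kernel_comp_r a T _ C (L j) (fun r x => scal (pow_kernel (c j) (b j) r) x)); auto; try lra.
now apply pow_kernel_kernel, Hb'.
Qed.

Context (Hb : forall j, (1 <= j <= m)%nat -> a <= b j < 1).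

Lemma smoothed_memory_kernel : exists N, 0 <= N /\ kernel a T N (smoothed_memory m).
Proof.
apply kernel_sum; intros j Hj.
destruct (linear_norm _ (HL j Hj)) as (C & HC & HCb).
pose proof (pow_kernel_const_ge0 (c j) (b j)).
assert (0 < 8 / a) by (apply Rdiv_lt_0_compat; lra).
assert (0 <= (8 / a + 2) * (Rabs (c j) * Rpower T (b j - a))) by (apply Rmult_le_pos; lra).
exists (C * ((8 / a + 2) * (Rabs (c j) * Rpower T (b j - a)))); split; [nra|].
apply (kernel_comp_r a T _ C (L j) (smoothed_kernel (c j) (b j))); auto; try lra.
now apply smoothed_kernel_kernel, Hb.
Qed.

Lemma S_smoothed_memory_derive x r : 0 < r < T ->
  is_derive (fun r => S (smoothed_memory m r x)) r
    (minus (memory m r x) (smoothed_memory m r x)).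
Proof.
pose proof S_linear as HS; revert x r.
apply (sum_pair (fun k l => forall x r, 0 < r < T ->
  is_derive (fun r => S (k r x)) r (minus (l r x) (k r x)))
  (fun j r x => smoothed_kernel (c j) (b j) r (L j x))
  (fun j r x => scal (pow_kernel (c j) (b j) r) (L j x))).
- intros x r _; eapply is_derive_Heq; [apply @is_derive_const|hring].
- intros k1 l1 k2 l2 D1 D2 x r Hr.
  apply (is_derive_ext (fun r => plus (S (k1 r x)) (S (k2 r x)))).
  + intros t; symmetry; apply S_plus.
  + eapply is_derive_Heq; [apply (is_derive_plus (fun r => S (k1 r x)) (fun r => S (k2 r x)));
      [now apply D1|now apply D2]|hring].
- intros j Hj x r Hr.
  apply (maxreg_derive _ _ r (pow_kernel_const_norm_ge0 (c j) (b j) (L j x))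
    (pow_kernel_holder (c j) (b j) (L j x) (Hb j Hj)) Hr).
Qed.

Lemma S_smoothed_memory_norm : exists N, 0 <= N /\ forall r x, 0 < r < T ->
  norm (S (smoothed_memory m r x)) <= N * norm x * Rpower r a.
Proof.
pose proof S_linear as HS.
apply (sum_pair (fun k _ => exists N, 0 <= N /\ forall r x, 0 < r < T ->
  norm (S (k r x)) <= N * norm x * Rpower r a)
  (fun j r x => smoothed_kernel (c j) (b j) r (L j x)) (fun _ _ _ => zero)).
- exists 0; split; [lra|]; intros r x _; rewrite (linear_zero' S HS), hnorm_zero; lra.
- intros k1 _ k2 _ (N1 & HN1 & K1) (N2 & HN2 & K2).
  exists (N1 + N2); split; [lra|]; intros r x Hr; rewrite S_plus.
  eapply Rle_trans; [apply hnorm_triangle|].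
  specialize (K1 r x Hr); specialize (K2 r x Hr); lra.
- intros j Hj; destruct (linear_norm _ (HL j Hj)) as (C & HC & HCb).
  pose proof (pow_kernel_const_ge0 (c j) (b j)) as Hp.
  set (Np := Rabs (c j) * Rpower T (b j - a)) in *.
  assert (0 < 2 / a) by (apply Rdiv_lt_0_compat; lra).
  exists (Np * C * (2 / a)); split; [assert (0 <= Np * C) by nra; nra|]; intros r x Hr.
  eapply Rle_trans; [apply (S_maxreg_norm (Np * norm (L j x)))|].
  + apply pow_kernel_const_norm_ge0.
  + now apply pow_kernel_holder, Hb.
  + assumption.
  + apply Rmult_le_compat_r; [apply Rlt_le, Rpower_pos|].
    replace (Np * C * (2 / a) * norm x) with (1 * (Np * (C * norm x)) * (2 / a)) by ring.
    apply Rmult_le_compat_r; [lra|]; apply Rmult_le_compat_l; [lra|].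
    apply Rmult_le_compat_l; [lra|apply HCb].
Qed.

Lemma volterra_kernel_kernel : exists N, 0 <= N /\ kernel a T N (volterra_kernel m).
Proof.
destruct smoothed_memory_kernel as (N & HN & Hk).
pose proof (Rpower_pos T (1 - a)); pose proof (Rabs_pos kappa).
exists (Rabs kappa * (1 * Rpower T (1 - a)) + N); split; [nra|].
apply (kernel_plus a T _ N (fun r x => scal kappa (E r x))
  (fun r x => opp (smoothed_memory m r x))); [|now apply kernel_opp].
apply (kernel_comp_l a T _ _ (fun x : H => scal kappa x));
  [assumption|apply scal_linear| |apply E_kernel].
intros x; rewrite hnorm_scal; lra.
Qed.

(** The part kappa S E contributes - kappa E, and [maxreg_derive] contributes the smoothed memory
    minus [memory]; together they rebuild the kernel itself. The derivative is again O(r^(a-1)), so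
    [conv_derive] applies to S composed with the kernel. *)
Lemma S_volterra_kernel_derive x r : 0 < r < T ->
  is_derive (fun r => S (volterra_kernel m r x)) r
    (opp (plus (volterra_kernel m r x) (memory m r x))).
Proof.
intros Hr; pose proof S_linear as HS.
apply (is_derive_ext (fun r => minus (scal kappa (S (E r x))) (S (smoothed_memory m r x)))).
- intros s; unfold volterra_kernel; now rewrite linear_minus, (linear_scal S HS).
- eapply is_derive_Heq.
  + apply (is_derive_minus (fun r => scal kappa (S (E r x))) (fun r => S (smoothed_memory m r x))).
    * apply (linear_derive (fun x : H => scal kappa x) (fun r => S (E r x))).
      -- apply scal_linear.
      -- apply SE_derive; lra.
    * now apply S_smoothed_memory_derive.
  + unfold volterra_kernel; hring.
Qed.

Lemma S_volterra_kernel_norm : exists N, 0 <= N /\ forall r x, 0 < r < T ->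
  norm (S (volterra_kernel m r x)) <= N * norm x.
Proof.
destruct S_smoothed_memory_norm as (N & HN & Hn).
destruct S_bounded as (C & HC & HCb); pose proof S_linear as HS.
pose proof (Rpower_pos T a); pose proof (Rabs_pos kappa).
exists (Rabs kappa * C + N * Rpower T a); split; [nra|]; intros r x Hr.
unfold volterra_kernel; rewrite linear_minus, linear_scal' by assumption.
eapply Rle_trans; [apply norm_minus_le|]; rewrite hnorm_scal.
specialize (Hn r x Hr); pose proof (norm_ge_0 x).
assert (norm (S (E r x)) <= C * norm x).
{ eapply Rle_trans; [apply HCb|]; apply Rmult_le_compat_l; [lra|].
  apply E_contraction; lra. }
assert (Rpower r a <= Rpower T a) by (apply Rle_Rpower_l; lra).
assert (N * norm x * Rpower r a <= N * norm x * Rpower T a)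
  by (apply Rmult_le_compat_l; nra).
nra.
Qed.

Lemma S_volterra_kernel_lim x :
  filterlim (fun r => S (volterra_kernel m r x)) (at_right 0) (locally (scal kappa (S x))).
Proof.
destruct S_smoothed_memory_norm as (N & HN & Hn); pose proof S_linear as HS.
replace (scal kappa (S x)) with (plus (scal kappa (S x)) (opp zero) : H) by hring.
apply (filterlim_ext (fun r => plus (scal kappa (S (E r x))) (opp (S (smoothed_memory m r x))))).
- intros r; unfold volterra_kernel; rewrite linear_minus, linear_scal' by assumption.
  hring.
- apply (filterlim_comp_2 (G := locally (scal kappa (S x) : H)) (H := locally (opp zero : H))
    (fun r => scal kappa (S (E r x))) (fun r => opp (S (smoothed_memory m r x))) plus).
  + apply (filterlim_comp _ _ _ (fun r => S (E r x)) (fun y : H => scal kappa y) _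
      (locally (S x))).
    * apply (linear_lim (at_right 0) S); [assumption|apply E_lim_0].
    * apply (filterlim_scal_r (V := H)).
  + apply (filterlim_comp _ _ _ (fun r => S (smoothed_memory m r x)) (fun y : H => opp y) _
      (locally (zero : H))).
    * apply (lim_0_of_bound (N * norm x) T); [assumption|]; intros r Hr; now apply Hn.
    * apply (filterlim_opp (V := H)).
  + apply (filterlim_plus (V := H)).
Qed.

(** For q = [conv (volterra_kernel m) f] it reads (S q)' + q = kappa S f - memory * f, which is q' +
    A q = A (kappa S f - memory * f) with A^-1 applied. The kernel is built to satisfy this. *)
Lemma volterra_derive M f t : 0 <= M -> bounded_fn a T M f -> 0 < t < T ->
  is_derive (fun s => S (conv (volterra_kernel m) f s)) t
    (minus (minus (scal kappa (S (f t))) (conv (volterra_kernel m) f t))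
       (conv (memory m) f t)).
Proof.
intros HM Hf Ht.
destruct volterra_kernel_kernel as (N & HN & Hk).
destruct (memory_kernel (fun j Hj => proj1 (Hb j Hj))) as (N' & HN' & Hk').
destruct S_bounded as (C & HC & HCb); pose proof S_linear as HS.
pose proof (opp_linear (H := H)) as Hopp.
assert (Hplus := kernel_plus a T N N' _ _ Hk Hk').
apply (is_derive_ext_open (conv (fun r x => S (volterra_kernel m r x)) f) _ 0 T);
  [assumption| |].
- intros r Hr; now apply (conv_linear a T Ha N M).
- eapply is_derive_Heq.
  + apply (conv_derive a T Ha (fun r x => S (volterra_kernel m r x))
      (fun r x => opp (plus (volterra_kernel m r x) (memory m r x)))
      (fun x => scal kappa (S x)) f (C * N) (N + N') M); try assumption; try nra.
    * apply kernel_comp_l; try assumption; lra.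
    * now apply kernel_opp.
    * exact (is_linear_comp (fun x : H => scal kappa x) S (scal_linear kappa) HS).
    * intros x r Hr; now apply S_volterra_kernel_derive.
    * intros x; apply S_volterra_kernel_lim.
  + rewrite (conv_linear a T Ha (N + N') M (fun x : H => opp x)
      (fun r x => plus (volterra_kernel m r x) (memory m r x))); try assumption; [|lra].
    rewrite (conv_plus_kernel a T Ha N N' M) by assumption; hring.
Qed.

Lemma volterra_lim_0 M f : 0 <= M -> bounded_fn a T M f ->
  filterlim (fun s => S (conv (volterra_kernel m) f s)) (at_right 0) (locally (zero : H)).
Proof.
intros HM Hf.
destruct volterra_kernel_kernel as (N & HN & Hk).
destruct S_volterra_kernel_norm as (N' & HN' & Hb').
pose proof S_linear as HS.
apply (filterlim_ext_loc (conv (fun r x => S (volterra_kernel m r x)) f)).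
- apply (filter_imp (fun t => 0 < t < T)); [|now apply at_right_between].
  intros t Ht; now apply (conv_linear a T Ha N M).
- apply (conv_bounded_lim_0 N' M); try assumption.
  + intros r Hr; apply (is_linear_comp S); [assumption|now apply Hk].
  + intros x r Hr; apply linear_continuous; [assumption|now apply Hk].
Qed.

End Memory.

Lemma is_derive_scal_prod (p : R -> R) (f : R -> H) (t p' : R) (f' : H) :
  is_derive p t p' -> is_derive f t f' ->
  is_derive (fun s => scal (p s) (f s)) t (plus (scal p' (f t)) (scal (p t) f')).
Proof.
intros Hp Hf.
pose proof (filterdiff_scal_fct t p f _ _ Rmult_comm Hp Hf) as Hd.
eapply filterdiff_ext_lin; [exact Hd|].
intros s; apply inner_ext; intro; inner_expand.
unfold scal; simpl; unfold mult; simpl; ring.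
Qed.

Lemma pow_kernel_primitive_derive d e t : e <> 0 -> 0 < t ->
  is_derive (pow_kernel (d / e) (e + 1)) t (pow_kernel d e t).
Proof.
intros He Ht; unfold pow_kernel.
eapply is_derive_Req.
- apply (is_derive_scal (fun s => Rpower s (e + 1 - 1))), is_derive_Rpower, Ht.
- replace (e + 1 - 1) with e by ring; unfold scal; simpl; unfold mult; simpl; field; assumption.
Qed.

(** * The time derivative of the memory convolution *)

Section MemoryPrimitive.
Context (c b : nat -> R) (L : nat -> H -> H) (m : nat).
Context (Hb : forall j, (1 <= j <= m)%nat -> a <= b j < 1).
Context (HL : forall j, (1 <= j <= m)%nat -> is_linear (L j)).

Let W := memory c b L m.
(* The primitive of W which vanishes at 0. *)
Let W1 := memory (fun j => c j / b j) (fun j => b j + 1) L m.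

Lemma primitive_memory_kernel : exists N, 0 <= N /\ kernel a T N W1.
Proof.
apply memory_kernel; [assumption|]; intros j Hj; pose proof (Hb j Hj); lra.
Qed.

Lemma primitive_memory_product (f f' : R -> H) (t s : R) : 0 < t - s -> is_derive f s (f' s) ->
  is_derive (fun s => W1 (t - s) (f s)) s (minus (W1 (t - s) (f' s)) (W (t - s) (f s))).
Proof.
intros Hs Hf.
apply (sum_pair (fun k1 k => is_derive (fun s => k1 (t - s) (f s)) s
  (minus (k1 (t - s) (f' s)) (k (t - s) (f s))))
  (fun j r x => scal (pow_kernel (c j / b j) (b j + 1) r) (L j x))
  (fun j r x => scal (pow_kernel (c j) (b j) r) (L j x))).
- eapply is_derive_Heq; [apply @is_derive_const|hring].
- intros k1 l1 k2 l2 D1 D2.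
  eapply is_derive_Heq; [apply (is_derive_plus _ _ _ _ _ D1 D2)|hring].
- intros j Hj; eapply is_derive_Heq.
  + apply is_derive_scal_prod; [|apply (linear_derive (L j)); [now apply HL|exact Hf]].
    apply (is_derive_comp (pow_kernel (c j / b j) (b j + 1)) (fun r => t - r) s).
    * apply pow_kernel_primitive_derive; [pose proof (Hb j Hj); lra|assumption].
    * instantiate (1 := -1); auto_derive; [exact I|ring].
  + apply inner_ext; intro; inner_expand; unfold scal; simpl; unfold mult; simpl; ring.
Qed.

Lemma primitive_memory_derive x r : 0 < r < T -> is_derive (fun r => W1 r x) r (W r x).
Proof.
intros Hr; destruct primitive_memory_kernel as (N & HN & Hk & _).
(* The product rule for the constant function x at t = 0 and s = - r, to be reflected afterwards. *)
assert (is_derive (fun s => W1 (0 - s) x) (- r) (minus (W1 (0 - - r) zero) (W (0 - - r) x))) as Hd.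
{ apply (primitive_memory_product (fun _ => x) (fun _ => zero) 0 (- r)); [lra|].
  apply @is_derive_const. }
pose proof (is_derive_comp (fun s => W1 (0 - s) x) (fun s => - s) r _ (-1) Hd) as Hc.
eapply is_derive_Heq.
- eapply is_derive_ext; [|apply Hc; auto_derive; [exact I|ring]].
  intros s; simpl; f_equal; ring.
- replace (0 - - r) with r by ring.
  rewrite (linear_zero' (W1 r)) by now apply Hk.
  hring.
Qed.

Lemma primitive_memory_norm : exists N, 0 <= N /\ forall r x, 0 < r < T ->
  norm (W1 r x) <= N * norm x * Rpower r a.
Proof.
apply (sum_pair (fun k _ => exists N, 0 <= N /\ forall r x, 0 < r < T ->
  norm (k r x) <= N * norm x * Rpower r a)
  (fun j r x => scal (pow_kernel (c j / b j) (b j + 1) r) (L j x)) (fun _ _ _ => zero)).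
- exists 0; split; [lra|]; intros r x _; rewrite hnorm_zero; lra.
- intros k1 _ k2 _ (N1 & HN1 & K1) (N2 & HN2 & K2).
  exists (N1 + N2); split; [lra|]; intros r x Hr; eapply Rle_trans; [apply hnorm_triangle|].
  specialize (K1 r x Hr); specialize (K2 r x Hr); lra.
- intros j Hj; destruct (linear_norm _ (HL j Hj)) as (C & HC & HCb).
  set (Np := Rabs (c j / b j) * Rpower T (b j - a)).
  assert (0 <= Np) as HNp by (apply Rmult_le_pos; [apply Rabs_pos|apply Rlt_le, Rpower_pos]).
  exists (Np * C); split; [nra|]; intros r x Hr; rewrite hnorm_scal.
  replace (Np * C * norm x * Rpower r a) with (Np * Rpower r a * (C * norm x)) by ring.
  apply Rmult_le_compat; [apply Rabs_pos|apply norm_ge_0| |apply HCb].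
  unfold pow_kernel; rewrite Rabs_mult, (Rabs_pos_eq (Rpower _ _)) by apply Rlt_le, Rpower_pos.
  unfold Np; rewrite Rmult_assoc; apply Rmult_le_compat_l; [apply Rabs_pos|].
  replace (b j + 1 - 1) with (b j - a + a) by ring; rewrite Rpower_plus.
  apply Rmult_le_compat_r; [apply Rlt_le, Rpower_pos|].
  pose proof (Hb j Hj); apply Rle_Rpower_l; lra.
Qed.

(** Integrates the derivative of W1 (t - s) (v s) in s. The boundary term at s = t vanishes because
    W1 is O(r^a); the one at s = 0 is W1 t x0. This makes W * v differentiable although the
    derivative of W need not be integrable. *)
Lemma conv_memory_by_parts (z v : R -> H) Mz Mv x0 t : 0 <= Mz -> 0 <= Mv ->
  bounded_fn a T Mz z -> bounded_fn a T Mv v ->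
  (forall s, 0 < s < T -> is_derive v s (z s)) ->
  filterlim v (at_right 0) (locally x0) -> 0 < t < T ->
  conv W v t = plus (W1 t x0) (conv W1 z t).
Proof.
intros HMz HMv Hz Hv Hvz Hlim Ht.
destruct (memory_kernel c b L m HL (fun j Hj => proj1 (Hb j Hj))) as (N & HN & Hk).
destruct primitive_memory_kernel as (N1 & HN1 & Hk1).
destruct primitive_memory_norm as (N2 & HN2 & Hn2).
assert (is_int (fun s => minus (W1 (t - s) (z s)) (W (t - s) (v s))) t
  (minus zero (W1 t x0))) as I1.
{ apply (is_RInt_gen_derive _ (fun s => W1 (t - s) (v s))); [lra| | | |].
  - intros s Hs; apply primitive_memory_product; [lra|apply Hvz; lra].
  - intros s Hs; apply (continuous_minus (fun s => W1 (t - s) (z s)) (fun s => W (t - s) (v s))).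
    + apply (kernel_fn_continuous a T Ha N1 Mz); try assumption; lra.
    + apply (kernel_fn_continuous a T Ha N Mv); try assumption; lra.
  - apply (filterlim_comp_2 (G := locally t) (H := locally x0) (fun s => t - s) v W1).
    + apply (filterlim_filter_le_1 (F := locally 0)); [apply filter_le_within|].
      pose proof (continuous_reflect t 0) as Hc.
      unfold continuous in Hc; rewrite Rminus_0_r in Hc; exact Hc.
    + assumption.
    + intros P HP.
      destruct (kernel_continuous2 a T N1 W1 t x0 ltac:(lra) Hk1 Ht P HP) as [d Hd].
      apply (Filter_prod _ _ _ (ball t d) (ball x0 d)).
      * now exists d.
      * now exists d.
      * intros r x Hr Hx; apply (Hd (r, x)); now split.
  (* In the variable r = t - s < t/2 the vector v (t - r) stays bounded, so the factor r^a of W1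
     decides. *)
  - apply (filterlim_ext (fun s => W1 (t - s) (v (t - (t - s))))).
    { intros s; do 2 f_equal; ring. }
    apply (filterlim_comp _ _ _ (fun s => t - s) (fun r => W1 r (v (t - r))) _ (at_right 0)).
    + apply reflect_at_left.
    + apply (lim_0_of_bound (N2 * (Mv * Rpower (t / 2) (a - 1))) (t / 2)); [lra|].
      intros r Hr; eapply Rle_trans; [apply Hn2; lra|].
      apply Rmult_le_compat_r; [apply Rlt_le, Rpower_pos|].
      apply Rmult_le_compat_l; [assumption|].
      eapply Rle_trans; [apply Hv; lra|].
      apply Rmult_le_compat_l; [assumption|apply Rpower_le_neg; lra]. }
assert (minus (conv W1 z t) (conv W v t) = minus zero (W1 t x0)) as Heq.
{ rewrite <- (is_int_unique _ _ _ I1); symmetry; apply is_int_unique.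
  apply is_int_minus; [now apply (conv_is_int a T Ha N1 Mz)|now apply (conv_is_int a T Ha N Mv)]. }
replace (conv W v t) with (minus (conv W1 z t) (minus (conv W1 z t) (conv W v t))) by hring.
rewrite Heq; hring.
Qed.

Lemma conv_memory_derive (z v : R -> H) Mz Mv x0 t : 0 <= Mz -> 0 <= Mv ->
  bounded_fn a T Mz z -> bounded_fn a T Mv v ->
  (forall s, 0 < s < T -> is_derive v s (z s)) ->
  filterlim v (at_right 0) (locally x0) -> 0 < t < T ->
  is_derive (conv W v) t (plus (W t x0) (conv W z t)).
Proof.
intros HMz HMv Hz Hv Hvz Hlim Ht.
destruct (memory_kernel c b L m HL (fun j Hj => proj1 (Hb j Hj))) as (N & HN & Hk).
destruct primitive_memory_kernel as (N1 & HN1 & Hk1).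
destruct primitive_memory_norm as (N2 & HN2 & Hn2).
apply (is_derive_ext_open (fun t => plus (W1 t x0) (conv W1 z t)) _ 0 T); [assumption| |].
- intros s Hs; symmetry; now apply (conv_memory_by_parts z v Mz Mv).
- eapply is_derive_Heq.
  + apply (is_derive_plus (fun t => W1 t x0) (conv W1 z)).
    * now apply primitive_memory_derive.
    * apply (conv_derive a T Ha W1 W (fun _ => zero) z N1 N Mz); try assumption.
      -- apply (is_linear_build _ 0); [intros; hring|intros; hring|].
         intros x; rewrite hnorm_zero; lra.
      -- intros x r Hr; now apply primitive_memory_derive.
      -- intros x; apply (lim_0_of_bound (N2 * norm x) T); [assumption|].
         intros r Hr; now apply Hn2.
  + hring.
Qed.

Lemma conv_memory_lim_0 (v : R -> H) Mv : 0 <= Mv ->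
  (forall s, 0 < s < T -> continuous v s) -> (forall s, 0 < s < T -> norm (v s) <= Mv) ->
  filterlim (conv W v) (at_right 0) (locally (zero : H)).
Proof.
intros HMv Hc Hn.
destruct (memory_kernel c b L m HL (fun j Hj => proj1 (Hb j Hj))) as (N & HN & Hk).
apply (lim_0_of_bound (N * Mv * (2 / a)) T); [assumption|]; intros t Ht.
rewrite Rmult_assoc.
apply (sing_int a (N * Mv) t (fun s => W (t - s) (v s))); try lra; split; intros s Hs.
- apply (kernel_fn_continuous a T Ha N (Mv * Rpower T (1 - a))); try assumption; try lra.
  split; [assumption|]; intros r Hr; eapply Rle_trans; [now apply Hn|].
  pose proof (Rpower_weaken 1 r ltac:(lra) Hr) as Hp.
  replace (1 - 1) with 0 in Hp by ring; rewrite Rpower_O in Hp by lra; nra.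
- eapply Rle_trans; [apply (kernel_bound a T N W (t - s)) with (M := Mv); try assumption|].
  + lra.
  + apply Hn; lra.
  + pose proof (Rpower_pos s (a - 1)); pose proof (Rpower_pos (t - s) (a - 1)).
    assert (0 <= N * Mv) by nra.
    replace (N * Rpower (t - s) (a - 1) * Mv) with (N * Mv * Rpower (t - s) (a - 1)) by ring.
    apply Rmult_le_compat_l; lra.
Qed.

End MemoryPrimitive.

(** * Existence, regularity and uniqueness for the evolution equation *)

Section Regularity.
Context (c b : nat -> R) (L : nat -> H -> H) (kappa : R) (m : nat).
Context (Hb : forall j, (1 <= j <= m)%nat -> a <= b j < 1).
Context (HL : forall j, (1 <= j <= m)%nat -> is_linear (L j)).

Let W := memory c b L m.
Let V := volterra_kernel c b L kappa m.

(** Here y stands for A v' and S y for v'. The derivative is the equation differentiated in time,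
    with W t w0 coming from the initial value in the convolution. With w0 = A u0 and x0 = A u0 -
    g(0), the limit is v'(0) = g(0) - A u0 + kappa u0. *)
Lemma regular_exists M g1 x0 w0 : 0 <= M -> holder M g1 ->
  (forall t, 0 < t < T -> norm (E' t x0) <= M * Rpower t (a - 1)) ->
  exists (y : R -> H) My, 0 <= My /\ bounded_fn a T My y /\
    (forall t, 0 < t < T -> is_derive (fun s => S (y s)) t
       (plus (minus (minus (minus (g1 t) (W t w0)) (y t)) (conv W y t))
          (scal kappa (S (y t))))) /\
    filterlim (fun s => S (y s)) (at_right 0) (locally (plus (opp x0) (scal kappa (S w0)))).
Proof.
intros HM Hg1 Hx0; pose proof S_linear as HS.
destruct (volterra_kernel_kernel c b L kappa m HL Hb) as (N & HN & Hk).
pose proof (kernel_apply a T N _ w0 Hk) as HVw.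
pose proof (maxreg_bounded_fn M g1 HM Hg1) as Hmr.
assert (HE0 : bounded_fn a T M (fun t => E' t x0)).
{ split; [|assumption]; intros t Ht.
  apply (continuous_ext_near (fun s => opp (A (E s x0))) _ t t); [lra| |].
  - intros s Hs; apply Rabs_def2 in Hs; symmetry; apply E'_eq; lra.
  - apply (linear_continuous (fun x : H => opp x)); [apply opp_linear|].
    apply AE_continuous; lra. }
(* A E applied to v'(0) = - x0 + kappa S w0 gives E' x0 + kappa E w0; the second term is contained
   in V t w0. *)
set (F := fun t => plus (plus (maxreg g1 t) (V t w0)) (E' t x0)).
set (MF := (8 / a + 2) * M + N * norm w0 + M).
assert (HF : bounded_fn a T MF F) by (repeat apply bounded_fn_plus; assumption).
assert (0 < 8 / a) by (apply Rdiv_lt_0_compat; lra).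
pose proof (norm_ge_0 w0).
assert (0 <= MF) as HMF.
{ unfold MF; assert (0 <= (8 / a + 2) * M) by (apply Rmult_le_pos; lra); nra. }
destruct (volterra_exists a T Ha N V HN Hk F MF HMF HF) as (y & My & HMy & Hy & Heq).
exists y, My; split; [assumption|]; split; [assumption|].
assert (HSE : forall s, 0 < s -> S (E' s x0) = opp (E s x0)).
{ intros s Hs; rewrite (proj2 (E'_eq s x0 Hs)).
  replace (opp (A (E s x0))) with (scal (-1) (A (E s x0)) : H) by hring.
  rewrite S_scal, HAS by (now apply E_dom); hring. }
assert (HSy : forall s, 0 < s < T -> S (y s) =
  plus (plus (plus (S (maxreg g1 s)) (S (V s w0))) (opp (E s x0))) (S (conv V y s))).
{ intros s Hs; rewrite Heq by assumption; unfold F.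
  rewrite !S_plus, HSE by lra; reflexivity. }
split.
- intros t Ht.
  apply (is_derive_ext_open (fun s => plus (plus (plus (S (maxreg g1 s)) (S (V s w0)))
     (opp (E s x0))) (S (conv V y s))) _ 0 T); [assumption| |].
  + intros s Hs; symmetry; now apply HSy.
  + eapply is_derive_Heq.
    * apply (is_derive_plus (fun s => plus (plus (S (maxreg g1 s)) (S (V s w0))) (opp (E s x0)))
        (fun s => S (conv V y s))).
      -- apply (is_derive_plus (fun s => plus (S (maxreg g1 s)) (S (V s w0)))
           (fun s => opp (E s x0))).
         ++ apply (is_derive_plus (fun s => S (maxreg g1 s)) (fun s => S (V s w0))).
            ** now apply (maxreg_derive M).
            ** now apply S_volterra_kernel_derive.
         ++ apply (is_derive_opp (fun s => E s x0)); apply hE'; lra.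
      -- now apply (volterra_derive c b L kappa m HL Hb My).
    * fold V W; apply inner_ext; intros w.
      pose proof (f_equal (fun x => inner x w) (Heq t Ht)) as Hw.
      unfold F in Hw; simpl in Hw; rewrite !inner_plus_l in Hw.
      inner_expand; lra.
- apply (filterlim_ext_loc (fun s => plus (plus (plus (S (maxreg g1 s)) (S (V s w0)))
     (opp (E s x0))) (S (conv V y s)))).
  + apply (filter_imp (fun s => 0 < s < T)); [|now apply at_right_between].
    intros s Hs; symmetry; now apply HSy.
  + replace (plus (opp x0) (scal kappa (S w0))) with
      (plus (plus (plus zero (scal kappa (S w0))) (opp x0)) zero : H) by hring.
    assert (Hplus : forall (p q : R -> H) x y, filterlim p (at_right 0) (locally x) ->
      filterlim q (at_right 0) (locally y) ->
      filterlim (fun s => plus (p s) (q s)) (at_right 0) (locally (plus x y))).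
    { intros p q x' y' Hp Hq.
      apply (filterlim_comp_2 (G := locally x') (H := locally y') p q plus); try assumption.
      apply (filterlim_plus (V := H)). }
    apply Hplus; [apply Hplus; [apply Hplus|]|].
    * apply (lim_0_of_bound (1 * M * (2 / a)) T); [assumption|].
      intros t Ht; now apply S_maxreg_norm.
    * now apply S_volterra_kernel_lim.
    * apply (linear_lim (at_right 0) (fun x : H => opp x)); [apply opp_linear|apply E_lim_0].
    * now apply (volterra_lim_0 c b L kappa m HL Hb My).
Qed.

(** By [volterra_derive], d = u - V * u satisfies (S d)' = - d, so d = 0 by [ode_unique]; then
    [volterra_unique] applies to u = V * u. *)
Lemma homogeneous_unique (u : R -> H) M : 0 <= M -> bounded_fn a T M u ->
  (forall t, 0 < t < T -> is_derive (fun s => S (u s)) t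
     (minus (minus (scal kappa (S (u t))) (u t)) (conv W u t))) ->
  filterlim (fun s => S (u s)) (at_right 0) (locally (zero : H)) ->
  forall t, 0 < t < T -> u t = zero.
Proof.
intros HM Hu Hd Hlim; pose proof S_linear as HS.
destruct (volterra_kernel_kernel c b L kappa m HL Hb) as (N & HN & Hk).
apply (volterra_unique a T Ha N V HN Hk u M HM Hu).
intros t Ht.
assert (minus (u t) (conv V u t) = zero) as E0.
{ apply (ode_unique T (fun t => minus (u t) (conv V u t))); [| |assumption].
  - intros s Hs.
    apply (is_derive_ext (fun r => minus (S (u r)) (S (conv V u r)))).
    + intros r; symmetry; now apply linear_minus.
    + eapply is_derive_Heq.
      * apply (is_derive_minus (fun r => S (u r)) (fun r => S (conv V u r))).
        -- now apply Hd.
        -- now apply (volterra_derive c b L kappa m HL Hb M).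
      * fold V W; hring.
  - apply (filterlim_ext (fun r => plus (S (u r)) (opp (S (conv V u r))))).
    + intros r; rewrite linear_minus by assumption; hring.
    + replace (zero : H) with (plus zero (opp zero) : H) by hring.
      apply (filterlim_comp_2 (G := locally (zero : H)) (H := locally (opp zero : H))
        (fun r => S (u r)) (fun r => opp (S (conv V u r))) plus).
      * assumption.
      * apply (linear_lim (at_right 0) (fun x : H => opp x)); [apply opp_linear|].
        now apply (volterra_lim_0 c b L kappa m HL Hb M).
      * apply (filterlim_plus (V := H)). }
replace (u t) with (plus (minus (u t) (conv V u t)) (conv V u t)) by hring.
rewrite E0; hring.
Qed.

End Regularity.

Lemma zero_of_derive_zero (f : R -> H) :
  (forall t, 0 < t < T -> is_derive f t zero) ->
  filterlim f (at_right 0) (locally (zero : H)) -> forall t, 0 < t < T -> f t = zero.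
Proof.
intros Hf Hlim t Ht.
assert (Hconst : forall s, 0 < s <= t -> norm (minus (f t) (f s)) <= 0).
{ intros s Hs; replace 0 with (0 - 0) by ring.
  apply (mean_value f (fun _ => zero) (fun _ => 0) (fun _ => 0)); [lra| | |].
  - intros r Hr; apply Hf; lra.
  - intros r Hr; exact (is_derive_const (V := R_NormedModule) 0 r).
  - intros r Hr; rewrite hnorm_zero; lra. }
apply (norm_eq_zero (f t)); apply Rle_antisym; [|apply norm_ge_0].
apply Rnot_lt_le; intros Hlt.
destruct (lim_witness _ _ _ t Hlim Hlt (proj1 Ht)) as (s & Hs2 & Hs1).
rewrite (norm_congr _ (f s)) in Hs1 by hring.
specialize (Hconst s ltac:(lra)); pose proof (norm_le_minus (f t) (f s)); lra.
Qed.

Lemma bounded_fn_of_bounded M (f : R -> H) : 0 <= M ->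
  (forall s, 0 < s < T -> continuous f s) -> (forall s, 0 < s < T -> norm (f s) <= M) ->
  bounded_fn a T (M * Rpower T (1 - a)) f.
Proof.
intros HM Hc Hn; split; [assumption|]; intros r Hr; eapply Rle_trans; [now apply Hn|].
pose proof (Rpower_weaken 1 r ltac:(lra) Hr) as Hp.
replace (1 - 1) with 0 in Hp by ring; rewrite Rpower_O in Hp by lra; nra.
Qed.

Lemma filterlim_hplus (p q : R -> H) x y : filterlim p (at_right 0) (locally x) ->
  filterlim q (at_right 0) (locally y) ->
  filterlim (fun s => plus (p s) (q s)) (at_right 0) (locally (plus x y)).
Proof.
intros Hp Hq.
apply (filterlim_comp_2 (G := locally x) (H := locally y) p q plus); try assumption.
apply (filterlim_plus (V := H)).
Qed.

Lemma filterlim_hminus (p q : R -> H) x y : filterlim p (at_right 0) (locally x) ->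
  filterlim q (at_right 0) (locally y) ->
  filterlim (fun s => minus (p s) (q s)) (at_right 0) (locally (minus x y)).
Proof.
intros Hp Hq; apply filterlim_hplus; [assumption|].
apply (linear_lim (at_right 0) (fun x : H => opp x)); [apply opp_linear|assumption].
Qed.

(** * Identification of a given solution with the constructed one *)

Section Comparison.
Context (c b : nat -> R) (LB L : nat -> H -> H) (kappa : R) (m : nat).
Context (Hb : forall j, (1 <= j <= m)%nat -> a <= b j < 1).
Context (HLB : forall j, (1 <= j <= m)%nat -> is_linear (LB j)).
Context (HL : forall j, (1 <= j <= m)%nat -> is_linear (L j)).
Context (HSL : forall j, (1 <= j <= m)%nat -> forall x, S (LB j x) = L j (S x)).

(** Intertwines the two bounded versions of B_j: [LB] stands for B_j S and [L] for the extension of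
    S B_j. *)
Lemma S_memory r x : S (memory c b LB m r x) = memory c b L m r (S x).
Proof.
pose proof S_linear as HS; revert r x.
apply (sum_pair (fun k k' => forall r x, S (k r x) = k' r (S x))
  (fun j r x => scal (pow_kernel (c j) (b j) r) (LB j x))
  (fun j r x => scal (pow_kernel (c j) (b j) r) (L j x))).
- intros _ _; now apply linear_zero'.
- intros k1 l1 k2 l2 E1 E2 r x; now rewrite S_plus, E1, E2.
- intros j Hj r x; now rewrite S_scal, HSL.
Qed.

Lemma memory_is_int (v : R -> H) (I : nat -> H) t : 0 < t ->
  (forall j, (1 <= j <= m)%nat ->
     is_int (fun s => scal (pow_kernel (c j) (b j) (t - s)) (L j (v s))) t (I j)) ->
  is_int (fun s => memory c b L m (t - s) (v s)) t (sum_n_m I 1 m).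
Proof.
intros Ht HI; unfold memory.
apply (sum_pair (fun p q => is_int (fun s => p (t - s) (v s)) t (q 0 zero))
  (fun j r x => scal (pow_kernel (c j) (b j) r) (L j x)) (fun j _ _ => I j)); [| |exact HI].
- assert (is_int (fun _ : R => zero : H) t (minus zero zero)) as I0.
  { apply (is_RInt_gen_derive _ (fun _ => zero : H)); [assumption| | | |].
    - intros s Hs; exact (is_derive_const (zero : H) s).
    - intros s Hs; apply continuous_const.
    - apply filterlim_const.
    - apply filterlim_const. }
  assert (minus zero zero = zero :> H) as E0 by hring.
  rewrite E0 in I0; exact I0.
- intros k1 l1 k2 l2; apply is_int_plus.
Qed.

(** As V' = S y, the data on y express only the differentiated equation for V. The residual of the
    equation itself, with S applied, is rho; it vanishes because its derivative and its limit at 0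
    do. Then v - V falls under [homogeneous_unique]. *)
Lemma comparison (y g g1 v V : R -> H) (My Mv MV : R) (w0 g0 : H) :
  0 <= My -> 0 <= Mv -> 0 <= MV -> bounded_fn a T My y ->
  (forall t, 0 < t < T -> is_derive (fun s => S (y s)) t
     (plus (minus (minus (minus (g1 t) (memory c b LB m t w0)) (y t))
        (conv (memory c b LB m) y t)) (scal kappa (S (y t))))) ->
  filterlim (fun s => S (y s)) (at_right 0)
    (locally (plus (opp (minus w0 g0)) (scal kappa (S w0)))) ->
  (forall t, 0 < t < T -> is_derive g t (g1 t)) ->
  filterlim g (at_right 0) (locally g0) ->
  (forall t, 0 < t < T -> is_derive V t (S (y t))) ->
  (forall t, 0 < t < T -> norm (V t) <= MV) ->
  filterlim V (at_right 0) (locally (S w0)) ->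
  (forall t, 0 < t < T -> continuous v t) ->
  (forall t, 0 < t < T -> norm (v t) <= Mv) ->
  filterlim v (at_right 0) (locally (S w0)) ->
  (forall t, 0 < t < T -> is_derive (fun s => S (v s)) t
     (plus (minus (minus (S (g t)) (v t)) (conv (memory c b L m) v t)) (scal kappa (S (v t))))) ->
  forall t, 0 < t < T -> v t = V t.
Proof.
intros HMy HMv HMV Hy Hdy Hylim Hg Hglim HV HVb HVlim Hv Hvb Hvlim Hdv.
pose proof S_linear as HS; destruct S_bounded as (C & HC & HCb).
destruct (memory_kernel c b LB m HLB (fun j Hj => proj1 (Hb j Hj))) as (N & HN & Hk).
destruct (memory_kernel c b L m HL (fun j Hj => proj1 (Hb j Hj))) as (N' & HN' & Hk').
set (W := memory c b L m).
pose proof (bounded_fn_linear a T My C S y (Rlt_le _ _ HC) HS HCb Hy) as HSy.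
assert (HCM : 0 <= C * My) by nra.
assert (HVc : forall t, 0 < t < T -> continuous V t)
  by (intros t Ht; eapply continuous_derive; now apply HV).
pose proof (Rpower_pos T (1 - a)) as HTa.
assert (HVf : bounded_fn a T (MV * Rpower T (1 - a)) V) by now apply bounded_fn_of_bounded.
assert (Hvf : bounded_fn a T (Mv * Rpower T (1 - a)) v) by now apply bounded_fn_of_bounded.
assert (HMV' : 0 <= MV * Rpower T (1 - a)) by nra.
assert (HMv' : 0 <= Mv * Rpower T (1 - a)) by nra.
set (rho := fun t => minus (minus (plus (plus (S (S (y t))) (V t)) (conv W V t))
  (scal kappa (S (V t)))) (S (g t))).
assert (Hrho : forall t, 0 < t < T -> rho t = zero).
{ apply zero_of_derive_zero.
  - intros t Ht; eapply is_derive_Heq.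
    + apply (is_derive_minus (fun t => minus (plus (plus (S (S (y t))) (V t)) (conv W V t))
        (scal kappa (S (V t)))) (fun t => S (g t))).
      * apply (is_derive_minus (fun t => plus (plus (S (S (y t))) (V t)) (conv W V t))
          (fun t => scal kappa (S (V t)))).
        -- apply (is_derive_plus (fun t => plus (S (S (y t))) (V t)) (conv W V)).
           ++ apply (is_derive_plus (fun t => S (S (y t))) V); [|now apply HV].
              apply (linear_derive S); [assumption|now apply Hdy].
           ++ apply (conv_memory_derive c b L m Hb HL (fun s => S (y s)) V (C * My)
                (MV * Rpower T (1 - a)) (S w0)); assumption.
        -- apply (linear_derive (fun x : H => scal kappa x)); [apply scal_linear|].
           apply (linear_derive S); [assumption|now apply HV].
      * apply (linear_derive S); [assumption|now apply Hg].
    + rewrite S_plus, !linear_minus, S_scal, S_memory by assumption.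
      rewrite <- (conv_linear a T Ha N My S) by assumption.
      assert (conv (fun r x => S (memory c b LB m r x)) y t = conv W (fun s => S (y s)) t) as ->.
      { apply (conv_ext T); [assumption| |].
        - intros s Hs; apply S_memory.
        - exists (conv (fun r x => S (memory c b LB m r x)) y t).
          apply (conv_is_int a T Ha (C * N) My (fun r x => S (memory c b LB m r x))); try assumption; [nra|].
          apply kernel_comp_l; try assumption; lra. }
      fold W; hring.
  - replace (zero : H) with (minus (minus (plus (plus
      (S (plus (opp (minus w0 g0)) (scal kappa (S w0)))) (S w0)) zero)
      (scal kappa (S (S w0)))) (S g0) : H).
    + apply filterlim_hminus; [apply filterlim_hminus; [apply filterlim_hplus;
        [apply filterlim_hplus|]|]|].
      * now apply (linear_lim (at_right 0) S).
      * assumption.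
      * apply (conv_memory_lim_0 c b L m Hb HL V MV); assumption.
      * apply (linear_lim (at_right 0) (fun x : H => scal kappa x)); [apply scal_linear|].
        now apply (linear_lim (at_right 0) S).
      * now apply (linear_lim (at_right 0) S).
    + replace (plus (opp (minus w0 g0)) (scal kappa (S w0))) with
        (plus (minus g0 w0) (scal kappa (S w0)) : H) by hring.
      rewrite S_plus, linear_minus, S_scal by assumption; hring. }
assert (Hu : forall t, 0 < t < T -> minus (v t) (V t) = zero).
{ apply (homogeneous_unique c b L kappa m Hb HL (fun t => minus (v t) (V t))
    (Mv * Rpower T (1 - a) + MV * Rpower T (1 - a))); [lra| | |].
  - now apply bounded_fn_minus.
  - intros t Ht.
    apply (is_derive_ext (fun s => minus (S (v s)) (S (V s)))).
    + intros s; symmetry; now apply linear_minus.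
    + eapply is_derive_Heq.
      * apply (is_derive_minus (fun s => S (v s)) (fun s => S (V s))); [now apply Hdv|].
        apply (linear_derive S); [assumption|now apply HV].
      * rewrite (conv_minus a T Ha N' (Mv * Rpower T (1 - a)) (MV * Rpower T (1 - a)))
          by assumption.
        rewrite (linear_minus S) by assumption.
        apply inner_ext; intros w.
        pose proof (f_equal (fun x => inner x w) (Hrho t Ht)) as Hw.
        unfold rho in Hw; cbv beta in Hw; revert Hw.
        fold W; inner_expand; intros Hw; lra.
  - apply (filterlim_ext (fun s => minus (S (v s)) (S (V s)))).
    + intros s; symmetry; now apply linear_minus.
    + replace (zero : H) with (minus (S (S w0)) (S (S w0)) : H) by hring.
      apply filterlim_hminus; now apply (linear_lim (at_right 0) S). }
intros t Ht.
replace (v t) with (plus (minus (v t) (V t)) (V t)) by hring.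
rewrite Hu by assumption; hring.
Qed.

End Comparison.

End Evolution.
End Operator.

(** * One-sided derivatives at T *)

Section OneSided.
Context {H : HilbertSpace} (T : R).

Lemma is_deriv_on_hnorm (f : R -> H) (t : R) (l : H) : 0 <= t <= T ->
  is_deriv_on T f t l <->
  (forall eps : R, 0 < eps -> exists d, 0 < d /\
     forall s, 0 <= s <= T -> Rabs (s - t) < d ->
       norm (minus (minus (f s) (f t)) (scal (s - t) l)) <= eps * Rabs (s - t)).
Proof.
intros Ht; split.
- intros [_ Hd] eps He.
  assert (is_filter_lim (within (fun s => 0 <= s <= T) (locally t)) t) as Hlim
    by (intros P HP; now apply filter_le_within).
  destruct (Hd t Hlim (mkposreal eps He)) as [d Hd'].
  exists d; split; [apply cond_pos|]; intros s Hs Hst; now apply (Hd' s).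
- intros Hd; split; [exact (is_linear_scal_l (K := R_AbsRing) l)|]; intros x Hx.
  (* The derivative is required at every limit point of the filter, and t is the only one, because t
     itself belongs to [0,T]. *)
  assert (x = t) as ->.
  { destruct (Req_dec x t) as [|Hne]; [assumption|exfalso].
    assert (0 < Rabs (t - x)) as Hpos by (apply Rabs_pos_lt; lra).
    destruct (Hx (ball x (mkposreal _ Hpos))) as [d Hd'].
    { now exists (mkposreal _ Hpos). }
    specialize (Hd' t (ball_center t d) Ht).
    real_ball_in Hd'.
    unfold Rminus in Hd'; lra. }
  intros [eps He]; destruct (Hd eps He) as (d & Hd0 & Hd').
  exists (mkposreal d Hd0); intros s Hs HsT; now apply Hd'.
Qed.

Lemma is_deriv_on_of_is_derive (f V : R -> H) (t : R) (l : H) : 0 < t <= T ->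
  (forall s, 0 < s <= T -> f s = V s) -> is_derive V t l -> is_deriv_on T f t l.
Proof.
intros Ht HfV HV; apply is_deriv_on_hnorm; [lra|]; intros eps He.
rewrite is_derive_hnorm in HV; destruct (HV eps He) as (d & Hd & Hd').
exists (Rmin d t); split; [apply Rmin_pos; lra|]; intros s Hs Hst.
rmin_bounds.
assert (0 < s) by (apply Rabs_def2 in Hst; lra).
rewrite !HfV by lra; apply Hd'; lra.
Qed.

Lemma is_derive_of_is_deriv_on (f : R -> H) (t : R) (l : H) : 0 < t < T ->
  is_deriv_on T f t l -> is_derive f t l.
Proof.
intros Ht Hf; apply is_derive_hnorm; intros eps He.
destruct (proj1 (is_deriv_on_hnorm f t l ltac:(lra)) Hf eps He) as (d & Hd & Hd').
exists (Rmin d (Rmin t (T - t))); split; [repeat apply Rmin_pos; lra|]; intros s Hs.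
rmin_bounds.
apply Hd'; [|lra]; apply Rabs_def2 in Hs; lra.
Qed.

Lemma is_deriv_on_continuous (f : R -> H) (t : R) (l : H) : 0 <= t <= T ->
  is_deriv_on T f t l -> forall eps, 0 < eps -> exists d, 0 < d /\
    forall s, 0 <= s <= T -> Rabs (s - t) < d -> norm (minus (f s) (f t)) < eps.
Proof.
intros Ht Hf eps He.
destruct (proj1 (is_deriv_on_hnorm f t l Ht) Hf 1 Rlt_0_1) as (d & Hd & Hd').
pose proof (norm_ge_0 l).
set (e := eps / (norm l + 2)).
assert (0 < e) as He' by (apply Rdiv_lt_0_compat; lra).
exists (Rmin d e); split; [now apply Rmin_pos|]; intros s Hs Hst.
rmin_bounds.
specialize (Hd' s Hs ltac:(lra)).
rewrite (norm_congr _ (plus (minus (minus (f s) (f t)) (scal (s - t) l)) (scal (s - t) l)))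
  by hring.
eapply Rle_lt_trans; [apply hnorm_triangle|]; rewrite hnorm_scal.
apply Rle_lt_trans with (Rabs (s - t) * (norm l + 1)); [lra|].
apply Rle_lt_trans with (e * (norm l + 1)); [apply Rmult_le_compat_r; lra|].
replace eps with (e * (norm l + 2)) by (unfold e; field; lra).
apply Rmult_lt_compat_l; lra.
Qed.

Lemma continuous_on_segment (f : R -> H) (t : R) :
  continuous_on (fun t => 0 <= t <= T) f -> 0 <= t <= T ->
  forall eps, 0 < eps -> exists d, 0 < d /\
    forall s, 0 <= s <= T -> Rabs (s - t) < d -> norm (minus (f s) (f t)) < eps.
Proof.
intros Hf Ht eps He.
destruct (proj1 (filterlim_hnorm (within (fun s => 0 <= s <= T) (locally t)) f (f t))
  (Hf t Ht) eps He) as [[d Hd] Hd'].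
exists d; split; [assumption|]; intros s Hs Hst; now apply (Hd' s).
Qed.

Lemma continuous_on_bounded (f : R -> H) : 0 < T ->
  continuous_on (fun t => 0 <= t <= T) f ->
  exists M, 0 <= M /\ forall t, 0 <= t <= T -> norm (f t) <= M.
Proof.
intros HT Hf.
apply (interval_cover (fun u w => exists M, 0 <= M /\ forall t, u <= t <= w -> norm (f t) <= M));
  [lra| |].
- intros x y z Hxy Hyz (M1 & HM1 & K1) (M2 & HM2 & K2); exists (M1 + M2); split; [lra|].
  intros t Ht; destruct (Rle_lt_dec t y) as [Hty|Hty].
  + specialize (K1 t ltac:(lra)); lra.
  + specialize (K2 t ltac:(lra)); lra.
- intros x Hx; destruct (continuous_on_segment f x Hf Hx 1 Rlt_0_1) as (d & Hd & Hd').
  exists d; split; [assumption|]; intros u w Hu Hw Hud Hwd.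
  pose proof (norm_ge_0 (f x)).
  exists (norm (f x) + 1); split; [lra|]; intros t Ht.
  assert (norm (minus (f t) (f x)) < 1) by (apply Hd'; [lra|apply Rabs_def1; lra]).
  pose proof (norm_le_minus (f t) (f x)); lra.
Qed.

Lemma continuous_on_lim_0 (f : R -> H) : 0 < T ->
  continuous_on (fun t => 0 <= t <= T) f -> filterlim f (at_right 0) (locally (f 0)).
Proof.
intros HT Hf; apply (filterlim_hnorm (at_right 0)); intros eps He.
destruct (continuous_on_segment f 0 Hf ltac:(lra) eps He) as (d & Hd & Hd').
apply (filter_imp (fun s => 0 < s < Rmin d T)).
- intros s Hs; rmin_bounds.
  apply Hd'; [lra|]; apply Rabs_def1; lra.
- apply at_right_between; now apply Rmin_pos.
Qed.

Lemma continuous_on_interior (f : R -> H) t : 0 < t < T ->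
  continuous_on (fun t => 0 <= t <= T) f -> continuous f t.
Proof.
intros Ht Hf; apply continuous_hnorm; intros eps He.
destruct (continuous_on_segment f t Hf ltac:(lra) eps He) as (d & Hd & Hd').
exists (Rmin d (Rmin t (T - t))); split; [repeat apply Rmin_pos; lra|]; intros s Hs.
rmin_bounds.
apply Hd'; [|lra]; apply Rabs_def2 in Hs; lra.
Qed.

(* Extending a function on (0,T] by a constant spares one-sided derivatives at T. *)
Lemma clamp_holder (a T1 C M : R) (f f' : R -> H) : 0 < a < 1 -> 0 < T < T1 -> 0 <= C ->
  C * Rpower (T / T1) (a - 1) <= M ->
  (forall t, 0 < t <= T -> is_deriv_on T f t (f' t)) ->
  (forall t, 0 < t <= T -> norm (f t) <= C * Rpower t (a - 1)) ->
  (forall t, 0 < t <= T -> t * norm (f' t) <= C * Rpower t (a - 1)) ->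
  holder a T1 M (fun t => f (Rmin t T)).
Proof.
intros Ha HT HC HM Hf Hb Hb'.
assert (0 < T / T1 <= 1) as Hratio.
{ split; [apply Rdiv_lt_0_compat; lra|]; apply (Rmult_le_reg_r T1); [lra|].
  replace (T / T1 * T1) with T by (field; lra); lra. }
assert (HCM : C <= M).
{ apply Rle_trans with (C * Rpower (T / T1) (a - 1)); [|assumption].
  assert (Rpower 1 (a - 1) <= Rpower (T / T1) (a - 1)) as Hp1 by (apply Rpower_le_neg; lra).
  rewrite Rpower_base_1 in Hp1; nra. }
assert (Hmin : forall t, 0 < t -> 0 < Rmin t T <= T).
{ intros t Ht; split; [apply Rmin_pos; lra|apply Rmin_r]. }
assert (Hlip : forall s t, 0 < s <= t -> t <= T ->
  norm (minus (f t) (f s)) <= C * Rpower s (a - 2) * (t - s)).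
{ assert (Hlip' : forall s t, 0 < s <= t -> t < T ->
    norm (minus (f t) (f s)) <= C * Rpower s (a - 2) * (t - s)).
  { intros s t Hs Ht.
    replace (C * Rpower s (a - 2) * (t - s)) with
      (C * Rpower s (a - 2) * t - C * Rpower s (a - 2) * s) by ring.
    apply (mean_value f f' (fun r => C * Rpower s (a - 2) * r) (fun _ => C * Rpower s (a - 2)));
      [lra| | |].
    - intros r Hr; apply is_derive_of_is_deriv_on; [lra|apply Hf; lra].
    - intros r Hr; auto_derive; [exact I|ring].
    - intros r Hr; specialize (Hb' r ltac:(lra)).
      rewrite (Rpower_split r (a - 1)) in Hb' by lra.
      replace (a - 1 - 1) with (a - 2) in Hb' by ring.
      assert (Rpower r (a - 2) <= Rpower s (a - 2)) by (apply Rpower_le_neg; lra).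
      apply Rle_trans with (C * Rpower r (a - 2)).
      + apply (Rmult_le_reg_l r); [lra|]; lra.
      + now apply Rmult_le_compat_l. }
  (* The mean value inequality uses two-sided derivatives, hence t < T; continuity at T adds the end
     point. *)
  intros s t Hs Ht; destruct (Rlt_le_dec t T) as [HtT|HtT]; [now apply Hlip'|].
  assert (t = T) as -> by lra.
  destruct (Req_dec s T) as [->|Hne].
  { hnorm zero; rewrite hnorm_zero; rewrite Rminus_diag; lra. }
  apply Rnot_lt_le; intros Hlt.
  set (e := norm (minus (f T) (f s)) - C * Rpower s (a - 2) * (T - s)).
  assert (0 < e) as He by (unfold e; lra).
  destruct (is_deriv_on_continuous f T (f' T) ltac:(lra) (Hf T ltac:(lra)) e He)
    as (d & Hd & Hd').
  set (r := Rmax s (T - d / 2)).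
  assert (s <= r) by apply Rmax_l; assert (T - d / 2 <= r) by apply Rmax_r.
  assert (r < T) by (apply Rmax_lub_lt; lra).
  assert (norm (minus (f r) (f T)) < e) as Hn1 by (apply Hd'; [lra|apply Rabs_def1; lra]).
  assert (norm (minus (f r) (f s)) <= C * Rpower s (a - 2) * (r - s)) as Hn2 by (apply Hlip'; lra).
  pose proof (norm_minus_tri (f T) (f r) (f s)) as Hn3.
  rewrite (norm_minus_sym (f T) (f r)) in Hn3.
  assert (C * Rpower s (a - 2) * (r - s) <= C * Rpower s (a - 2) * (T - s)).
  { apply Rmult_le_compat_l; [|lra]; apply Rmult_le_pos; [assumption|apply Rlt_le, Rpower_pos]. }
  unfold e in *; lra. }
(* On (0,T1) one has (T/T1) t <= min (t,T), so clamping costs only the factor (T/T1)^(a-1). *)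
assert (Hpow : forall t, 0 < t < T1 -> Rpower (Rmin t T) (a - 1) <=
  Rpower (T / T1) (a - 1) * Rpower t (a - 1)).
{ intros t Ht; rewrite Rpower_mult_distr by lra; apply Rpower_le_neg; [|lra].
  assert (T / T1 * t <= t) by nra.
  assert (T / T1 * t <= T).
  { replace T with (T / T1 * T1) at 2 by (field; lra); apply Rmult_le_compat_l; lra. }
  split; [nra|]; now apply Rmin_glb. }
split; [split|].
- intros t Ht; apply continuous_hnorm; intros eps He.
  pose proof (Hmin t ltac:(lra)).
  destruct (is_deriv_on_continuous f (Rmin t T) _ ltac:(lra) (Hf (Rmin t T) ltac:(lra)) eps He)
    as (d & Hd & Hd').
  exists (Rmin d t); split; [apply Rmin_pos; lra|]; intros s Hs.
  rmin_bounds.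
  assert (0 < s) by (apply Rabs_def2 in Hs; lra).
  pose proof (Hmin s ltac:(lra)).
  apply Hd'; [lra|].
  assert (Rabs (Rmin s T - Rmin t T) <= Rabs (s - t)); [|lra].
  unfold Rmin; destruct (Rle_dec s T), (Rle_dec t T); unfold Rabs;
    repeat destruct Rcase_abs; lra.
- intros t Ht; pose proof (Hmin t ltac:(lra)).
  eapply Rle_trans; [apply Hb; lra|].
  specialize (Hpow t Ht); pose proof (Rpower_pos t (a - 1)).
  apply Rle_trans with (C * (Rpower (T / T1) (a - 1) * Rpower t (a - 1)));
    [now apply Rmult_le_compat_l|].
  rewrite <- Rmult_assoc; apply Rmult_le_compat_r; lra.
- intros s t Hs Ht.
  pose proof (Rpower_pos s (a - 2)).
  destruct (Rle_lt_dec T s) as [HsT|HsT].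
  + rewrite !Rmin_right by lra; hnorm zero; rewrite hnorm_zero.
    apply Rmult_le_pos; [apply Rmult_le_pos|]; lra.
  + rewrite (Rmin_left s) by lra.
    assert (s <= Rmin t T) by (apply Rmin_glb; lra).
    eapply Rle_trans; [apply Hlip; [lra|apply Rmin_r]|].
    assert (Rmin t T <= t) by apply Rmin_l.
    apply Rmult_le_compat; try lra; [apply Rmult_le_pos; lra|apply Rmult_le_compat_r; lra].
Qed.

End OneSided.

Lemma linear_sum {H : HilbertSpace} (L : H -> H) (I : nat -> H) m : is_linear L ->
  L (sum_n_m I 1 m) = sum_n_m (fun j => L (I j)) 1 m.
Proof.
intros HL; induction m as [|p IH].
- rewrite !sum_n_m_zero by lia; now apply linear_zero'.
- rewrite !sum_n_Sm by lia; rewrite (linear_plus L HL), IH; reflexivity.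
Qed.

(** * Bounded operators obtained from A and a dominated B *)

Section Domination.
Context {H : HilbertSpace} (A B : operator H) (S : H -> H).
Context (hA_sa : self_adjoint A).
Context (HSA : forall f, dom A (S f) /\ A (S f) = f).
Context (HB_dom : forall w, dom A w -> dom B w) (HAB : dominates A B).

(** The case theta = 0 and q = 2; it makes B S bounded. *)
Lemma dominates_bound : exists C, 0 < C /\ forall x, dom A x -> norm (B x) <= C * norm (A x).
Proof.
destruct HAB as (C & HC & Hb); exists C; split; [assumption|]; intros x Hx.
apply (dense_norm_le (dom A)); [apply hA_sa| |].
- apply Rmult_le_pos; [lra|apply norm_ge_0].
- intros w Hw; eapply Rle_trans; [apply Rle_abs|].
  exact (Hb 0%nat 2%nat eq_refl x w Hx Hw).
Qed.

(** The case theta = 2 and q = 0, tested with S (S (B x)): A maps this vector to S (B x), and the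
    symmetry of S turns the pairing into |S (B x)|^2. *)
Lemma dominates_dual_bound :
  exists C, 0 < C /\ forall x, dom A x -> norm (S (B x)) <= C * norm x.
Proof.
destruct HAB as (C & HC & Hb); exists C; split; [assumption|]; intros x Hx.
destruct (HSA (S (B x))) as [D1 D2].
pose proof (Hb 2%nat 0%nat eq_refl x (S (S (B x))) Hx D1) as Hle; simpl in Hle.
rewrite D2, <- (S_sym A S hA_sa HSA), inner_norm in Hle.
pose proof (norm_ge_0 (S (B x))); pose proof (norm_ge_0 x).
rewrite Rabs_pos_eq in Hle by apply pow2_ge_0.
destruct (Req_dec (norm (S (B x))) 0) as [E0|E0].
- rewrite E0; apply Rmult_le_pos; lra.
- apply (Rmult_le_reg_r (norm (S (B x)))); [lra|]; simpl in Hle; lra.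
Qed.

End Domination.

Theorem theorem2
  (H : HilbertSpace) (A : operator H) (E E' : R -> H -> H)
  (m : nat) (B : nat -> operator H) (alpha : nat -> R)
  (alpha_min kappa T : R) (u0 : H) (g g' g'' v : R -> H)
  (hm : (1 <= m)%nat)
  (hkappa : 0 <= kappa)
  (halpha : forall j, (1 <= j <= m)%nat -> 0 < alpha j < 1)
  (halpha_min : (exists j, (1 <= j <= m)%nat /\ alpha_min = alpha j) /\
                (forall j, (1 <= j <= m)%nat -> alpha_min <= alpha j))
  (hT : 0 < T)
  (hA_sa : self_adjoint A)
  (hA_pos : positive_definite A)
  (hA_inv : has_compact_inverse A)
  (hB_sa : forall j, (1 <= j <= m)%nat -> self_adjoint (B j))
  (hB_dom : forall j, (1 <= j <= m)%nat -> forall w, dom A w -> dom (B j) w)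
  (hAB : forall j, (1 <= j <= m)%nat -> dominates A (B j))
  (hE : semigroup_exp A E)
  (hE' : forall t x, 0 < t -> is_derive (fun s => E s x) t (E' t x))
  (hu0 : dom A u0)
  (hu0_neq0 : u0 <> zero)
  (hg : continuous_on (fun t => 0 <= t <= T) g)
  (hg' : forall t, 0 < t <= T -> is_deriv_on T g t (g' t))
  (hg'' : forall t, 0 < t <= T -> is_deriv_on T g' t (g'' t))
  (hv : is_solution A m B alpha kappa T u0 g v)
  (hdata : exists C : R, 0 < C /\ forall t, 0 < t <= T ->
     norm (minus (A u0) (g 0)) + norm (g t) <= C /\
     norm (E' t (minus (A u0) (g 0))) + norm (g' t) + t * norm (g'' t)
       <= C * Rpower t (alpha_min - 1)) :
  exists v' v'' : R -> H,
    (forall t, 0 < t <= T ->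
       is_deriv_on T v t (v' t) /\
       is_deriv_on T v' t (v'' t) /\
       dom A (v' t)) /\
    exists C : R, 0 < C /\ forall t, 0 < t <= T ->
      norm (v'' t) + norm (A (v' t))
        <= C * Rpower t (alpha_min - 1) * norm_q A 2 u0.
Proof.
destruct hA_inv as (S & HSA & HAS & HSc).
destruct halpha_min as [(j0 & Hj0 & Ea) Hmin].
destruct hdata as (C & HC & Hdata).
set (a := alpha_min) in *.
assert (Ha : 0 < a < 1) by (rewrite Ea; now apply halpha).
(* On (0,T1) the time T is interior, so the constructed functions have two-sided derivatives
   there. *)
set (T1 := T + 1); assert (HT1 : 0 < T1) by (unfold T1; lra).
pose proof (S_linear A S HSA HAS HSc) as HS.
destruct (S_bounded A S HSA HAS HSc) as (CS & HCS & HCSb).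
set (w0 := A u0); set (x0 := minus w0 (g 0)).
assert (HSw0 : S w0 = u0) by now apply HAS.
set (c := fun j => / Gamma (alpha j)).
assert (Hb : forall j, (1 <= j <= m)%nat -> a <= alpha j < 1).
{ intros j Hj; split; [now apply Hmin|now apply halpha]. }
(* B_j enters only through bounded operators: B_j S, which acts on A v', and the extension of S B_j
   constructed below, which acts on v. *)
set (LB := fun j x => B j (S x)).
assert (HLB : forall j, (1 <= j <= m)%nat -> is_linear (LB j)).
{ intros j Hj.
  destruct (dominates_bound A (B j) hA_sa (hAB j Hj)) as (CB & HCB & HCBb).
  assert (HD : forall x, dom (B j) (S x)) by (intros x; apply (hB_dom j Hj), HSA).
  apply (is_linear_build _ CB); unfold LB.
  - intros x y; rewrite (linear_plus S HS); apply op_plus; apply HD.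
  - intros k x; rewrite linear_scal' by assumption; apply op_scal; apply HD.
  - intros x; eapply Rle_trans; [apply HCBb, HSA|]; rewrite (proj2 (HSA x)); lra. }
assert (HLex : forall j, exists L : H -> H, (1 <= j <= m)%nat ->
  is_linear L /\ forall x, dom A x -> L x = S (B j x)).
{ intros j; destruct (classic ((1 <= j <= m)%nat)) as [Hj|Hj];
    [|exists (fun x => x); tauto].
  destruct (dominates_dual_bound A (B j) S hA_sa HSA (hAB j Hj)) as (CB & HCB & HCBb).
  destruct (bounded_extension A E E' hA_pos hE hE' (fun x => S (B j x)) CB) as (L & HL);
    try lra; try assumption.
  - intros x y Hx Hy; rewrite op_plus by now apply (hB_dom j Hj).
    apply (linear_plus S HS).
  - intros k x Hx; rewrite op_scal by now apply (hB_dom j Hj).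
    now apply linear_scal'.
  - now exists L. }
set (L := fun j => proj1_sig (constructive_indefinite_description _ (HLex j))).
assert (HLj : forall j, (1 <= j <= m)%nat ->
  is_linear (L j) /\ forall x, dom A x -> L j x = S (B j x))
  by (intros j; apply (proj2_sig (constructive_indefinite_description _ (HLex j)))).
assert (HL : forall j, (1 <= j <= m)%nat -> is_linear (L j)) by (intros j Hj; now apply HLj).
assert (HSL : forall j, (1 <= j <= m)%nat -> forall x, S (LB j x) = L j (S x)).
{ intros j Hj x; unfold LB; symmetry; apply (proj2 (HLj j Hj)), HSA. }
assert (Hgb : forall t, 0 < t <= T -> norm (g' t) <= C * Rpower t (a - 1)).
{ intros t Ht; destruct (Hdata t Ht) as [_ Hd].
  pose proof (norm_ge_0 (E' t (minus (A u0) (g 0)))); pose proof (norm_ge_0 (g'' t)); nra. }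
assert (Hgb' : forall t, 0 < t <= T -> t * norm (g'' t) <= C * Rpower t (a - 1)).
{ intros t Ht; destruct (Hdata t Ht) as [_ Hd].
  pose proof (norm_ge_0 (E' t (minus (A u0) (g 0)))); pose proof (norm_ge_0 (g' t)); lra. }
assert (HEb : forall t, 0 < t <= T -> norm (E' t x0) <= C * Rpower t (a - 1)).
{ intros t Ht; destruct (Hdata t Ht) as [_ Hd].
  pose proof (norm_ge_0 (g' t)); pose proof (norm_ge_0 (g'' t)).
  unfold x0, w0; nra. }
(* The first term covers g' clamped at T, and E' x0 up to T. The second covers E' x0 on (T,T1),
   where |E' x0| <= |x0| / T and 1 <= T1^(1-a) t^(a-1). *)
set (M := C * Rpower (T / T1) (a - 1) + norm x0 * / T * Rpower T1 (1 - a)).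
pose proof (Rpower_pos (T / T1) (a - 1)) as Hp1.
pose proof (Rpower_pos T1 (1 - a)) as Hp2.
pose proof (norm_ge_0 x0) as Hx0.
assert (0 < / T) as HiT by (apply Rinv_0_lt_compat; lra).
assert (0 <= norm x0 * / T * Rpower T1 (1 - a)) as Hp3
  by (apply Rmult_le_pos; [apply Rmult_le_pos|]; lra).
assert (0 <= C * Rpower (T / T1) (a - 1)) as Hp4 by (apply Rmult_le_pos; lra).
assert (HM : 0 <= M) by (unfold M; lra).
assert (Hratio : 1 <= Rpower (T / T1) (a - 1)).
{ rewrite <- (Rpower_base_1 (a - 1)) at 1.
  apply Rpower_le_neg; [|lra]; split; [apply Rdiv_lt_0_compat; lra|].
  apply (Rmult_le_reg_r T1); [lra|].
  replace (T / T1 * T1) with T by (field; lra); unfold T1; lra. }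
assert (Hg1 : holder a T1 M (fun t => g' (Rmin t T))).
{ apply (clamp_holder T a T1 C M g' g''); try assumption; try lra.
  - unfold T1; lra.
  - unfold M; lra. }
assert (HE1 : forall t, 0 < t < T1 -> norm (E' t x0) <= M * Rpower t (a - 1)).
{ intros t Ht; pose proof (Rpower_pos t (a - 1)).
  destruct (Rle_lt_dec t T) as [HtT|HtT].
  - eapply Rle_trans; [apply HEb; lra|]; apply Rmult_le_compat_r; [lra|].
    unfold M; nra.
  - destruct (E'_eq A E E' hE hE' t x0 ltac:(lra)) as [_ ->]; rewrite hnorm_opp.
    eapply Rle_trans; [apply (AE_bound A E E' hA_sa hA_pos hE hE'); lra|].
    assert (/ t <= / T) by (apply Rinv_le_contravar; lra).
    pose proof (Rpower_weaken a T1 1 t ltac:(lra) Ht) as Hw.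
    replace (1 - 1) with 0 in Hw by ring; rewrite Rpower_O in Hw by lra.
    apply Rle_trans with (norm x0 * / T * (Rpower T1 (1 - a) * Rpower t (a - 1))).
    + assert (0 <= norm x0 * / T) by (apply Rmult_le_pos; lra).
      apply Rle_trans with (norm x0 * / T); [nra|].
      rewrite <- (Rmult_1_r (norm x0 * / T)) at 1; now apply Rmult_le_compat_l.
    + rewrite <- Rmult_assoc; apply Rmult_le_compat_r; [lra|unfold M; lra]. }
destruct (regular_exists A E E' S hA_sa hA_pos HSA HAS HSc hE hE' a T1 Ha HT1 c alpha LB kappa m
  Hb HLB M (fun t => g' (Rmin t T)) x0 w0 HM Hg1 HE1)
  as (y & My & HMy & Hy & Hdy & Hylim).
set (z := fun t => S (y t)).
pose proof (bounded_fn_linear a T1 My CS S y (Rlt_le _ _ HCS) HS HCSb Hy) as Hz; fold z in Hz.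
assert (HMz : 0 <= CS * My) by nra.
(* The candidate solution: its derivative is z, and A z = y. *)
set (V := fun t => plus u0 (Int z t)).
assert (HV : forall t, 0 < t < T1 -> is_derive V t (z t)).
{ intros t Ht; replace (z t) with (plus zero (z t) : H) by hring.
  apply (is_derive_plus (fun _ => u0) (Int z)); [exact (is_derive_const u0 t)|].
  apply (Int_derive T1 a (CS * My)); try assumption; apply Ha. }
assert (HIb : forall t, 0 < t < T1 -> norm (Int z t) <= CS * My * (2 / a) * Rpower t a).
{ intros t Ht; now apply (Int_dominated T1 a (CS * My)). }
assert (H2a : 0 < 2 / a) by (apply Rdiv_lt_0_compat; lra).
assert (HMI : 0 <= CS * My * (2 / a)) by (apply Rmult_le_pos; lra).
destruct hv as (Hvc & Hv0 & Hveq).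
destruct (continuous_on_bounded T v hT Hvc) as (Mv & HMv & Hvb).
(* The comparison runs on (0,T), where v satisfies the equation and the clamped g' agrees with
   g'. *)
assert (HvV : forall t, 0 < t < T -> v t = V t).
{ apply (comparison A E E' S hA_sa hA_pos HSA HAS HSc hE hE' a T Ha hT c alpha LB L kappa m
    Hb HLB HL HSL y g g' v V My Mv (norm u0 + CS * My * (2 / a) * Rpower T1 a) w0 (g 0));
    try assumption.
  - pose proof (norm_ge_0 u0); pose proof (Rpower_pos T1 a); nra.
  - destruct Hy as [Hyc Hyb]; split; intros t Ht; [apply Hyc|apply Hyb]; unfold T1; lra.
  - intros t Ht; pose proof (Hdy t ltac:(unfold T1; lra)) as Hd.
    rewrite Rmin_left in Hd by lra; exact Hd.
  - intros t Ht; apply (is_derive_of_is_deriv_on T); [assumption|apply hg'; lra].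
  - now apply (continuous_on_lim_0 T).
  - intros t Ht; apply HV; unfold T1; lra.
  - intros t Ht; eapply Rle_trans; [apply hnorm_triangle|]; apply Rplus_le_compat_l.
    eapply Rle_trans; [apply HIb; unfold T1; lra|].
    apply Rmult_le_compat_l; [assumption|]; apply Rle_Rpower_l; unfold T1; lra.
  - rewrite HSw0; replace u0 with (plus u0 zero : H) at 1 by hring.
    apply filterlim_hplus; [apply filterlim_const|].
    apply (lim_0_of_bound a Ha (CS * My * (2 / a)) T1); assumption.
  - intros t Ht; now apply (continuous_on_interior T).
  - intros t Ht; apply Hvb; lra.
  - rewrite HSw0, <- Hv0; now apply (continuous_on_lim_0 T).
  - intros t Ht; destruct (Hveq t ltac:(lra)) as (Hdom & dv & I & Hdv & HI & Heq).
    pose proof (is_derive_of_is_deriv_on T v t dv Ht Hdv) as Hdv'.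
    (* S passes through the improper integrals and turns S B_j v into L_j v, since v s lies in
       [dom A] for s > 0. *)
    assert (is_int (fun s => memory c alpha L m (t - s) (v s)) t
      (sum_n_m (fun j => S (I j)) 1 m)) as HIm.
    { apply memory_is_int; [lra|]; intros j Hj.
      apply (is_int_ext (fun s => S (scal (omega (alpha j) (t - s)) (B j (v s))))); [lra| |].
      - intros s Hs; rewrite linear_scal' by assumption.
        destruct (Hveq s ltac:(lra)) as [Hds _].
        rewrite (proj2 (HLj j Hj)) by assumption; f_equal.
        unfold omega, pow_kernel, c, Rdiv; ring.
      - apply (is_int_linear S); [assumption|exact (HI j Hj)]. }
    rewrite <- (linear_sum S I m HS) in HIm.
    eapply is_derive_Heq; [apply (linear_derive S); [assumption|exact Hdv']|].
    unfold conv; rewrite (is_int_unique _ _ _ HIm), <- Heq.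
    rewrite !(linear_minus S), !(linear_plus S), (linear_scal' S) by assumption.
    rewrite (HAS (v t) Hdom); hring. }
(* The end point T is added by continuity of v and V. *)
assert (HvV' : forall t, 0 < t <= T -> v t = V t).
{ intros t Ht; destruct (Req_dec t T) as [->|Hne]; [|apply HvV; lra].
  assert (norm (minus (v T) (V T)) <= 0) as Hle.
  { apply Rnot_lt_le; intros Hlt; set (e := norm (minus (v T) (V T)) / 2).
    assert (0 < e) as He by (unfold e; lra).
    destruct (continuous_on_segment T v T Hvc ltac:(lra) e He) as (d1 & Hd1 & Hc1).
    assert (continuous V T) as HVc by (apply (continuous_derive V T (z T)), HV; unfold T1; lra).
    destruct (proj1 (continuous_hnorm _ _) HVc e He) as (d2 & Hd2 & Hc2).
    set (d := Rmin (Rmin d1 d2) T).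
    assert (0 < d) by (repeat apply Rmin_pos; lra).
    assert (d <= d1 /\ d <= d2 /\ d <= T) as (D1 & D2 & D3).
    { unfold d; rmin_bounds; repeat split; lra. }
    set (s := T - d / 2).
    assert (Rabs (s - T) < d) by (apply Rabs_def1; unfold s; lra).
    pose proof (Hc1 s ltac:(unfold s; lra) ltac:(lra)) as E1.
    pose proof (Hc2 s ltac:(lra)) as E2.
    rewrite (HvV s) in E1 by (unfold s; lra).
    pose proof (norm_minus_tri (v T) (V s) (V T)) as E3.
    rewrite (norm_minus_sym (v T) (V s)) in E3; unfold e in *; lra. }
  assert (minus (v T) (V T) = zero) as E0.
  { apply (norm_eq_zero (minus (v T) (V T))); pose proof (norm_ge_0 (minus (v T) (V T))); lra. }
  replace (v T) with (plus (minus (v T) (V T)) (V T)) by hring; rewrite E0; hring. }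
(* The candidate for v'', read off from the differentiated equation. *)
set (zd := fun t : R => (plus (minus (minus (minus (g' (Rmin t T)) (memory c alpha LB m t w0)) (y t))
  (conv (memory c alpha LB m) y t)) (scal kappa (z t))) : H).
destruct (memory_kernel a T1 c alpha LB m HLB (fun j Hj => proj1 (Hb j Hj)))
  as (N & HN & Hk).
assert (Hzd : exists Mz, bounded_fn a T1 Mz zd).
{ eexists; apply bounded_fn_plus; [apply bounded_fn_minus; [apply bounded_fn_minus;
    [apply bounded_fn_minus|]|]|].
  - apply Hg1.
  - apply (kernel_apply a T1 N); exact Hk.
  - exact Hy.
  - apply (conv_bounded_fn a T1 Ha N My); assumption.
  - apply (bounded_fn_linear a T1 (CS * My) (Rabs kappa) (fun x : H => scal kappa x));
      [apply Rabs_pos|apply scal_linear| |exact Hz].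
    intros x; rewrite hnorm_scal; lra. }
destruct Hzd as [Mz Hzd].
exists z, zd; split.
- intros t Ht; split; [|split].
  + apply (is_deriv_on_of_is_derive T v V); [assumption|assumption|].
    apply HV; unfold T1; lra.
  + apply (is_deriv_on_of_is_derive T z z); [assumption|reflexivity|].
    apply Hdy; unfold T1; lra.
  + apply HSA.
- assert (Hw0 : 0 < norm w0).
  { destruct (Rle_lt_dec (norm w0) 0) as [Hle|]; [exfalso|assumption].
    apply hu0_neq0; rewrite <- HSw0.
    assert (w0 = zero) as ->; [|now apply linear_zero'].
    apply (norm_eq_zero w0); pose proof (norm_ge_0 w0); lra. }
  (* The bound obtained does not carry |A u0|, so this factor is divided out. The sign of Mz is
     unknown, hence [Rabs], and the 1 makes the constant positive. *)
  exists ((Rabs Mz + My + 1) / norm w0); split.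
  { apply Rdiv_lt_0_compat; [pose proof (Rabs_pos Mz); lra|assumption]. }
  intros t Ht; simpl; fold w0.
  assert (Ht1 : 0 < t < T1) by (unfold T1; lra).
  unfold z at 1; rewrite (proj2 (HSA (y t))).
  pose proof (proj2 Hzd t Ht1) as B1; pose proof (proj2 Hy t Ht1) as B2.
  pose proof (Rpower_pos t (a - 1)); pose proof (Rle_abs Mz).
  replace ((Rabs Mz + My + 1) / norm w0 * Rpower t (a - 1) * norm w0) with
    ((Rabs Mz + My + 1) * Rpower t (a - 1)) by (field; lra).
  nra.
Qed.
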